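(* Let $F$ be a regularly varying function such that \[ \frac{F(x)}{\log x}\xrightarrow{x\to\infty}\infty \quad\text{and}\quad F(x)\le (1+o(1))\,\frac{1}{(h-1)!}\,\frac{x^{h-1}}{b_1\cdots b_h}. \] Then there exists $A\subseteq\mathbb{Z}_{\ge 0}$ such that $r_{A,h}(n)\sim F(n)$ as $n\to\infty$.
   Context: Fix an integer $h\ge 2$ and positive integers $b_1,\dots,b_h$, not necessarily distinct, with $\gcd(b_1,\dots,b_h)=1$. For $A\subseteq\mathbb{Z}_{\ge 0}$, $1\le\ell\le h$ and an integer $n\ge 0$, let $r_{A,\ell}(n)$ be the number of $\ell$-tuples $(k_1,\dots,k_\ell)\in A^\ell$ with $b_1k_1+\cdots+b_\ell k_\ell=n$. A function $F$ is regularly varying if it is a positive measurable function on $[1,\infty)$ such that for every real $\lambda>0$ the limit $\lim_{x\to\infty}F(\lambda x)/F(x)$ exists and is finite and positive. $X\sim Y$ means $X/Y\to1$. *)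

(* Defs.v *)
From HB Require Import structures.
From mathcomp Require Import all_boot all_order all_algebra.
From mathcomp Require Import all_classical all_reals all_analysis.
From mathcomp Require Import measurable_realfun.
Set Implicit Arguments. Unset Strict Implicit. Unset Printing Implicit Defensive.
Import Order.TTheory GRing.Theory Num.Theory numFieldNormedType.Exports.
Local Open Scope classical_set_scope.
Local Open Scope ring_scope.

(* r_{A,h}(n): number of h-tuples (k_1,..,k_h) in A^h with
   b_1 k_1 + ... + b_h k_h = n.  Since every b_i >= 1 (standing assumption),
   any such k_i satisfies k_i <= n, so tuples are enumerated in 'I_(n+1)^h. *)
Definition rep_count (h : nat) (b : 'I_h -> nat) (A : pred nat) (n : nat) : nat :=
  #|[set k : {ffun 'I_h -> 'I_n.+1} |
     [forall i, A (k i)] && ((\sum_(i < h) b i * k i)%N == n)]|.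

(* Lebesgue measurable subsets of R: the completed (Lebesgue) sigma-algebra,
   i.e. the sigma-algebra generated by sets (Borel set) U (Lebesgue-null set). *)
Definition lebesgue_measurable_set (R : realType) (E : set R) : Prop :=
  (completed_algebra_gen (@lebesgue_measure R)).-sigma.-measurable E.

Definition measurable_on_ge1 (R : realType) (F : R -> R) : Prop :=
  forall B : set R, measurable B ->
    lebesgue_measurable_set ([set x | 1 <= x] `&` F @^-1` B).

Definition regularly_varying (R : realType) (F : R -> R) : Prop :=
  (forall x : R, 1 <= x -> 0 < F x) /\
  measurable_on_ge1 F /\
  (forall lam : R, 0 < lam ->
     exists2 L : R, 0 < L & (F (lam * x) / F x) @[x --> +oo%R] --> (L : R)).

(* Main.v *)
(* Let A be a random set containing each k independently with probability p k, where p is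
   regularly varying and normalised so that the expected number of representations of n is
   asymptotic to F n.  That number is an h-fold convolution of p.  Off the ends a
   convolution of regularly varying sequences only depends on the indices, so its
   asymptotics can be read off from Vandermonde's identity for the coefficients of
   (1 - X)^(-(s+1)); gcd b = 1 removes the arithmetic obstruction.  The growth of F keeps
   the index of p above -1, and the upper bound on F is what allows p <= 1.

   Representations with a repeated entry or through a prescribed element solve an equation
   in fewer unknowns, and there are at most O(n^theta) of them, with n^theta log n = o(F n).
   The lower tail is then Janson's inequality.  A surplus of representations forces many
   pairwise disjoint ones, and the expected number of disjoint M-tuples is at most the M-th
   power of the mean, which bounds the upper tail.  Both tails are summable in n, so a
   finite set works up to any N, and compactness provides A. *)

Require Import Defs.
From mathcomp Require Import all_boot all_order all_algebra.
From mathcomp Require Import all_classical all_reals all_analysis.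
From mathcomp Require Import measurable_realfun lra ring zify.
Set Implicit Arguments. Unset Strict Implicit. Unset Printing Implicit Defensive.
Import Order.TTheory GRing.Theory Num.Theory numFieldNormedType.Exports.
Local Open Scope classical_set_scope.
Local Open Scope ring_scope.

(** * The uniform convergence theorem for regularly varying functions *)

Section lebesgue.
Variable R : realType.
Local Notation mu := (@lebesgue_measure R).

Lemma lebesgue_measure_dilation (l : R) (A : set R) : 0 < l -> measurable A ->
  mu ((fun x => l * x) @^-1` A) = ((l^-1)%:E * mu A)%E.
Proof.
move=> l0 mA; have l0' : 0 <= l by exact: ltW.
pose dil : measurableTypeR R -> measurableTypeR R := fun x => l * x.
have mdil : measurable_fun [set: measurableTypeR R] dil by exact: measurable_funM.
have := @lebesgue_measure_unique R (mscale (NngNum l0') (pushforward mu dil)).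
move=> /(_ mdil _ A mA) ->; last first.
  move=> _ [[a b]] _ <-.
  change (mu `]a, b]%classic = (l%:E * mu (dil @^-1` `]a, b]%classic))%E).
  have -> : dil @^-1` `]a, b] = `](a / l), (b / l)]%classic.
    by apply/seteqP; split => x /=; rewrite !in_itv/= ltr_pdivrMr// ler_pdivlMr// (mulrC x).
  rewrite !lebesgue_measure_itv/= !lte_fin ltr_pM2r ?invr_gt0//.
  case: ifPn => _; last by rewrite mule0.
  by rewrite -!EFinD -EFinM -mulrBl mulrCA mulfV ?mulr1// lt0r_neq0.
by rewrite /mscale /= /pushforward muleA -EFinM mulVf ?mul1e// lt0r_neq0.
Qed.

Lemma completed_measurable_fun (D : set R) (F : R -> R) :
  (forall B : set R, measurable B -> lebesgue_measurable_set (D `&` F @^-1` B)) ->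
  exists Z : set R, [/\ measurable Z, mu Z = 0%E & measurable_fun (D `\` Z) F].
Proof.
move=> mF; pose q (n : nat) : rat := odflt 0 (unpickle n).
have /choice[AZ AZ_approx] (n : nat) : exists AZ : set R * set R, [/\ measurable AZ.1,
    measurable AZ.2, mu AZ.2 = 0%E &
    (D `&` F @^-1` `]-oo, ratr (q n)[%classic) `\` AZ.2 = AZ.1 `\` AZ.2].
  have := mF `]-oo, ratr (q n)[%classic (measurable_itv _).
  rewrite /lebesgue_measurable_set g_sigma_completed_algebra_genE.
  move=> [A mA [N [Z [mZ Z0 NZ]]] <-]; exists (A, Z); split => //=.
  by apply/seteqP; split => x /= [] => [[|/NZ]//|Ax nZx]; split => //; left.
pose Z := \bigcup_n (AZ n).2.
have mZ : measurable Z by apply: bigcupT_measurable => n; case: (AZ_approx n).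
exists Z; split => //.
  apply/negligibleP => //; apply: negligible_bigcup => n.
  by apply/negligibleP; case: (AZ_approx n).
apply: (measurability _ (RGenInftyO.measurableE R)) => _ [_ [r ->] <-].
have -> : (D `\` Z) `&` F @^-1` `]-oo, r[ =
    \bigcup_n (if ratr (q n) < r then (AZ n).1 `\` Z else set0).
  apply/seteqP; split => x /=; rewrite in_itv/=.
    move=> [[Dx nZx]] /rat_in_itvoo[y]; rewrite in_itv/= => /andP[Fy yr].
    have qy : q (pickle y) = y by rewrite /q pickleK.
    exists (pickle y) => //; rewrite qy yr; split => //.
    have [_ _ _ /seteqP[/(_ x) + _]] := AZ_approx (pickle y); rewrite /= in_itv/= qy.
    by case=> //; split => // Ax; apply: nZx; exists (pickle y).
  move=> [n _]; case: ifPn => // qr [Ax nZx].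
  have [_ _ _ /seteqP[_ /(_ x)]] := AZ_approx n; rewrite /= in_itv/=.
  case=> [|[Dx Fq] _]; first by split => // ?; apply: nZx; exists n.
  by do !split => //; exact: lt_trans qr.
apply: bigcupT_measurable => n; case: ifPn => // _.
by apply: measurableD => //; case: (AZ_approx n).
Qed.

Lemma exists_dilation_avoiding (l eta : R) (B1 B2 : set R) :
  0 < eta -> eta <= l <= 1 -> measurable B1 -> measurable B2 ->
  (mu B1 < (eta / 4)%:E)%E -> (mu B2 < (eta / 4)%:E)%E ->
  exists v : R, [/\ 1 <= v <= 2 / eta, 1 <= l * v <= 2 / eta, ~ B2 v & ~ B1 (l * v)].
Proof.
move=> eta0 /andP[el l1] mB1 mB2 B1e B2e.
have l0 : 0 < l by exact: lt_le_trans el.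
have lV1 : 1 <= l^-1 by rewrite invf_ge1.
have le_eV : l^-1 <= eta^-1 by rewrite lef_pV2.
pose bad := B2 `|` (fun v => l * v) @^-1` B1.
have mpre : measurable ((fun v => l * v) @^-1` B1).
  by rewrite -[X in measurable X]setTI; exact: (@measurable_funM _ _ R setT (cst l) id).
have bad_lt : (mu bad < mu `[l^-1%R, (2 / eta)%R]%classic)%E.
  apply: (@le_lt_trans _ _ (mu B2 + mu ((fun v => (l * v)%R) @^-1` B1))%E); first exact: measureU2.
  rewrite lebesgue_measure_dilation// lebesgue_measure_itv/= lte_fin ifT; last lra.
  apply: (@lt_le_trans _ _ ((eta / 4)%:E + (l^-1)%:E * (eta / 4)%:E)%E).
    by apply: lteD => //; rewrite lte_pmul2l ?lte_fin ?invr_gt0.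
  rewrite -EFinM -!EFinD lee_fin.
  have : l^-1 * eta <= 1 by rewrite mulrC ler_pdivrMr// mul1r.
  lra.
have [v vI nbad] : exists2 v, v \in `[l^-1, 2 / eta] & ~ bad v.
  apply: contrapT => nv; move: bad_lt; apply/negP; rewrite -leNgt.
  have sub : `[l^-1, 2 / eta]%classic `<=` bad.
    by move=> v /= vI; apply: contrapT => nbad; apply: nv; exists v.
  by apply: le_measure => //; rewrite inE; [exact: measurable_itv|exact: measurableU].
move: vI; rewrite in_itv/= => /andP[v1 v2].
have v0 : 0 < v by lra.
exists v; split; [lra| |by move=> ?; apply: nbad; left|by move=> ?; apply: nbad; right].
apply/andP; split; first by rewrite mulrC -ler_pdivrMr// mul1r.
by apply: le_trans v2; rewrite ler_piMl// ltW.
Qed.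

End lebesgue.

Section egorov.
Context d (R : realType) (T : measurableType d) (mu : {measure set T -> \bar R}).

Lemma almost_uniform_dist (f : nat -> T -> R) (g : T -> R) (A : set T) (e : R) :
  (forall n, measurable_fun A (f n)) -> measurable A -> (mu A < +oo)%E ->
  (forall x, A x -> f ^~ x @ \oo --> g x) -> 0 < e ->
  exists B : set T, [/\ measurable B, (mu B < e%:E)%E &
    forall eps, 0 < eps -> \forall n \near \oo, forall x, A x -> ~ B x -> `|f n x - g x| < eps].
Proof.
move=> mf mA Afin fg e0.
have [B [mB Be uB]] := pointwise_almost_uniform mf mA Afin fg e0.
exists B; split => // eps eps0.
have : nbhs (g : {uniform` (A `\` B) -> R}) [set h | forall y, (A `\` B) y -> `|h y - g y| < eps].
  apply/uniform_nbhs; exists [set xy | `|xy.1 - xy.2| < eps]; split.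
    by rewrite -entourage_ballE; exists eps.
  by move=> h /= h_close y /h_close /=; rewrite distrC.
by move=> /uB[N _ fg_close]; exists N => // n /fg_close close x Ax nBx; exact: close.
Qed.

(* Egorov applied to g / (n + 1), which tends to 0 pointwise. *)
Lemma measurable_fun_bounded_off (g : T -> R) (A : set T) (e : R) :
  measurable_fun A g -> measurable A -> (mu A < +oo)%E -> 0 < e ->
  exists B : set T, [/\ measurable B, (mu B < e%:E)%E &
    exists K, forall x, A x -> ~ B x -> `|g x| <= K].
Proof.
move=> mg mA Afin e0; pose f n x := n.+1%:R^-1 * g x.
have mf n : measurable_fun A (f n) by exact: measurable_funM.
have f0 x : A x -> f ^~ x @ \oo --> (0 : R).
  by move=> _; rewrite -(mul0r (g x)); apply: cvgMr_tmp; exact: cvg_harmonic.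
have [B [mB Be uB]] := almost_uniform_dist mf mA Afin f0 e0; exists B; split => //.
have [N _ /(_ N (leqnn N)) f_small] := uB _ ltr01; exists N.+1%:R => x Ax nBx.
have := f_small x Ax nBx; rewrite subr0 /f normrM normfV normr_nat.
by rewrite mulrC ltr_pdivrMr// mul1r => /ltW.
Qed.

End egorov.

Section cauchy_equation.
Variable R : realType.

Lemma additive_bounded_linear (f : R -> R) (M : R) : {morph f : s t / s + t} ->
  (forall t, -1 <= t <= 0 -> `|f t| <= M) -> forall t, f t = t * f 1.
Proof.
move=> fD fM; pose D t := f t - t * f 1.
have DD : {morph D : s t / s + t} by move=> s t; rewrite /D fD; ring.
have D0 : D 0 = 0 by have := DD 0 0; rewrite addr0; lra.
have DN t : D (- t) = - D t by have := DD t (- t); rewrite subrr D0; lra.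
have Dn n t : D (n%:R * t) = n%:R * D t.
  elim: n => [|n IH]; first by rewrite !mul0r D0.
  by rewrite -natr1 mulrDl mul1r DD IH; ring.
have Dnat (n : nat) : D n%:R = 0 by rewrite -[n%:R]mulr1 Dn /D mul1r subrr mulr0.
have Dint (z : int) t : D (t + z%:~R) = D t.
  by case: z => n; rewrite ?NegzE ?mulrNz DD ?DN Dnat ?oppr0 addr0.
have Dbd t : `|D t| <= M + `|f 1|.
  rewrite -(Dint (- (Num.floor t + 1)) t).
  have := floor_itv t => /andP[]; rewrite intrN intrD => ? ?.
  have tI : -1 <= t - ((Num.floor t)%:~R + 1%:~R) <= 0 by apply/andP; split; lra.
  apply: (le_trans (ler_normB _ _)); apply: lerD; first exact: fM.
  by rewrite normrM ler_piMl// ler_norml; lra.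
move=> t; suff : D t = 0 by rewrite /D; lra.
apply/eqP; rewrite -normr_le0 leNgt; apply/negP => Dt.
have := Dbd ((Num.truncn ((M + `|f 1|) / `|D t|)).+1%:R * t).
rewrite Dn normrM normr_nat leNgt -ltr_pdivrMr// => /negP; apply; exact: truncnS_gt.
Qed.

Lemma additive_bounded_ln (g : R -> R) (K : R) :
  (forall x y : R, 0 < x -> 0 < y -> g (x * y) = g x + g y) ->
  (forall l, 2^-1 <= l <= 1 -> `|g l| <= K) ->
  forall l : R, 0 < l -> g l = g (expR 1) * ln l.
Proof.
move=> gM gK l l0; pose f t := g (expR t).
have fD : {morph f : s t / s + t} by move=> s t; rewrite /f expRD gM ?expR_gt0.
have f_bounded t : -1 <= t <= 0 -> `|f t| <= K + K.
  move=> /andP[t1 t0]; have half : `|f (t / 2)| <= K.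
    by apply: gK; rewrite expR_le1; have := expR_ge1Dx (t / 2); lra.
  by rewrite [t]splitr fD; apply: (le_trans (ler_normD _ _)); exact: lerD.
by have := additive_bounded_linear fD f_bounded (ln l); rewrite /f lnK// mulrC.
Qed.

End cauchy_equation.

Section uniform_convergence.
Variables (R : realType) (F : R -> R).
Local Notation mu := (@lebesgue_measure R).

Definition log_ratio (l x : R) : R := ln (F (l * x)) - ln (F x).

Lemma log_ratio_cvg : regularly_varying F ->
  exists g : R -> R, forall l, 0 < l -> log_ratio l x @[x --> +oo] --> g l.
Proof.
move=> [Fpos [_ FL]].
have /choice[L L_lim] (l : R) : exists y : R, 0 < l -> log_ratio l x @[x --> +oo] --> y.
  have [l0|] := boolP (0 < l); last by exists 0.
  have [y y0 Fy] := FL l l0; exists (ln y) => _.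
  have : ln (F (l * x) / F x) @[x --> +oo] --> ln y.
    exact: (@cvg_comp _ _ _ (fun x => F (l * x) / F x) (@ln R) _ _ _ Fy (continuous_ln y0)).
  apply: cvg_trans; apply: near_eq_cvg; near=> x.
  have x1 : 1 <= x by near: x; apply: nbhs_pinfty_ge; rewrite num_real.
  have lx : 1 <= l * x.
    rewrite -ler_pdivrMl// mulr1; near: x; apply: nbhs_pinfty_ge; rewrite num_real//.
  by rewrite /log_ratio ln_div// ?posrE ?Fpos.
by exists L.
Unshelve. all: by end_near. Qed.

Variable g : R -> R.
Hypothesis cvg_g : forall l, 0 < l -> log_ratio l x @[x --> +oo] --> g l.

Lemma log_ratio_lim_mul x y : 0 < x -> 0 < y -> g (x * y) = g x + g y.
Proof.
move=> x0 y0; have xy0 : 0 < x * y by rewrite mulr_gt0.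
have cvg_y : y * z @[z --> +oo] --> +oo by apply/cvgryPge => C; near=> z; rewrite -ler_pdivrMl.
have cvg_xy : log_ratio x (y * z) @[z --> +oo] --> g x.
  exact: (@cvg_comp _ _ _ (fun z => y * z) (log_ratio x) _ _ _ cvg_y (cvg_g x0)).
have /cvg_lim <- // := cvg_g xy0; apply: cvg_lim => //.
apply: cvg_trans (cvgD cvg_xy (cvg_g y0)); apply: near_eq_cvg; near=> z.
by rewrite /log_ratio /= -[LHS]/(_ + _) mulrA; ring.
Unshelve. all: by end_near. Qed.

Hypothesis mF : measurable_on_ge1 F.

Section along_a_sequence.
Variable x : nat -> R.
Hypotheses (x1 : forall n, 1 <= x n) (x_cvg : x @ \oo --> +oo).

Lemma log_ratio_seq_cvg l : 0 < l -> (fun n => log_ratio l (x n)) @ \oo --> g l.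
Proof. by move=> l0; exact: (@cvg_comp _ _ _ x (log_ratio l) _ _ _ x_cvg (cvg_g l0)). Qed.

Lemma measurable_log_ratio : exists Z : set R, [/\ measurable Z, mu Z = 0%E &
  forall n (E : set R), measurable E -> E `<=` `[1, +oo[ ->
    measurable_fun (E `\` Z) (fun u => log_ratio u (x n))].
Proof.
have [Z [mZ Z0 mFZ]] := completed_measurable_fun mF.
have x0 n : 0 < x n by exact: lt_le_trans (x1 n).
have mdil n : measurable_fun setT (fun u : R => x n * u) by exact: measurable_funM.
have mZn n : measurable ((fun u => x n * u) @^-1` Z).
  by rewrite -[X in measurable X]setTI; exact: mdil.
exists (\bigcup_n ((fun u => x n * u) @^-1` Z)); split.
- exact: bigcupT_measurable.
- apply/negligibleP; first exact: bigcupT_measurable.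
  apply: negligible_bigcup => n; apply/negligibleP; first exact: mZn.
  by rewrite [LHS](lebesgue_measure_dilation (x0 n) mZ) Z0 mule0.
move=> n E mE E1; apply: measurable_funB => //; apply: measurableT_comp; first exact: measurable_ln.
have mge1 : measurable ([set y : R | 1 <= y] `\` Z).
  apply: measurableD => //; rewrite (_ : mkset _ = `[1, +oo[%classic); first exact: measurable_itv.
  by apply/seteqP; split => y /=; rewrite in_itv/= andbT.
rewrite (_ : (fun u => F (u * x n)) = F \o (fun u => x n * u)); last first.
  by apply/funext => u; rewrite /= mulrC.
apply: (measurable_comp mge1 _ mFZ); last exact: measurable_funTS.
move=> _ [u [Eu nZu] <-]; split; last by move=> Zu; apply: nZu; exists n.
by move: (E1 u Eu); rewrite /= in_itv/= andbT => u1; rewrite -[1]mulr1 ler_pM.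
Qed.

Lemma log_ratio_almost_uniform (M d : R) : 0 < d ->
  exists B : set R, [/\ measurable B, (mu B < d%:E)%E,
    exists K, forall u, 1 <= u <= M -> ~ B u -> `|g u| <= K &
    forall e, 0 < e -> \forall n \near \oo, forall u, 1 <= u <= M -> ~ B u ->
      `|log_ratio u (x n) - g u| < e].
Proof.
move=> d0; have [Z [mZ Z0 mlr]] := measurable_log_ratio.
pose A := `[1, M]%classic `\` Z.
have mA : measurable A by exact: measurableD.
have Afin : (mu A < +oo)%E.
  apply: (@le_lt_trans _ _ (mu `[1, M]%classic)).
    by apply: le_measure; rewrite ?inE//; exact: subDsetl.
  by rewrite lebesgue_measure_itv/=; case: ifPn; rewrite ?ltry// -EFinD ltry.
have mf n : measurable_fun A (fun u => log_ratio u (x n)).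
  by apply: mlr => // u /=; rewrite !in_itv/= andbT => /andP[].
have fg u : A u -> (fun n => log_ratio u (x n)) @ \oo --> g u.
  by move=> [/= + _]; rewrite in_itv/= => /andP[u1 _]; apply: log_ratio_seq_cvg; lra.
have mg : measurable_fun A g by exact: measurable_fun_cvg fg.
have d20 : 0 < d / 2 by rewrite divr_gt0.
have [B1 [mB1 B1d unif]] := almost_uniform_dist (mu := mu) mf mA Afin fg d20.
have [B2 [mB2 B2d [K gK]]] := measurable_fun_bounded_off (mu := mu) mg mA Afin d20.
have inA u : 1 <= u <= M -> ~ (B1 `|` B2 `|` Z) u -> [/\ A u, ~ B1 u & ~ B2 u].
  move=> uM nB; split; last 2 first.
  - by move=> ?; apply: nB; left; left.
  - by move=> ?; apply: nB; left; right.
  by split; [rewrite /= in_itv|move=> ?; apply: nB; right].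
exists (B1 `|` B2 `|` Z); split.
- by do !apply: measurableU.
- rewrite measureU0//; last exact: measurableU.
  apply: (le_lt_trans (measureU2 _ mB1 mB2)).
  by rewrite [d]splitr EFinD lteD.
- by exists K => u uM /(inA _ uM)[Au _ nB2]; exact: gK.
- move=> e e0; apply: filterS (unif e e0) => n g_close u uM /(inA _ uM)[Au nB1 _].
  exact: g_close.
Qed.

End along_a_sequence.

Lemma log_ratio_lim_bounded : exists K, forall l, 2^-1 <= l <= 1 -> `|g l| <= K.
Proof.
have half0 : (0 : R) < 2^-1 by rewrite invr_gt0.
have x1 n : 1 <= n.+1%:R :> R by rewrite ler1n.
have x_cvg : (fun n => n.+1%:R : R) @ \oo --> +oo.
  by apply: cvg_comp (@cvg_addnl 1) _; exact: cvgr_idn.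
have [|B [mB Bd [K g_le] _]] := log_ratio_almost_uniform x1 x_cvg (2 / 2^-1) (d := 2^-1 / 4).
  by rewrite divr_gt0.
exists (K + K) => l lI; have l0 : 0 < l by lra.
have [v [vI lvI nv nlv]] := exists_dilation_avoiding half0 lI mB mB Bd Bd.
have -> : g l = g (l * v) - g v by rewrite log_ratio_lim_mul//; [ring|lra].
by apply: (le_trans (ler_normB _ _)); apply: lerD; exact: g_le.
Qed.

(* Off small sets, both log_ratio u (x n) and log_ratio u (l n * x n) are uniformly close to
   g u; at a common good point v the two errors bound the one at l n. *)
Lemma log_ratio_uniform_seq (x l : nat -> R) (eta e : R) : 0 < eta -> 0 < e ->
  (forall n, 1 <= x n) -> (forall n, 1 <= l n * x n) -> x @ \oo --> +oo ->
  (fun n => l n * x n) @ \oo --> +oo -> (forall n, eta <= l n <= 1) ->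
  exists n, `|log_ratio (l n) (x n) - g (l n)| < e.
Proof.
move=> eta0 e0 x1 y1 x_cvg y_cvg lI.
have ed : 0 < eta / 4 by rewrite divr_gt0.
have e20 : 0 < e / 2 by rewrite divr_gt0.
have [B1 [mB1 B1d _ /(_ _ e20) near1]] := log_ratio_almost_uniform x1 x_cvg (2 / eta) ed.
have [B2 [mB2 B2d _ /(_ _ e20) near2]] := log_ratio_almost_uniform y1 y_cvg (2 / eta) ed.
have [N _ /(_ N (leqnn N))[/= close1 close2]] := filterI near1 near2.
have [v [vI lvI nv nlv]] := exists_dilation_avoiding eta0 (lI N) mB1 mB2 B1d B2d.
exists N; have /andP[? _] := lI N; move: (close1 _ lvI nlv) (close2 _ vI nv).
rewrite log_ratio_lim_mul/log_ratio; [|lra..].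
rewrite (_ : v * (l N * x N) = l N * v * x N); last ring.
by rewrite !ltr_norml => /andP[? ?] /andP[? ?]; apply/andP; split; lra.
Qed.

End uniform_convergence.

Theorem log_ratio_uniform (R : realType) (F : R -> R) : regularly_varying F ->
  exists rho : R, forall eta e : R, 0 < eta -> 0 < e ->
    \forall x \near +oo, forall l, eta <= l <= 1 -> `|log_ratio F l x - rho * ln l| < e.
Proof.
move=> Freg; have [_ [mF _]] := Freg; have [g cvg_g] := log_ratio_cvg Freg.
have [K gK] := log_ratio_lim_bounded cvg_g mF.
have gE := additive_bounded_ln (log_ratio_lim_mul cvg_g) gK.
exists (g (expR 1)) => eta e eta0 e0; apply: contrapT => not_near.
have /choice[xl xl_bad] (n : nat) : exists xl : R * R, [/\ n.+1%:R <= xl.1,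
    n.+1%:R <= xl.2 * xl.1, eta <= xl.2 <= 1 & e <= `|log_ratio F xl.2 xl.1 - g xl.2|].
  apply: contrapT => nxl; apply: not_near; exists (Num.max n.+1%:R (n.+1%:R / eta)).
  split=> [|x]; first exact: num_real.
  rewrite gt_max => /andP[/ltW xn]; rewrite ltr_pdivrMr// => /ltW xn_eta l lI.
  have /andP[el _] := lI; have x0 : 0 <= x by apply: le_trans xn.
  rewrite ltNge -gE; last by lra.
  apply/negP => ebad; apply: nxl; exists (x, l); split => //.
  by apply: (le_trans xn_eta); rewrite mulrC ler_wpM2r.
have to_oo (y : nat -> R) : (forall n, n.+1%:R <= y n) -> (forall n, 1 <= y n) /\ y @ \oo --> +oo.
  move=> yn; split=> [n|]; first by apply: le_trans (yn n); rewrite ler1n.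
  apply: (ger_cvgy _ (@cvgr_idn R)); near=> n; apply: le_trans (yn n); rewrite ler_nat//.
pose x n := (xl n).1; pose l n := (xl n).2.
have [x1 x_cvg] : (forall n, 1 <= x n) /\ x @ \oo --> +oo by apply: to_oo => n; case: (xl_bad n).
have [y1 y_cvg] : (forall n, 1 <= l n * x n) /\ (fun n => l n * x n) @ \oo --> +oo.
  by apply: to_oo => n; case: (xl_bad n).
have lI n : eta <= l n <= 1 by case: (xl_bad n).
have [n] := log_ratio_uniform_seq cvg_g mF eta0 e0 x1 y1 x_cvg y_cvg lI.
by have [_ _ _] := xl_bad n; rewrite leNgt => /negP.
Unshelve. all: by end_near. Qed.

(** * Regularly varying sequences *)

Lemma eq_fun_cvg (R : realType) (f g : nat -> R) (l k : R) :
  g n @[n --> \oo] --> k -> f =1 g -> l = k -> f n @[n --> \oo] --> l.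
Proof. by move=> g_k /funext -> ->. Qed.

Lemma eq_ler (R : numDomainType) (x y : R) : x = y -> x <= y.
Proof. by move=> ->. Qed.

Section regular_variation.
Variable R : realType.
Implicit Types (v w : nat -> R) (a b c e eta : R).

(* The shift by one avoids the junk value of ln at 0. *)
Definition lnS n : R := ln n.+1%:R.

(* The sequence expR \o v is regularly varying of index a, in the uniform form. *)
Definition log_regvar a v := forall eta e, 0 < eta -> 0 < e ->
  \forall n \near \oo, forall k, (k <= n)%N -> eta * n.+1%:R <= k.+1%:R ->
    `|v k - v n - a * (lnS k - lnS n)| <= e.

Lemma expR_lnS n : expR (lnS n) = n.+1%:R.
Proof. by rewrite lnK// posrE. Qed.

Lemma lnS_ge0 n : 0 <= lnS n. Proof. by rewrite ln_ge0// ler1n. Qed.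

Lemma lnS0 : lnS 0 = 0. Proof. exact: ln1. Qed.

Lemma ler_lnS k n : (k <= n)%N -> lnS k <= lnS n.
Proof. by move=> kn; rewrite ler_ln ?posrE// ler_nat. Qed.

Lemma near_lnS_ge a : \forall n \near \oo, a <= lnS n.
Proof.
near=> n; rewrite -ler_expR expR_lnS; apply: (@le_trans _ _ n%:R); last by rewrite ler_nat.
by near: n; exact: nbhs_infty_ger.
Unshelve. all: by end_near. Qed.

Lemma dist_ln_le (x y d : R) : 0 < d -> d <= x -> d <= y -> `|ln x - ln y| <= `|x - y| / d.
Proof.
move=> d0 dx dy; wlog yx : x y dx dy / y <= x => [wlog_le|].
  case: (leP y x) => [|/ltW] xy; first exact: wlog_le.
  by rewrite distrC (distrC x); exact: wlog_le.
have y0 : 0 < y by exact: lt_le_trans dy.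
have x0 : 0 < x by exact: lt_le_trans dx.
rewrite ger0_norm ?subr_ge0 ?ler_ln// ger0_norm ?subr_ge0// -ln_div ?posrE//.
have -> : x / y = 1 + (x - y) / y by field; exact: lt0r_neq0.
have xy0 : 0 <= (x - y) / y by rewrite divr_ge0 ?subr_ge0// ltW.
apply: (le_trans (le_ln1Dx _)); first lra.
by rewrite ler_wpM2l ?subr_ge0// lef_pV2.
Qed.

Lemma dist_lnS_le k n eta : 0 < eta -> (k <= n)%N -> eta * n.+1%:R <= k.+1%:R ->
  `|lnS k - lnS n| <= - ln eta.
Proof.
move=> eta0 kn ek; rewrite distrC ger0_norm ?subr_ge0 ?ler_lnS// lerBlDr addrC -lerBlDr opprK.
by rewrite -lnM ?posrE// ler_ln ?posrE ?mulr_gt0// mulrC.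
Qed.

Lemma near_infty_proportional eta (P : nat -> Prop) : 0 < eta -> (\forall k \near \oo, P k) ->
  \forall n \near \oo, forall k, eta * n.+1%:R <= k.+1%:R -> P k.
Proof.
move=> eta0 [N _ P_after]; near=> n => k; rewrite mulrC -ler_pdivlMr// => nk; apply: P_after => /=.
rewrite -ltnS -(ltr_nat R); rewrite ler_pdivlMr// in nk; apply: lt_le_trans nk.
rewrite -ltr_pdivrMr//; apply: (@lt_trans _ _ n%:R); last by rewrite ltr_nat.
by near: n; exact: nbhs_infty_gtr.
Unshelve. all: by end_near. Qed.

Lemma log_regvarD a b v w : log_regvar a v -> log_regvar b w ->
  log_regvar (a + b) (fun n => v n + w n).
Proof.
move=> regvar_v regvar_w eta e eta0 e0; have e20 : 0 < e / 2 by rewrite divr_gt0.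
apply: filterS2 (regvar_v _ _ eta0 e20) (regvar_w _ _ eta0 e20) => n vn wn k kn ek.
rewrite [e]splitr (_ : v k + w k - _ - _ =
  (v k - v n - a * (lnS k - lnS n)) + (w k - w n - b * (lnS k - lnS n))); last ring.
by apply: (le_trans (ler_normD _ _)); apply: lerD; [exact: vn|exact: wn].
Qed.

Lemma log_regvarZ a c v : log_regvar a v -> log_regvar (c * a) (fun n => c * v n).
Proof.
move=> regvar_v eta e eta0 e0; have c0 : 0 < `|c| + 1 by rewrite ltr_wpDl.
apply: filterS (regvar_v _ _ eta0 (divr_gt0 e0 c0)) => n vn k kn ek.
have -> : c * v k - c * v n - c * a * (lnS k - lnS n) = c * (v k - v n - a * (lnS k - lnS n)).
  by ring.
rewrite normrM; have := vn k kn ek; rewrite ler_pdivlMr//; apply: le_trans.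
by rewrite mulrC ler_wpM2l// lerDl.
Qed.

Lemma log_regvar_lnS : log_regvar 1 lnS.
Proof.
by move=> eta e eta0 e0; near=> n => k _ _; rewrite mul1r subrr normr0 ltW.
Unshelve. all: by end_near. Qed.

Lemma log_regvarZ_lnS c : log_regvar c (fun n => c * lnS n).
Proof. by have := log_regvarZ c log_regvar_lnS; rewrite mulr1. Qed.

Lemma log_regvar_cvg a v w (l : R) : log_regvar a v -> w n - v n @[n --> \oo] --> l ->
  log_regvar a w.
Proof.
move=> regvar_v /cvgrPdist_le wv_l eta e eta0 e0; have e30 : 0 < e / 3 by rewrite divr_gt0.
have wv := wv_l _ e30.
apply: filterS3 (regvar_v _ _ eta0 e30) wv (near_infty_proportional eta0 wv).
move=> n vn wvn wvk k kn ek.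
move: (vn k kn ek) wvn (wvk k ek); rewrite !ler_norml => /andP[? ?] /andP[? ?] /andP[? ?].
by apply/andP; split; lra.
Qed.

Lemma lnS_sub_succ_cvg0 : lnS n - lnS n.+1 @[n --> \oo] --> (0 : R).
Proof.
apply/cvgr0Pnorm_le => e e0; near=> n.
have nR : 0 < n.+1%:R :> R by rewrite ltr0n.
apply: (le_trans (dist_ln_le nR (lexx _) _)); first by rewrite ler_nat.
rewrite -[n.+2%:R]natr1 opprD addrA subrr sub0r normrN1 mul1r -[leRHS]invrK.
rewrite lef_pV2 ?posrE ?invr_gt0//; apply: (@le_trans _ _ n%:R); last by rewrite ler_nat.
by near: n; exact: nbhs_infty_ger.
Unshelve. all: by end_near. Qed.

Lemma log_regvar_succ a v : log_regvar a v -> v n - v n.+1 @[n --> \oo] --> (0 : R).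
Proof.
move=> regvar_v.
have excess_cvg : v n - v n.+1 - a * (lnS n - lnS n.+1) @[n --> \oo] --> (0 : R).
  apply/cvgr0Pnorm_le => e e0.
  have [N _ close] := regvar_v 2^-1 e (ltac:(by rewrite invr_gt0)) e0; exists N => // n Nn.
  by apply: close (leqW Nn) _ (leqnSn n) _; rewrite mulrC ler_pdivrMr// -natrM ler_nat; lia.
apply: (eq_fun_cvg (cvgD excess_cvg (cvgM (cvg_cst a) lnS_sub_succ_cvg0))) => [n|].
  by rewrite /= subrK.
by rewrite mulr0 addr0.
Qed.

Lemma ln43_le_lnS_half n : (0 < n)%N -> ln (4 / 3) <= lnS n - lnS n./2.
Proof.
move=> n0; rewrite /lnS -ln_div ?posrE// ler_ln ?posrE ?divr_gt0//.
rewrite ler_pdivlMr// mulrAC ler_pdivrMr// -!natrM ler_nat.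
have := odd_double_half n; lia.
Qed.

(* Induction on n, replacing n by n / 2: each halving step is nonpositive once n is large. *)
Lemma log_regvar_almost_increasing a v : 0 < a -> log_regvar a v ->
  exists2 K, 0 <= K & forall k n, (k <= n)%N -> v k <= v n + K.
Proof.
move=> a0 regvar_v; pose e := a * ln (4 / 3).
have e0 : 0 < e by rewrite mulr_gt0// ln_gt0//; lra.
have half_gt0 : 0 < 2^-1 :> R by rewrite invr_gt0.
have [N _ v_close] := regvar_v 2^-1 e half_gt0 e0.
pose S := \sum_(k < N.+1) `|v k|.
have le_S k : (k <= N)%N -> `|v k| <= S.
  by rewrite -ltnS => kN; rewrite /S (bigD1 (Ordinal kN))//= lerDl sumr_ge0.
have S0 : 0 <= S by exact: sumr_ge0.
exists (2 * S + e) => [|k n]; first lra.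
have [m] := ubnP n; elim: m n => // m IH n; rewrite ltnS => nm kn.
have [nN|Nn] := leqP n N.
  by move: (le_S _ nN) (le_S _ (leq_trans kn nN)); rewrite !ler_norml; lra.
have half_le : 2^-1 * n.+1%:R <= (n./2).+1%:R :> R.
  rewrite mulrC ler_pdivrMr// -natrM ler_nat; have := odd_double_half n; lia.
have [kh|hk] := leqP k n./2; last first.
  have := v_close n (ltnW Nn) k kn; rewrite ler_norml => /(_ _)/andP[|_].
    by apply: (le_trans half_le); rewrite ler_nat ltnS ltnW.
  have : a * (lnS k - lnS n) <= 0 by rewrite mulr_ge0_le0 ?subr_le0 ?ler_lnS// ltW.
  lra.
have hn : (n./2 < n)%N by have := odd_double_half n; lia.
have := v_close n (ltnW Nn) n./2 (ltnW hn) half_le; rewrite ler_norml => /andP[_].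
have : a * ln (4 / 3) <= a * (lnS n - lnS n./2).
  by rewrite ler_pM2l// ln43_le_lnS_half//; exact: leq_ltn_trans Nn.
by have := IH n./2 (leq_trans hn nm) kh; rewrite -/e; lra.
Qed.

Lemma log_regvar_potter a c v : log_regvar a v -> c < a -> exists2 K, 0 <= K &
  forall k n, (k <= n)%N -> v k <= v n + K + c * (lnS k - lnS n).
Proof.
move=> regvar_v ca; have regvar_sub := log_regvarD regvar_v (log_regvarZ_lnS (- c)).
have [|K K0 v_le] := log_regvar_almost_increasing _ regvar_sub.
  by rewrite subr_gt0.
by exists K => // k n /v_le; lra.
Qed.

Lemma log_regvar_local_bound a v eta : log_regvar a v -> 0 < eta -> exists2 K, 0 <= K &
  forall k n, (k <= n)%N -> eta * n.+1%:R <= k.+1%:R -> `|v k - v n| <= K.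
Proof.
move=> regvar_v eta0.
have [|K1 K10 v_le] := log_regvar_potter regvar_v (c := a - 1); first lra.
have [|K2 K20 Nv_le] := log_regvar_potter (log_regvarZ (-1) regvar_v) (c := - a - 1); first lra.
pose K := `|a - 1| * `|ln eta| + `|- a - 1| * `|ln eta|.
have K0 : 0 <= K by rewrite addr_ge0 ?mulr_ge0.
have term_le c k n : (k <= n)%N -> eta * n.+1%:R <= k.+1%:R ->
    c * (lnS k - lnS n) <= `|c| * `|ln eta|.
  move=> kn ek; apply: (le_trans (ler_norm _)); rewrite normrM ler_wpM2l//.
  by apply: (le_trans (dist_lnS_le eta0 kn ek)); rewrite -normrN ler_norm.
exists (K1 + K2 + K) => [|k n kn ek]; first by rewrite !addr_ge0.
have l1 := term_le (a - 1) k n kn ek; have l2 := term_le (- a - 1) k n kn ek.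
have t1 : 0 <= `|a - 1| * `|ln eta| by rewrite mulr_ge0.
have t2 : 0 <= `|- a - 1| * `|ln eta| by rewrite mulr_ge0.
have := v_le k n kn; have := Nv_le k n kn; rewrite ler_norml /K => ? ?.
by apply/andP; split; lra.
Qed.

Lemma log_regvar_ge a c v : log_regvar a v -> c < a -> exists K, forall n, K + c * lnS n <= v n.
Proof.
move=> regvar_v ca; have [K _ potter] := log_regvar_potter regvar_v ca; exists (v 0%N - K) => n.
by have := potter 0%N n isT; rewrite lnS0; lra.
Qed.

Lemma log_regvar_le a c v : log_regvar a v -> a < c -> exists K, forall n, v n <= K + c * lnS n.
Proof.
move=> regvar_v ac.
have [|K Nv_ge] := log_regvar_ge (log_regvarZ (-1) regvar_v) (c := - c); first lra.
by exists (- K) => n; have := Nv_ge n; lra.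
Qed.

Lemma log_regvar_index_ge a c K v : log_regvar a v ->
  (\forall n \near \oo, K + c * lnS n <= v n) -> c <= a.
Proof.
move=> regvar_v v_ge; rewrite leNgt; apply/negP => ac; pose d := (c - a) / 2.
have d0 : 0 < d by rewrite divr_gt0// subr_gt0.
have [K' v_le] := log_regvar_le regvar_v (ltac:(rewrite /d; lra) : a < c - d).
have lnS_large := near_lnS_ge ((K' - K + 1) / d).
near \oo => n.
have : (K' - K + 1) / d <= lnS n by near: n.
have : K + c * lnS n <= v n by near: n.
by have := v_le n; rewrite ler_pdivrMr//; lra.
Unshelve. all: by end_near. Qed.

Lemma log_regvar_index_le a c K v : log_regvar a v ->
  (\forall n \near \oo, v n <= K + c * lnS n) -> a <= c.
Proof.
move=> regvar_v v_le; rewrite -lerN2 -(mulN1r a).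
apply: (log_regvar_index_ge (K := - K) (log_regvarZ (-1) regvar_v)).
by apply: filterS v_le => n; lra.
Qed.

Lemma regularly_varying_log_regvar (F : R -> R) : regularly_varying F ->
  exists rho, log_regvar rho (fun n => ln (F n%:R)).
Proof.
move=> /log_ratio_uniform[rho ratio_close]; exists rho.
have near_nat eta e : 0 < eta -> 0 < e -> \forall n \near \oo, forall l, eta <= l <= 1 ->
    `|log_ratio F l n.+1%:R - rho * ln l| < e.
  move=> eta0 e0; have [M [_ after_M]] := ratio_close eta e eta0 e0; near=> n => l; apply: after_M.
  apply: (@lt_trans _ _ n%:R); last by rewrite ltr_nat.
  by near: n; exact: nbhs_infty_gtr.
have shifted : log_regvar rho (fun n => ln (F n.+1%:R)).
  move=> eta e eta0 e0; apply: filterS (near_nat _ _ eta0 e0) => n ratio_n k kn ek.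
  have := ratio_n (k.+1%:R / n.+1%:R).
  rewrite /log_ratio divfK// ln_div ?posrE// => /(_ _)/ltW; apply.
  by rewrite ler_pdivlMr// ek ler_pdivrMr// mul1r ler_nat.
apply: (log_regvar_cvg (l := 0) shifted); rewrite -cvg_shiftS.
exact: log_regvar_succ shifted.
Unshelve. all: by end_near. Qed.

End regular_variation.
Arguments lnS {R}.

(** * Convolutions of regularly varying sequences *)

Section power_sums.
Variable R : realType.

Lemma expR_mul_le (s x : R) : 0 <= s <= 1 -> expR (s * x) <= 1 - s + s * expR x.
Proof.
move=> /andP[s0 s1].
have tangent (y : R) : expR (s * x) * (1 + (y - s * x)) <= expR y.
  rewrite [leRHS](_ : _ = expR (s * x) * expR (y - s * x)); last first.
    by rewrite -expRD; congr expR; ring.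
  by rewrite ler_pM2l ?expR_gt0// expR_ge1Dx.
have := ler_wpM2l s0 (tangent x); have s1' : 0 <= 1 - s by lra.
by have := ler_wpM2l s1' (tangent 0); rewrite expR0; lra.
Qed.

Lemma sum_expR_lnS_le (tau : R) (m : nat) : 0 <= tau < 1 ->
  \sum_(k < m.+1) expR (- tau * lnS k) <= (1 - tau)^-1 * expR ((1 - tau) * lnS m).
Proof.
move=> /andP[t0 t1]; have s0 : 0 < 1 - tau by lra.
elim: m => [|m IH].
  by rewrite big_ord_recr big_ord0 /= add0r lnS0 !mulr0 expR0 mulr1 invf_ge1//; lra.
rewrite big_ord_recr/=; apply: (le_trans (lerD IH (lexx _))).
pose E := expR ((1 - tau) * lnS m.+1); pose i : R := m.+2%:R^-1.
have -> : expR (- tau * lnS m.+1) = E * i.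
  by rewrite /i -(expR_lnS R m.+1) -expRN -expRD; congr expR; ring.
rewrite -(ler_pM2l s0) mulrDr !mulrA mulfV ?lt0r_neq0// !mul1r -lerBrDr.
have -> : expR ((1 - tau) * lnS m) = E * expR ((1 - tau) * (lnS m - lnS m.+1)).
  by rewrite -expRD; congr expR; ring.
rewrite -/E (_ : E - _ = E * (1 - (1 - tau) * i)); last ring.
rewrite ler_pM2l ?expR_gt0//; apply: le_trans (expR_mul_le _ _) _; first lra.
rewrite expRB !expR_lnS /i -[m.+2%:R]natr1.
have : 0 < m.+1%:R :> R by rewrite ltr0n.
move: (m.+1%:R) => x x0; apply: eq_ler; field.
by apply: lt0r_neq0; lra.
Qed.

Lemma sum_expR_lnS_cond_le (tau x : R) (N : nat) : 0 <= tau < 1 -> 0 < x ->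
  \sum_(k < N | k.+1%:R <= x) expR (- tau * lnS k) <= (1 - tau)^-1 * expR ((1 - tau) * ln x).
Proof.
move=> tau01 x0; have s0 : 0 < 1 - tau by lra.
elim: N => [|N IH]; first by rewrite big_ord0 mulr_ge0 ?expR_ge0// invr_ge0 ltW.
rewrite big_mkcond big_ord_recr/= -big_mkcond; case: ifPn => [Nx|_]; last by rewrite addr0.
apply: (@le_trans _ _ (\sum_(k < N.+1) expR (- tau * lnS k))).
  rewrite big_ord_recr/= lerD2r big_mkcond; apply: ler_sum => k _.
  by case: ifP => // _; exact: expR_ge0.
apply: (le_trans (sum_expR_lnS_le N tau01)).
by rewrite ler_pM2l ?invr_gt0// ler_expR ler_pM2l// ler_ln ?posrE.
Qed.

Lemma dist_expR_le (x y : R) : `|x - y| <= 2^-1 -> `|expR x - expR y| <= 2 * `|x - y| * expR y.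
Proof.
move=> xy; have -> : expR x - expR y = expR y * (expR (x - y) - 1).
  by rewrite mulrBr -expRD mulr1 subrKC.
rewrite normrM (ger0_norm (expR_ge0 _)) mulrC ler_pM2r ?expR_gt0//.
move: (x - y) xy => z z2; have le1 := expR_ge1Dx z; have le2 := expR_ge1Dx (- z).
have [z_le Nz_le] : z <= `|z| /\ - z <= `|z| by rewrite ler_norm -normrN ler_norm.
have z1 : 0 < 1 - z by lra.
have le3 : expR z <= (1 - z)^-1.
  by rewrite -[leLHS]invrK lef_pV2 ?posrE ?invr_gt0 ?expR_gt0// -expRN.
have le4 : (1 - z)^-1 <= 1 + 2 * `|z|.
  rewrite -[leLHS]mul1r ler_pdivrMr//.
  have : 0 <= `|z| * (1 - 2 * z) by rewrite mulr_ge0//; lra.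
  lra.
by rewrite ler_norml; apply/andP; split; lra.
Qed.

End power_sums.

Section convolution_weights.
Variable R : realType.
Implicit Types (v w : nat -> R) (D f : nat -> nat -> R) (eta e s t : R).

Definition conv_weight v w n y : R := expR (v y - v n + (w (n - y)%N - w n)).

Definition edge eta n y : bool :=
  (y.+1%:R <= eta * n.+1%:R) || ((n - y).+1%:R <= eta * n.+1%:R).

Definition edge_negligible D :=
  forall e, 0 < e -> \forall eta \near (0 : R)^'+, forall n,
    \sum_(y < n.+1 | edge eta n y) D n y <= e * n.+1%:R.

Lemma conv_weight_gt0 v w n y : 0 < conv_weight v w n y. Proof. exact: expR_gt0. Qed.

Lemma conv_weight_rev v w n y : (y <= n)%N -> conv_weight v w n (n - y) = conv_weight w v n y.
Proof. by move=> yn; rewrite /conv_weight subKn// addrC. Qed.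

Lemma not_edge_gt eta n y : ~~ edge eta n y ->
  eta * n.+1%:R <= y.+1%:R /\ eta * n.+1%:R <= (n - y).+1%:R.
Proof. by rewrite negb_or -!ltNge => /andP[/ltW ? /ltW ?]. Qed.

Lemma sum_conv_weight_left_le v w s t : log_regvar s v -> log_regvar t w -> -1 < s ->
  exists K sg, [/\ 0 < K, 0 < sg & forall eta n, 0 < eta <= 2^-1 ->
    \sum_(y < n.+1 | y.+1%:R <= eta * n.+1%:R) conv_weight v w n y <=
      K * expR (sg * ln eta) * n.+1%:R].
Proof.
move=> regvar_v regvar_w s1; pose c := (Num.min s 0 - 1) / 2.
have [min0 mins] : Num.min s 0 <= 0 /\ Num.min s 0 <= s by rewrite !ge_min !lexx orbT.
have min1 : -1 < Num.min s 0 by rewrite lt_min s1; lra.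
have cs : c < s by rewrite /c; lra.
have [K1 _ v_le] := log_regvar_potter regvar_v cs.
have [K2 _ w_le] := log_regvar_local_bound regvar_w (eta := 2^-1) (ltac:(by rewrite invr_gt0)).
pose tau := - c; have tau01 : 0 <= tau < 1 by rewrite /tau /c; apply/andP; split; lra.
have sg0 : 0 < 1 - tau by lra.
pose K := (1 - tau)^-1 * expR (K1 + K2).
exists K, (1 - tau); split => //; first by rewrite mulr_gt0 ?expR_gt0 ?invr_gt0.
move=> eta n /andP[eta0 eta2]; have nR : 0 < n.+1%:R :> R by rewrite ltr0n.
have weight_le (y : 'I_n.+1) : y.+1%:R <= eta * n.+1%:R ->
    conv_weight v w n y <= expR (K1 + K2 + tau * lnS n) * expR (- tau * lnS y).
  move=> ye; have yn : (y <= n)%N by rewrite -ltnS.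
  have half : 2^-1 * n.+1%:R <= (n - y).+1%:R :> R.
    rewrite -(subSn yn) natrB ?leqW//; move: ye; rewrite -natr1.
    by have := ler_wpM2r (ltW nR) eta2; lra.
  have := w_le (n - y)%N n (leq_subr _ _) half; rewrite ler_norml => /andP[_ ?].
  by rewrite -expRD ler_expR /tau; have := v_le y n yn; lra.
apply: (le_trans (ler_sum _ weight_le)); rewrite -mulr_sumr.
have en0 : 0 < eta * n.+1%:R by rewrite mulr_gt0.
apply: (le_trans (ler_wpM2l (expR_ge0 _) (sum_expR_lnS_cond_le n.+1 tau01 en0))).
rewrite lnM ?posrE// -/(lnS n) mulrCA -expRD -[in leRHS](expR_lnS R n) /K -!mulrA -!expRD.
by apply: eq_ler; congr (_ * expR _); ring.
Qed.

Lemma conv_weight_local v w s t eta : log_regvar s v -> log_regvar t w -> 0 < eta ->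
  exists2 K, 0 < K & forall n y, (y <= n)%N -> ~~ edge eta n y -> conv_weight v w n y <= K.
Proof.
move=> regvar_v regvar_w eta0; have [K1 _ v_le] := log_regvar_local_bound regvar_v eta0.
have [K2 _ w_le] := log_regvar_local_bound regvar_w eta0.
exists (expR (K1 + K2)) => [|n y yn /not_edge_gt[y1 y2]]; first exact: expR_gt0.
rewrite ler_expR; have := v_le y n yn y1; have := w_le (n - y)%N n (leq_subr _ _) y2.
by rewrite !ler_norml => /andP[_ ?] /andP[_ ?]; lra.
Qed.

Lemma conv_weight_edge v w s t : log_regvar s v -> log_regvar t w -> -1 < s -> -1 < t ->
  edge_negligible (conv_weight v w).
Proof.
move=> regvar_v regvar_w s1 t1 e e0.
have left_edge v' w' s' t' : log_regvar s' v' -> log_regvar t' w' -> -1 < s' ->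
    \forall eta \near (0 : R)^'+, forall n,
      \sum_(y < n.+1 | y.+1%:R <= eta * n.+1%:R) conv_weight v' w' n y <= e / 2 * n.+1%:R.
  move=> regvar_v' regvar_w' s'1.
  have [K [sg [K0 sg0 left_le]]] := sum_conv_weight_left_le regvar_v' regvar_w' s'1.
  have d0 : 0 < e / 2 / K by rewrite !divr_gt0.
  near=> eta => n; have eta0 : 0 < eta by [].
  apply: (le_trans (left_le eta n _)).
    by rewrite eta0/=; near: eta; apply: nbhs_right_le; rewrite invr_gt0.
  rewrite ler_wpM2r// mulrC -ler_pdivlMr// -[leRHS]lnK ?posrE// ler_expR mulrC -ler_pdivlMr//.
  rewrite -[leRHS]expRK ler_ln ?posrE ?expR_gt0//.
  by near: eta; apply: nbhs_right_le; exact: expR_gt0.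
apply: filterS2 (left_edge _ _ _ _ regvar_v regvar_w s1) (left_edge _ _ _ _ regvar_w regvar_v t1).
move=> eta left_le right_le n.
apply: (@le_trans _ _ (\sum_(y < n.+1 | y.+1%:R <= eta * n.+1%:R) conv_weight v w n y +
    \sum_(y < n.+1 | (n - y).+1%:R <= eta * n.+1%:R) conv_weight v w n y)).
  rewrite big_mkcond [X in _ <= X + _]big_mkcond [X in _ <= _ + X]big_mkcond -big_split.
  apply: ler_sum => y _; rewrite /edge; have := conv_weight_gt0 v w n y.
  by case: (y.+1%:R <= _) => /=; case: ((n - y).+1%:R <= _) => /=; lra.
rewrite [e]splitr mulrDl; apply: lerD; first exact: left_le.
rewrite (reindex_inj rev_ord_inj)/=; apply: le_trans (right_le n).
apply: eq_ler; apply: eq_big => y; rewrite subSS.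
  by rewrite subKn// -ltnS.
by rewrite conv_weight_rev// -ltnS.
Unshelve. all: by end_near. Qed.

Lemma sum_conv_weight_le v w s t : log_regvar s v -> log_regvar t w -> -1 < s -> -1 < t ->
  exists2 K, 0 < K & forall n, \sum_(y < n.+1) conv_weight v w n y <= K * n.+1%:R.
Proof.
move=> regvar_v regvar_w s1 t1; have edge_le := conv_weight_edge regvar_v regvar_w s1 t1 ltr01.
have [eta [eta0 edge_le_eta]] : exists eta, 0 < eta /\ forall n,
    \sum_(y < n.+1 | edge eta n y) conv_weight v w n y <= 1 * n.+1%:R.
  have [eta [? ?]] := @filter_ex _ (0^'+) _ _ (filterI (nbhs_right_gt (0 : R)) edge_le).
  by exists eta.
have [K K0 weight_le] := conv_weight_local regvar_v regvar_w eta0.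
exists (1 + K) => [|n]; first lra.
rewrite (bigID (fun y : 'I_n.+1 => edge eta n y))/= mulrDl; apply: lerD; first exact: edge_le_eta.
apply: (@le_trans _ _ (\sum_(y < n.+1) K)); last by rewrite sumr_const card_ord mulr_natr.
rewrite big_mkcond; apply: ler_sum => y _; case: ifPn => [yne|_]; last exact: ltW.
by apply: weight_le; rewrite // -ltnS.
Qed.

Lemma sum_dominated_cvg0 D f (C K : R) : (forall n y, 0 <= D n y) ->
  (forall n, \sum_(y < n.+1) D n y <= C * n.+1%:R) -> edge_negligible D ->
  (forall n y, (y <= n)%N -> `|f n y| <= K * D n y) ->
  (forall eta e, 0 < eta -> 0 < e -> \forall n \near \oo, forall y, (y <= n)%N ->
    ~~ edge eta n y -> `|f n y| <= e * D n y) ->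
  (\sum_(y < n.+1) f n y) / n.+1%:R @[n --> \oo] --> (0 : R).
Proof.
move=> D0 DC De fK fmid; apply/cvgr0Pnorm_le => e e0.
have [C1 K1] : 0 < `|C| + 1 /\ 0 < `|K| + 1 by rewrite !ltr_wpDl.
have e2 : 0 < e / 2 by rewrite divr_gt0.
have [eta [eta0 edge_le]] := @filter_ex _ (0^'+) _ _
  (filterI (nbhs_right_gt (0 : R)) (De _ (divr_gt0 e2 K1))).
apply: filterS (fmid eta _ eta0 (divr_gt0 e2 C1)) => n mid.
rewrite normrM normfV normr_nat ler_pdivrMr//; apply: (le_trans (ler_norm_sum _ _ _)).
rewrite (bigID (fun y : 'I_n.+1 => edge eta n y))/= [e]splitr mulrDl; apply: lerD.
  apply: (@le_trans _ _ ((`|K| + 1) * \sum_(y < n.+1 | edge eta n y) D n y)).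
    rewrite mulr_sumr; apply: ler_sum => y _; have yn : (y <= n)%N by rewrite -ltnS.
    apply: (le_trans (fK n y yn)); rewrite ler_wpM2r//.
    by apply: (le_trans (ler_norm _)); rewrite lerDl.
  have := ler_wpM2l (ltW K1) (edge_le n); rewrite mulrA mulrCA mulfV ?mulr1// lt0r_neq0//.
apply: (@le_trans _ _ (e / 2 / (`|C| + 1) * \sum_(y < n.+1) D n y)).
  rewrite mulr_sumr big_mkcond; apply: ler_sum => y _; case: ifPn => [yne|_].
    by apply: mid; rewrite // -ltnS.
  by rewrite mulr_ge0// divr_ge0// ltW.
apply: (le_trans (ler_wpM2l _ (DC n))); first by rewrite divr_ge0// ltW.
rewrite mulrA ler_wpM2r// mulrAC ler_pdivrMr// ler_wpM2l ?(ltW e2)//.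
by apply: (le_trans (ler_norm _)); rewrite lerDl.
Qed.

End convolution_weights.

Section convolution_averages.
Variables (R : realType) (s t : R) (v w : nat -> R).
Hypotheses (regvar_v : log_regvar s v) (regvar_w : log_regvar t w) (s1 : -1 < s) (t1 : -1 < t).

Local Notation psi := (conv_weight v w).

Let psi_dominated_cvg0 (f : nat -> nat -> R) (K : R) :
  (forall n y, (y <= n)%N -> `|f n y| <= K * psi n y) ->
  (forall eta e : R, 0 < eta -> 0 < e -> \forall n \near \oo, forall y, (y <= n)%N ->
    ~~ edge eta n y -> `|f n y| <= e * psi n y) ->
  (\sum_(y < n.+1) f n y) / n.+1%:R @[n --> \oo] --> (0 : R).
Proof.
have [C _ sum_le] := sum_conv_weight_le regvar_v regvar_w s1 t1.
apply: (sum_dominated_cvg0 _ sum_le (conv_weight_edge regvar_v regvar_w s1 t1)) => n y.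
exact/ltW/conv_weight_gt0.
Qed.

Lemma conv_weight_succ_near (eta e : R) : 0 < eta -> 0 < e ->
  \forall n \near \oo, forall y, (y < n)%N -> ~~ edge eta n y ->
    `|psi n y - psi n y.+1| <= e * psi n y.
Proof.
move=> eta0 e0; pose d := Num.min (4^-1) (e / 4).
have d0 : 0 < d by rewrite lt_min invr_gt0 ltr0n divr_gt0.
have [d1 d2] : d <= 4^-1 /\ d <= e / 4 by rewrite !ge_min !lexx orbT.
have /cvgr0Pnorm_le/(_ d d0) v_succ := log_regvar_succ regvar_v.
have /cvgr0Pnorm_le/(_ d d0) w_succ := log_regvar_succ regvar_w.
have eta20 : 0 < eta / 2 by rewrite divr_gt0.
near=> n => y yn /not_edge_gt[y1 y2].
have vy : `|v y - v y.+1| <= d.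
  have : forall k, eta * n.+1%:R <= k.+1%:R -> `|v k - v k.+1| <= d.
    by near: n; exact: near_infty_proportional.
  by apply.
have wy : `|w (n - y.+1)%N - w (n - y.+1).+1| <= d.
  have : forall k, eta / 2 * n.+1%:R <= k.+1%:R -> `|w k - w k.+1| <= d.
    by near: n; exact: near_infty_proportional.
  apply; move: y2; rewrite subnSK// -[(n - y).+1%:R]natr1 => y2.
  suff : 1 <= eta / 2 * n.+1%:R by lra.
  rewrite mulrC -ler_pdivrMr//; apply: (@le_trans _ _ n%:R); last by rewrite ler_nat.
  by near: n; exact: nbhs_infty_ger.
rewrite subnSK// in wy.
rewrite distrC; apply: (le_trans (dist_expR_le _)).
  by move: vy wy; rewrite !ler_norml => /andP[? ?] /andP[? ?]; apply/andP; split; lra.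
rewrite ler_pM2r ?conv_weight_gt0// mulrC -ler_pdivlMr// ler_norml.
by move: vy wy; rewrite !ler_norml => /andP[? ?] /andP[? ?]; apply/andP; split; lra.
Unshelve. all: by end_near. Qed.

Lemma conv_weight_succ_le : exists2 K, 0 < K & forall n y, (y < n)%N -> psi n y.+1 <= K * psi n y.
Proof.
have half0 : 0 < 2^-1 :> R by rewrite invr_gt0.
have [K1 _ v_le] := log_regvar_local_bound regvar_v half0.
have [K2 _ w_le] := log_regvar_local_bound regvar_w half0.
have half k : 2^-1 * k.+2%:R <= k.+1%:R :> R by rewrite mulrC ler_pdivrMr// -natrM ler_nat; lia.
exists (expR (K1 + K2)) => [|n y yn]; first exact: expR_gt0.
rewrite -expRD ler_expR.
have := w_le _ _ (leqnSn (n - y.+1)) (half _); rewrite subnSK//.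
have := v_le _ _ (leqnSn y) (half _).
by rewrite !ler_norml => /andP[? ?] /andP[? ?]; lra.
Qed.

(* A periodic factor enters a slowly varying sum only through its mean, as sums of slowly
   varying terms hardly change under a shift. *)
Lemma sum_conv_weight_shift (chi : nat -> nat -> R) : (forall n y, `|chi n y| <= 1) ->
  (\sum_(y < n.+1) (chi n y.+1 - chi n y) * psi n y) / n.+1%:R @[n --> \oo] --> (0 : R).
Proof.
move=> chi1.
pose f n y := chi n y.+1 * (psi n y - (y < n)%N%:R * psi n y.+1) -
  (y == 0%N)%:R * (chi n 0%N * psi n 0%N).
have psi0 n y : 0 < psi n y := conv_weight_gt0 v w n y.
have -> : (fun n => (\sum_(y < n.+1) (chi n y.+1 - chi n y) * psi n y) / n.+1%:R) =
    fun n => (\sum_(y < n.+1) f n y) / n.+1%:R.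
  apply/funext => n; congr (_ / _).
  under eq_bigr do rewrite mulrBl.
  under [RHS]eq_bigr do rewrite /f mulrBr -addrA -opprD.
  rewrite !sumrB; congr (_ - _); rewrite big_split/= [LHS]big_ord_recl/= addrC.
  congr (_ + _); first by rewrite big_ord_recl/= mul1r big1 ?addr0// => y _; rewrite mul0r.
  rewrite [RHS]big_ord_recr/= ltnn mul0r mulr0 addr0.
  by apply: eq_bigr => y _; rewrite /= ltn_ord mul1r.
have [K K0 succ_le] := conv_weight_succ_le.
apply: (psi_dominated_cvg0 (K := 2 + K)) => [n y yn|eta e eta0 e0].
  rewrite [leRHS](_ : _ = (psi n y + K * psi n y) + psi n y); last ring.
  apply: (le_trans (ler_normB _ _)); apply: lerD.
    rewrite normrM -[leRHS]mul1r ler_pM//; apply: (le_trans (ler_normB _ _)).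
    rewrite (gtr0_norm (psi0 _ _)) lerD2l normrM normr_nat (gtr0_norm (psi0 _ _)).
    by case: ltnP => [/succ_le|_]; rewrite ?mul1r// mul0r mulr_ge0// ltW.
  case: eqP => [->|_]; last by rewrite mul0r normr0 ltW.
  by rewrite mul1r normrM (gtr0_norm (psi0 _ _)) ler_piMl// ltW.
have succ_near := conv_weight_succ_near eta0 e0.
near=> n => y yn yne; have [y1 y2] := not_edge_gt yne.
have large : 2 <= eta * n.+1%:R.
  rewrite mulrC -ler_pdivrMr//; apply: (@le_trans _ _ n%:R); last by rewrite ler_nat.
  by near: n; exact: nbhs_infty_ger.
have y0 : (y == 0%N) = false by apply/negP => /eqP y0; move: y1; rewrite y0; lra.
have yltn : (y < n)%N.
  rewrite ltn_neqAle yn andbT; apply/negP => /eqP ny; move: y2; rewrite ny subnn; lra.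
rewrite /f y0 yltn mul0r subr0 mul1r normrM -[leRHS]mul1r ler_pM//.
by move: y yltn yne {yn y1 y2 y0}; near: n.
Unshelve. all: by end_near. Qed.

Lemma sum_conv_weight_average (chi : nat -> nat -> R) (q : nat) : (0 < q)%N ->
  (forall n y, `|chi n y| <= 1) -> (forall n y, chi n (y + q)%N = chi n y) ->
  (\sum_(y < n.+1) (chi n y - (\sum_(i < q) chi n i) / q%:R) * psi n y) / n.+1%:R
    @[n --> \oo] --> (0 : R).
Proof.
move=> q0 chi1 chiq.
have shift_cvg i : (\sum_(y < n.+1) (chi n (y + i)%N - chi n y) * psi n y) / n.+1%:R
    @[n --> \oo] --> (0 : R).
  elim: i => [|i IH].
    under eq_fun => n do under eq_bigr => y _ do rewrite addn0 subrr mul0r.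
    by under eq_fun => n do rewrite big1_eq mul0r; exact: cvg_cst.
  apply: (eq_fun_cvg (cvgD (sum_conv_weight_shift (fun n y => chi1 n (y + i)%N)) IH)) => [n|];
    last by rewrite addr0.
  rewrite -[RHS]mulrDl -big_split/=; congr (_ / _); apply: eq_bigr => y _.
  by rewrite addSn addnS; ring.
have window n y : \sum_(i < q) chi n (y + i)%N = \sum_(i < q) chi n i.
  elim: y => // y IH; rewrite -[RHS]IH -(prednK q0) big_ord_recr [RHS]big_ord_recl/=.
  rewrite addSnnS prednK// chiq addn0 addrC; congr (_ + _).
  by apply: eq_bigr => i _; rewrite addSnnS.
have sum_cvg m : (\sum_(i < m) (\sum_(y < n.+1) (chi n (y + i)%N - chi n y) * psi n y)) / n.+1%:R
    @[n --> \oo] --> (0 : R).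
  elim: m => [|m IH].
    by under eq_fun => n do rewrite big_ord0 mul0r; exact: cvg_cst.
  apply: (eq_fun_cvg (cvgD IH (shift_cvg m))) => [n|]; last by rewrite addr0.
  by rewrite -[RHS]mulrDl big_ord_recr.
apply: (eq_fun_cvg (cvgM (cvg_cst (- q%:R^-1 : R)) (sum_cvg q))) => [n|]; last by rewrite mulr0.
rewrite -[RHS]/(_ * _) exchange_big/= mulrA mulr_sumr; congr (_ / _); apply: eq_bigr => y _.
rewrite -mulr_suml sumrB sumr_const card_ord window mulrA -[chi n y *+ q]mulr_natr; congr (_ * _).
by field; rewrite pnatr_eq0 -lt0n.
Qed.

End convolution_averages.

(** * Generalised binomial coefficients *)

Section conv.
Variable R : realType.

Definition conv (P u : nat -> R) (n : nat) : R := \sum_(y < n.+1) P y * u (n - y)%N.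

(* The coefficient binom(n + s, n) of X^n in (1 - X)^(-(s+1)). *)
Definition gbinom (s : R) (n : nat) : R := \prod_(j < n) (1 + s / j.+1%:R).

Lemma gbinom_gt0 (s : R) n : -1 < s -> 0 < gbinom s n.
Proof.
move=> s1; apply: prodr_gt0 => j _; rewrite -ltrBlDl sub0r ltr_pdivlMr// mulN1r.
by apply: le_lt_trans s1; rewrite lerN2 ler1n.
Qed.

Lemma gbinomS (s : R) n : n.+1%:R * gbinom s n.+1 = (n.+1%:R + s) * gbinom s n.
Proof. by rewrite /gbinom big_ord_recr/= mulrCA mulrC; congr (_ * _); field; rewrite nat1r. Qed.

Lemma vandermonde_gbinom (s t : R) n : conv (gbinom s) (gbinom t) n = gbinom (s + t + 1) n.
Proof.
rewrite /conv; elim: n => [|n IH].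
  by rewrite big_ord1 /gbinom !big_ord0 mulr1.
have Sn0 : n.+1%:R != 0 :> R by rewrite pnatr_eq0.
apply: (mulfI Sn0); rewrite gbinomS -IH.
pose a (y : nat) := y%:R * gbinom s y * gbinom t (n.+1 - y)%N.
pose b (y : nat) := gbinom s y * ((n.+1 - y)%:R * gbinom t (n.+1 - y)%N).
have -> : n.+1%:R * (\sum_(y < n.+2) gbinom s y * gbinom t (n.+1 - y)%N) =
    \sum_(y < n.+2) a y + \sum_(y < n.+2) b y.
  rewrite mulr_sumr -big_split/=; apply: eq_bigr => y _; rewrite /a /b.
  by rewrite natrB -1?ltnS//; ring.
rewrite big_ord_recl [X in _ + X]big_ord_recr/= {1}/a {2}/b subnn !mul0r mulr0 add0r addr0.
rewrite -big_split mulr_sumr/=; apply: eq_bigr => y _; rewrite /a /b /= -[bump 0 y]/(y.+1) subSS.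
have yn : (y <= n)%N by rewrite -ltnS.
by rewrite gbinomS (subSn yn) gbinomS -(subSn yn) natrB ?leqW//; ring.
Qed.

Lemma sum_inv_sq_le (n N : nat) : (0 < n)%N ->
  \sum_(n <= m < N) (m.+1%:R ^+ 2)^-1 <= n%:R^-1 :> R.
Proof.
move=> n0; have [Nn|nN] := leqP N n; first by rewrite big_geq.
apply: (@le_trans _ _ (\sum_(n <= m < N) - ((m.+1)%:R^-1 - (m%:R)^-1 : R))).
  rewrite big_nat_cond [leRHS]big_nat_cond; apply: ler_sum => m /andP[/andP[nm _] _].
  have m0 : 0 < m%:R :> R by rewrite ltr0n (leq_trans n0).
  rewrite -natr1; set x := m%:R in m0 *.
  have x1 : 0 < x + 1 by lra.
  have -> : - ((x + 1)^-1 - x^-1) = (x * (x + 1))^-1 by field; rewrite !lt0r_neq0.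
  by rewrite lef_pV2 ?posrE ?exprn_gt0 ?mulr_gt0// expr2 ler_pM2r//; lra.
by rewrite sumrN (telescope_sumr (fun m => m%:R^-1)) ?(ltnW nN)// opprB lerBlDr lerDl invr_ge0.
Qed.

Lemma cvg_sum_of_inv_sq_bound (d : nat -> R) (K : R) :
  (forall n, `|d n| <= K * (n.+1%:R ^+ 2)^-1) -> cvgn (series d).
Proof.
move=> dK; apply: normed_cvg.
have bound_ge0 n : 0 <= K * (n.+1%:R ^+ 2)^-1 by exact: le_trans (dK n).
have K0 : 0 <= K by have := dK 0%N; rewrite expr1n invr1 mulr1; exact: le_trans.
apply: (@series_le_cvg _ _ (fun n => K * (n.+1%:R ^+ 2)^-1)) => // [n|]; first exact: normr_ge0.
apply: nondecreasing_is_cvgn; first by apply: nondecreasing_series => n _ _.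
exists (K + K) => _ [n _ <-]; rewrite /series/= -mulr_sumr -[K + K]mulr2n -mulr_natr ler_wpM2l//.
case: n => [|n]; first by rewrite big_geq.
rewrite big_ltn// expr1n invr1 [leRHS]mulr2n lerD2l.
by apply: (le_trans (sum_inv_sq_le _ _)) => //; rewrite invr1.
Qed.

Lemma dist_ln1D_le (x : R) : -1 < x -> `|ln (1 + x) - x| <= x ^+ 2 / (1 + x).
Proof.
move=> x1; have x10 : 0 < 1 + x by lra.
have sq0 : 0 <= x ^+ 2 / (1 + x) by rewrite divr_ge0 ?sqr_ge0// ltW.
rewrite ler_norml; apply/andP; split; last by have := le_ln1Dx x1; lra.
have : ln (1 + x)^-1 <= - (x / (1 + x)).
  rewrite (_ : ln _ = ln (1 + - (x / (1 + x)))); last by congr ln; field; exact: lt0r_neq0.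
  by apply: le_ln1Dx; rewrite ltrN2 ltr_pdivrMr//; lra.
rewrite lnV ?posrE//; have : x = x / (1 + x) + x ^+ 2 / (1 + x) by field; exact: lt0r_neq0.
by lra.
Qed.

Definition log_gbinom_excess (s : R) (n : nat) : R := ln (gbinom s n) - s * lnS n.

Lemma cvg_log_gbinom_excess (s : R) : -1 < s -> cvgn (log_gbinom_excess s).
Proof.
move=> s1; pose d j : R := ln (1 + s / j.+1%:R) - s * ln (1 + j.+1%:R^-1).
have -> : log_gbinom_excess s = series d.
  apply/funext; elim=> [|n IH].
    by rewrite /log_gbinom_excess /gbinom big_ord0 ln1 lnS0 mulr0 subrr /series/= big_geq.
  have frac0 : 0 < 1 + s / n.+1%:R.
    rewrite -ltrBlDl sub0r ltr_pdivlMr// mulN1r.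
    by apply: le_lt_trans s1; rewrite lerN2 ler1n.
  have lnSS : lnS n.+1 = lnS n + ln (1 + n.+1%:R^-1) :> R.
    rewrite /lnS -lnM ?posrE ?addr_gt0 ?invr_gt0//; congr ln.
    by rewrite -[n.+2%:R]natr1; field; rewrite nat1r.
  rewrite seriesSr -IH /log_gbinom_excess /d lnSS {1}/gbinom big_ord_recr/= -/(gbinom s n).
  by rewrite lnM ?posrE ?gbinom_gt0//; ring.
pose K := s ^+ 2 / (1 + Num.min s 0) + `|s|.
have min1 : 0 < 1 + Num.min s 0 by rewrite -ltrBlDl sub0r lt_min s1; lra.
apply: (cvg_sum_of_inv_sq_bound (K := K)) => n.
pose x : R := n.+1%:R^-1; have x0 : 0 < x by rewrite invr_gt0.
have x1 : x <= 1 by rewrite invf_le1// ler1n.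
have -> : (n.+1%:R ^+ 2)^-1 = x ^+ 2 :> R by rewrite exprVn.
have sx : Num.min s 0 <= s * x.
  have [s0|s0] := lerP s 0; first by rewrite -[leLHS]mulr1 ler_wnM2l.
  by rewrite mulr_ge0// ltW.
rewrite (_ : d n = (ln (1 + s * x) - s * x) - s * (ln (1 + x) - x)); last by rewrite /d; ring.
apply: (le_trans (ler_normB _ _)); rewrite /K mulrDl; apply: lerD.
  apply: (le_trans (dist_ln1D_le _)); first lra.
  by rewrite exprMn mulrAC ler_wpM2r ?sqr_ge0// ler_wpM2l ?sqr_ge0// lef_pV2 ?posrE//; lra.
rewrite normrM ler_wpM2l//; apply: (le_trans (dist_ln1D_le _)); first lra.
by rewrite ler_pdivrMr ?addr_gt0// ler_peMr ?sqr_ge0//; lra.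
Qed.

Lemma log_regvar_gbinom (s : R) : -1 < s -> log_regvar s (fun n => ln (gbinom s n)).
Proof. by move=> /cvg_log_gbinom_excess; exact: log_regvar_cvg (log_regvarZ_lnS s). Qed.

(* The limit of gbinom s n / (n + 1)^s, that is 1 / Gamma(s + 1). *)
Definition gbinom_const (s : R) : R := expR (lim (log_gbinom_excess s @ \oo)).

Lemma gbinom_const_gt0 s : 0 < gbinom_const s. Proof. exact: expR_gt0. Qed.

Lemma gbinom_const0 : gbinom_const 0 = 1.
Proof.
rewrite /gbinom_const (_ : log_gbinom_excess 0 = cst 0) ?lim_cst ?expR0//.
apply/funext => n; rewrite /log_gbinom_excess mul0r subr0 /gbinom big1 ?ln1// => j _.
by rewrite mul0r addr0.
Qed.

Lemma gbinom_succ (s : R) n : -1 < s -> gbinom (s + 1) n = gbinom s n * (n.+1%:R + s) / (1 + s).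
Proof.
move=> s1; have s10 : 1 + s != 0 by apply: lt0r_neq0; lra.
elim: n => [|n IH]; first by rewrite /gbinom !big_ord0 mul1r mulfV.
have Sn0 : n.+1%:R != 0 :> R by rewrite pnatr_eq0.
apply: (mulfI Sn0); rewrite gbinomS IH !mulrA gbinomS -[n.+2%:R]natr1.
by congr (_ / _); ring.
Qed.

Lemma gbinom_constS (s : R) : -1 < s -> gbinom_const (s + 1) = gbinom_const s / (1 + s).
Proof.
move=> s1; have s10 : 0 < 1 + s by lra.
rewrite /gbinom_const -[in RHS](lnK (s10 : 1 + s \in Num.pos)) -expRN -expRD; congr expR.
apply: cvg_lim => //.
have ln_cvg : ln (1 + s / n.+1%:R) @[n --> \oo] --> (0 : R).
  rewrite -ln1; apply: continuous_cvg; first exact: continuous_ln.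
  rewrite -[X in _ --> X]addr0 -(mulr0 s); apply: cvgD; first exact: cvg_cst.
  by apply: cvgM; [exact: cvg_cst|exact: cvg_harmonic].
have cvg_s := cvg_log_gbinom_excess s1.
apply: (eq_fun_cvg (cvgD (cvgB cvg_s (cvg_cst (ln (1 + s)))) ln_cvg)) => [n|];
  last by rewrite addr0.
have Sn1 : 0 < n.+1%:R + s.
  by rewrite -ltrBlDr sub0r; apply: lt_le_trans (_ : 1 <= _); [lra|rewrite ler1n].
have SnE : n.+1%:R + s = n.+1%:R * (1 + s / n.+1%:R) by field; rewrite nat1r.
have frac0 : 0 < 1 + s / n.+1%:R by rewrite -(pmulr_rgt0 _ (ltr0Sn R n)) -SnE.
rewrite /log_gbinom_excess gbinom_succ// ln_div ?posrE ?mulr_gt0 ?gbinom_gt0//.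
rewrite lnM ?posrE ?gbinom_gt0// SnE lnM ?posrE// -/(lnS n) -[RHS]/(_ - _ + _); ring.
Qed.

Lemma gbinom_const_nat (l : nat) : gbinom_const l%:R = (l`!%:R)^-1.
Proof.
elim: l => [|l IH]; first by rewrite gbinom_const0 fact0 invr1.
rewrite -natr1 gbinom_constS; last by apply: lt_le_trans (ler0n _ _); lra.
by rewrite IH nat1r factS natrM invfM mulrC.
Qed.

End conv.

(** * Asymptotics of weighted representation counts *)

Lemma eqn_of_mod_lcm (a g i j : nat) : (i < lcmn a g)%N -> (j < lcmn a g)%N ->
  (a %| i)%N -> (a %| j)%N -> i = j %[mod g] -> i = j.
Proof.
wlog ij : i j / (i <= j)%N.
  move=> wlog_le iq jq ai aj; case: (leqP i j) => [|/ltnW] ij; first exact: wlog_le.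
  by move=> /esym E; apply/esym; exact: wlog_le.
move=> _ jq ai aj /esym/eqP; rewrite eqn_mod_dvd// => gij.
have : (lcmn a g %| j - i)%N by rewrite dvdn_lcm dvdn_sub.
rewrite /dvdn modn_small; last exact: leq_ltn_trans (leq_subr _ _) jq.
by rewrite subn_eq0 => ji; apply/eqP; rewrite eqn_leq ij.
Qed.

Lemma sum_mod_lcm (a g n : nat) : (0 < a)%N -> (0 < g)%N ->
  (\sum_(i < lcmn a g) ((a %| i) && (i == n %[mod g])) = (gcdn a g %| n))%N.
Proof.
move=> a0 g0; have q0 : (0 < lcmn a g)%N by rewrite lcmn_gt0 a0.
have [dn|ndn] := boolP (gcdn a g %| n)%N; last first.
  rewrite big1// => i _; apply/eqP; rewrite eqb0; apply: contra ndn => /andP[ai /eqP ing].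
  have di : (gcdn a g %| i)%N by exact: dvdn_trans (dvdn_gcdl _ _) ai.
  by rewrite /dvdn -(modn_dvdm _ (dvdn_gcdr a g)) -ing modn_dvdm// dvdn_gcdr.
have [u v uv _] := egcdnP g a0.
pose y := (u * a * (n %/ gcdn a g))%N; pose t := Ordinal (ltn_pmod y q0).
have yE : y = (v * (n %/ gcdn a g) * g + n)%N.
  by rewrite /y uv mulnDl [X in (_ + X)%N]mulnC divnK// mulnAC.
have tP : (a %| t)%N && (t == n %[mod g]).
  rewrite /= modn_dvdm ?dvdn_lcmr// yE modnMDl eqxx andbT.
  by rewrite /dvdn modn_dvdm ?dvdn_lcml// -yE -[_ == _]/(a %| _)%N /y mulnAC dvdn_mull.
rewrite (bigD1 t)//= tP big1 ?addn0 => [|i it]//; apply/eqP; rewrite eqb0; apply: contra it.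
case/andP: tP => at_ /eqP tn /andP[ai /eqP ing]; apply/eqP/val_inj => /=.
by apply: (eqn_of_mod_lcm (a := a) (g := g)); rewrite ?ltn_ord ?ltn_pmod// ing.
Qed.

Section lattice_equivalence.
Variable R : realType.
Implicit Types (v w P u : nat -> R) (s t C : R) (a g : nat).

(* u n is asymptotic to C * g * expR (v n) on the multiples of g and negligible elsewhere. *)
Definition lattice_equiv g C v u :=
  u n / expR (v n) - C * g%:R * (g %| n)%N%:R @[n --> \oo] --> (0 : R).

Lemma lattice_equiv_bounded g C v u : lattice_equiv g C v u ->
  exists2 K, 0 < K & forall n, `|u n / expR (v n)| <= K.
Proof.
move=> equiv_u; have /cvg_seq_bounded[M [_ u_le]] := cvgP _ equiv_u.
have M1 : M < `|M| + 1 by rewrite ltr_pwDr// ler_norm.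
exists (`|M| + 1 + `|C * g%:R|) => [|n]; first by rewrite ltr_pwDl// ltr_wpDl.
rewrite -[X in `|X|](subrK (C * g%:R * (g %| n)%N%:R)).
apply: (le_trans (ler_normD _ _)); apply: lerD; first exact: (u_le _ M1 n).
by rewrite normrM ler_piMr// normr_nat; case: (_ %| _)%N.
Qed.

Lemma sum_conv_weight_gbinom_cvg s t : -1 < s -> -1 < t ->
  (\sum_(y < n.+1) conv_weight (fun k => ln (gbinom s k)) (fun k => ln (gbinom t k)) n y) / n.+1%:R
    @[n --> \oo] --> gbinom_const (s + t + 1) / (gbinom_const s * gbinom_const t).
Proof.
move=> s1 t1; have st1 : -1 < s + t + 1 by lra.
have [cs ct cst] : [/\ cvgn (log_gbinom_excess s), cvgn (log_gbinom_excess t) &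
    cvgn (log_gbinom_excess (s + t + 1))] by split; exact: cvg_log_gbinom_excess.
have cvg_exp : expR (log_gbinom_excess (s + t + 1) n -
    (log_gbinom_excess s n + log_gbinom_excess t n)) @[n --> \oo] -->
    gbinom_const (s + t + 1) / (gbinom_const s * gbinom_const t).
  rewrite /gbinom_const -expRD -expRB; apply: continuous_cvg; first exact: continuous_expR.
  by apply: cvgB => //; exact: cvgD.
apply: (eq_fun_cvg cvg_exp) => // n.
have lnK_gbinom r k : -1 < r -> expR (ln (gbinom r k)) = gbinom r k :> R.
  by move=> r1; rewrite lnK// posrE gbinom_gt0.
have -> : \sum_(y < n.+1) conv_weight (fun k => ln (gbinom s k)) (fun k => ln (gbinom t k)) n y =
    gbinom (s + t + 1) n / (gbinom s n * gbinom t n).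
  rewrite -vandermonde_gbinom /conv mulr_suml; apply: eq_bigr => y _.
  rewrite /conv_weight expRD !expRB !lnK_gbinom//.
  by field; rewrite !lt0r_neq0// gbinom_gt0.
rewrite -[n.+1%:R](expR_lnS R n) -(lnK_gbinom _ _ st1) -(lnK_gbinom _ _ s1) -(lnK_gbinom _ _ t1).
by rewrite -expRD -!expRB; congr expR; rewrite /log_gbinom_excess; ring.
Qed.

Lemma conv_weight_equiv s t v w v' w' (eta e : R) :
  log_regvar s v -> log_regvar t w -> log_regvar s v' -> log_regvar t w' -> 0 < eta -> 0 < e ->
  \forall n \near \oo, forall y, (y <= n)%N -> ~~ edge eta n y ->
    `|conv_weight v w n y - conv_weight v' w' n y| <= e * conv_weight v' w' n y.
Proof.
move=> regvar_v regvar_w regvar_v' regvar_w' eta0 e0; pose d := Num.min (8^-1) (e / 8).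
have d0 : 0 < d by rewrite lt_min invr_gt0 ltr0n divr_gt0.
have [d1 d2] : d <= 8^-1 /\ d <= e / 8 by rewrite !ge_min !lexx orbT.
apply: filterS2 (filterI (regvar_v _ _ eta0 d0) (regvar_w _ _ eta0 d0))
  (filterI (regvar_v' _ _ eta0 d0) (regvar_w' _ _ eta0 d0)).
move=> n [vn wn] [v'n w'n] y yn /not_edge_gt[y1 y2].
have dist_le : `|v y - v n + (w (n - y)%N - w n) - (v' y - v' n + (w' (n - y)%N - w' n))| <= 4 * d.
  move: (vn y yn y1) (v'n y yn y1) (wn _ (leq_subr _ _) y2) (w'n _ (leq_subr _ _) y2).
  rewrite !ler_norml => /andP[? ?] /andP[? ?] /andP[? ?] /andP[? ?].
  by apply/andP; split; lra.
apply: (le_trans (dist_expR_le _)); first by apply: (le_trans dist_le); lra.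
by rewrite ler_pM2r ?conv_weight_gt0//; lra.
Qed.

Section two_sequences.
Variables (s t : R) (v w : nat -> R).
Hypotheses (regvar_v : log_regvar s v) (regvar_w : log_regvar t w) (s1 : -1 < s) (t1 : -1 < t).

Lemma sum_conv_weight_cvg :
  (\sum_(y < n.+1) conv_weight v w n y) / n.+1%:R @[n --> \oo] -->
    gbinom_const (s + t + 1) / (gbinom_const s * gbinom_const t).
Proof.
pose v' n := ln (gbinom s n); pose w' n := ln (gbinom t n).
have regvar_v' : log_regvar s v' by exact: log_regvar_gbinom.
have regvar_w' : log_regvar t w' by exact: log_regvar_gbinom.
pose D n y := conv_weight v w n y + conv_weight v' w' n y.
have D0 n y : 0 <= D n y by rewrite addr_ge0// ltW// conv_weight_gt0.
have [K _ sum_le] := sum_conv_weight_le regvar_v regvar_w s1 t1.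
have [K' _ sum_le'] := sum_conv_weight_le regvar_v' regvar_w' s1 t1.
have DC n : \sum_(y < n.+1) D n y <= (K + K') * n.+1%:R.
  by rewrite big_split mulrDl; exact: lerD.
have De : edge_negligible D.
  move=> e e0; have e20 : 0 < e / 2 by rewrite divr_gt0.
  have edge_le := conv_weight_edge regvar_v regvar_w s1 t1 e20.
  have edge_le' := conv_weight_edge regvar_v' regvar_w' s1 t1 e20.
  apply: filterS2 edge_le edge_le' => eta le_n le_n' n.
  by rewrite big_split/= [e]splitr mulrDl; exact: lerD (le_n n) (le_n' n).
have diff : (\sum_(y < n.+1) (conv_weight v w n y - conv_weight v' w' n y)) / n.+1%:R
    @[n --> \oo] --> (0 : R).
  pose f n y := conv_weight v w n y - conv_weight v' w' n y.
  apply: (@sum_dominated_cvg0 _ D f _ 1 D0 DC De) => [n y _|eta e eta0 e0].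
    rewrite mul1r; apply: (le_trans (ler_normB _ _)).
    by rewrite !gtr0_norm ?conv_weight_gt0.
  apply: filterS (conv_weight_equiv regvar_v regvar_w regvar_v' regvar_w' eta0 e0).
  move=> n weight_close y yn yne.
  by apply: (le_trans (weight_close y yn yne)); rewrite ler_pM2l// lerDr ltW// conv_weight_gt0.
apply: (eq_fun_cvg (cvgD diff (sum_conv_weight_gbinom_cvg s1 t1))) => [n|]; last by rewrite add0r.
by rewrite -[RHS]mulrDl sumrB subrK.
Qed.

Lemma conv_sub_lattice_cvg0 a g C1 C2 P u :
  lattice_equiv a C1 v P -> lattice_equiv g C2 w u ->
  (\sum_(y < n.+1) (P y * u (n - y)%N / expR (v n + w n) -
     C1 * a%:R * (C2 * g%:R) * ((a %| y) && (g %| n - y))%N%:R * conv_weight v w n y)) / n.+1%:R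
    @[n --> \oo] --> (0 : R).
Proof.
move=> equiv_P equiv_u; have [K1 K10 x_le] := lattice_equiv_bounded equiv_P.
have [K2 K20 z_le] := lattice_equiv_bounded equiv_u.
pose x y := P y / expR (v y); pose z m := u m / expR (w m).
pose x0 (y : nat) := C1 * a%:R * (a %| y)%N%:R; pose z0 (m : nat) := C2 * g%:R * (g %| m)%N%:R.
have termE n y : P y * u (n - y)%N / expR (v n + w n) -
     C1 * a%:R * (C2 * g%:R) * ((a %| y) && (g %| n - y))%N%:R * conv_weight v w n y =
     (x y * z (n - y)%N - x0 y * z0 (n - y)%N) * conv_weight v w n y.
  rewrite mulrBl; congr (_ - _); last by rewrite /x0 /z0 -mulnb natrM; ring.
  rewrite /x /z /conv_weight !expRD !expRN.
  by field; rewrite !lt0r_neq0 ?expR_gt0.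
have [C Cgt0 sum_le] := sum_conv_weight_le regvar_v regvar_w s1 t1.
have x0_le y : `|x0 y| <= `|C1 * a%:R| by rewrite normrM ler_piMr// normr_nat; case: (_ %| _)%N.
have z0_le y : `|z0 y| <= `|C2 * g%:R| by rewrite normrM ler_piMr// normr_nat; case: (_ %| _)%N.
have psi0 n y : 0 <= conv_weight v w n y by exact/ltW/conv_weight_gt0.
pose f n y := P y * u (n - y)%N / expR (v n + w n) -
  C1 * a%:R * (C2 * g%:R) * ((a %| y) && (g %| n - y))%N%:R * conv_weight v w n y.
apply: (@sum_dominated_cvg0 _ _ f _ (K1 * K2 + `|C1 * a%:R| * `|C2 * g%:R|) psi0 sum_le
  (conv_weight_edge regvar_v regvar_w s1 t1)) => [n y yn|eta e eta0 e0].
  rewrite /f termE normrM (gtr0_norm (conv_weight_gt0 _ _ _ _)) ler_pM2r ?conv_weight_gt0//.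
  apply: (le_trans (ler_normB _ _)); rewrite [`|x y * _|]normrM [`|x0 y * _|]normrM.
  by apply: lerD; apply: ler_pM => //; [exact: x_le|exact: z_le].
pose d := e / (K2 + `|C1 * a%:R| + 1).
have Kpos : 0 < K2 + `|C1 * a%:R| + 1 by rewrite ltr_wpDl// addr_ge0// ltW.
have d0 : 0 < d by rewrite divr_gt0.
have /cvgr0Pnorm_le/(_ d d0) xd := equiv_P; have /cvgr0Pnorm_le/(_ d d0) zd := equiv_u.
apply: filterS2 (near_infty_proportional eta0 xd) (near_infty_proportional eta0 zd).
move=> n xdn zdn y yn /not_edge_gt[y1 y2].
rewrite /f termE normrM (gtr0_norm (conv_weight_gt0 _ _ _ _)) ler_pM2r ?conv_weight_gt0//.
have -> : x y * z (n - y)%N - x0 y * z0 (n - y)%N =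
    (x y - x0 y) * z (n - y)%N + x0 y * (z (n - y)%N - z0 (n - y)%N) by ring.
apply: (le_trans (ler_normD _ _)).
rewrite [`|_ * z _|]normrM [`|x0 y * _|]normrM.
apply: (@le_trans _ _ (d * K2 + `|C1 * a%:R| * d)).
  by apply: lerD; apply: ler_pM => //; [exact: xdn|exact: z_le|exact: zdn].
rewrite [`|_| * d]mulrC -mulrDr /d mulrAC ler_pdivrMr// ler_pM2l//; lra.
Qed.

Theorem conv_lattice_equiv a g C1 C2 P u : (0 < a)%N -> (0 < g)%N ->
  lattice_equiv a C1 v P -> lattice_equiv g C2 w u ->
  lattice_equiv (gcdn a g)
    (C1 * C2 * (gbinom_const (s + t + 1) / (gbinom_const s * gbinom_const t)))
    (fun n => lnS n + (v n + w n)) (conv P u).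
Proof.
move=> a0 g0 equiv_P equiv_u; set B := _ / _; pose A := C1 * a%:R * (C2 * g%:R); pose q := lcmn a g.
have q0 : (0 < q)%N by rewrite lcmn_gt0 a0.
have qR : q%:R != 0 :> R by rewrite pnatr_eq0 -lt0n.
pose chi n y : R := ((a %| y) && (y == n %[mod g]))%N%:R.
have chi1 n y : `|chi n y| <= 1 by rewrite normr_nat lern1 leq_b1.
have chiq n y : chi n (y + q)%N = chi n y.
  have /dvdnP[k qE] : (g %| q)%N by exact: dvdn_lcmr.
  by rewrite /chi dvdn_addl ?dvdn_lcml// qE addnC modnMDl.
have mean n : \sum_(i < q) chi n i = (gcdn a g %| n)%N%:R.
  by rewrite -natr_sum sum_mod_lcm.
have average := sum_conv_weight_average regvar_v regvar_w s1 t1 q0 chi1 chiq.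
have mass : (gcdn a g %| n)%N%:R * ((\sum_(y < n.+1) conv_weight v w n y) / n.+1%:R - B)
    @[n --> \oo] --> (0 : R).
  have : (\sum_(y < n.+1) conv_weight v w n y) / n.+1%:R - B @[n --> \oo] --> (0 : R).
    by apply: (eq_fun_cvg (cvgB sum_conv_weight_cvg (cvg_cst B))) => //; rewrite subrr.
  move/cvgr0Pnorm_le => small; apply/cvgr0Pnorm_le => e e0; apply: filterS (small e e0) => n.
  by apply: le_trans; rewrite normrM normr_nat ler_piMl// lern1 leq_b1.
have approx := conv_sub_lattice_cvg0 equiv_P equiv_u.
apply: (eq_fun_cvg (cvgD approx (cvgD (cvgM (cvg_cst A) average)
  (cvgM (cvg_cst (A / q%:R)) mass)))) => [n|]; last by rewrite !mulr0 !addr0.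
rewrite -[RHS]/(_ + (_ * _ + _ * _)) mean.
have -> : \sum_(y < n.+1) (P y * u (n - y)%N / expR (v n + w n) -
    C1 * a%:R * (C2 * g%:R) * ((a %| y) && (g %| n - y))%N%:R * conv_weight v w n y) =
    conv P u n / expR (v n + w n) - A * \sum_(y < n.+1) chi n y * conv_weight v w n y.
  rewrite sumrB /conv mulr_suml mulr_sumr; congr (_ - _); apply: eq_bigr => y _.
  by rewrite /A /chi -mulrA eq_sym eqn_mod_dvd// -ltnS.
have -> : \sum_(y < n.+1) (chi n y - (gcdn a g %| n)%N%:R / q%:R) * conv_weight v w n y =
    \sum_(y < n.+1) chi n y * conv_weight v w n y -
    (gcdn a g %| n)%N%:R / q%:R * \sum_(y < n.+1) conv_weight v w n y.
  by rewrite mulr_sumr -sumrB; apply: eq_bigr => y _; rewrite mulrBl.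
have -> : C1 * C2 * B * (gcdn a g)%:R = A / q%:R * B.
  have -> : A = C1 * C2 * (gcdn a g)%:R * q%:R.
    by rewrite -mulrA -natrM mulnC muln_lcm_gcd natrM /A; ring.
  by field.
rewrite expRD expR_lnS; field; rewrite qR !lt0r_neq0 ?expR_gt0//.
Qed.

End two_sequences.
End lattice_equivalence.

Section weighted_representations.
Variable R : realType.
Implicit Types (v p : nat -> R) (s : R) (c : nat) (cs : seq nat).

Definition dilate c p n : R := if (c %| n)%N then p (n %/ c)%N else 0.

(* The sum of p k_1 * ... * p k_l over the solutions of c_1 k_1 + ... + c_l k_l = n. *)
Fixpoint rep_weight p cs : nat -> R :=
  if cs is c :: cs' then conv (dilate c p) (rep_weight p cs') else fun n => (n == 0%N)%:R.

Lemma coef_sum_dilate p c (N j : nat) : (0 < c)%N -> (j <= N)%N ->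
  (\sum_(x < N.+1) p x *: 'X^(c * x))`_j = dilate c p j.
Proof.
move=> c0 jN; rewrite coef_sum /dilate; case: ifPn => [/dvdnP[k jE]|ncj].
  have kN : (k < N.+1)%N by rewrite ltnS (leq_trans _ jN)// jE leq_pmulr.
  rewrite jE mulnK// (bigD1 (Ordinal kN))//= coefZ coefXn mulnC eqxx mulr1 big1 ?addr0// => x xk.
  rewrite coefZ coefXn eqn_pmul2l// [k == x](_ : _ = false) ?mulr0//.
  by apply: contraNF xk => /eqP kx; apply/eqP/val_inj.
rewrite big1// => x _; rewrite coefZ coefXn (_ : (j == _) = false) ?mulr0//.
by apply: contraNF ncj => /eqP ->; rewrite dvdn_mulr.
Qed.

Lemma coef_prod_rep_weight p (N m : nat) cs : all (ltn 0) cs -> (m <= N)%N ->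
  (\prod_(c <- cs) \sum_(x < N.+1) p x *: 'X^(c * x))`_m = rep_weight p cs m.
Proof.
elim: cs m => [|c cs IH] m; first by rewrite big_nil coef1.
move=> /= /andP[c0 cs0] mN; rewrite big_cons coefM; apply: eq_bigr => y _.
have yN : (y <= N)%N by rewrite (leq_trans _ mN)// -ltnS.
by rewrite coef_sum_dilate// IH// (leq_trans (leq_subr _ _)).
Qed.

Lemma dist_lnS_divn_le c n : (0 < c)%N -> (c %| n)%N ->
  `|lnS (n %/ c) - lnS n + ln c%:R| <= c%:R / n.+1%:R :> R.
Proof.
move=> c0 /dvdnP[m ->]; rewrite mulnK//; have cR : 0 < c%:R :> R by rewrite ltr0n.
have nR : 0 < (m * c).+1%:R :> R by rewrite ltr0n.
have n_le : (m * c).+1%:R <= m.+1%:R * c%:R :> R.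
  by rewrite -natrM ler_nat mulSn -add1n leq_add2r.
rewrite addrAC /lnS -lnM ?posrE//.
apply: (le_trans (dist_ln_le nR n_le (lexx _))); rewrite ler_wpM2r ?invr_ge0//.
have -> : m.+1%:R * c%:R - (m * c).+1%:R = c%:R - 1 :> R.
  by rewrite -natrM mulSn natrD -[(m * c).+1%:R]natr1; ring.
by rewrite ger0_norm ?subr_ge0 ?ler1n// lerBlDr lerDl.
Qed.

Lemma dilate_lattice_equiv s c v : (0 < c)%N -> log_regvar s v ->
  lattice_equiv c (expR (- (s + 1) * ln c%:R)) v (dilate c (fun k => expR (v k))).
Proof.
move=> c0 regvar_v; have cR : 0 < c%:R :> R by rewrite ltr0n.
pose E := expR (- s * ln c%:R); have E0 : 0 < E by exact: expR_gt0.
have -> : expR (- (s + 1) * ln c%:R) = E / c%:R.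
  by rewrite /E -[c%:R in X in _ / X]lnK ?posrE// -expRB; congr expR; ring.
apply/cvgr0Pnorm_le => e e0; pose d := Num.min (4^-1) (e / (4 * E)).
have d0 : 0 < d by rewrite lt_min invr_gt0 ltr0n divr_gt0// mulr_gt0.
have d1 : d <= 4^-1 by rewrite ge_min lexx.
have d2 : d * (4 * E) <= e by rewrite -ler_pdivlMr ?mulr_gt0// ge_min lexx orbT.
have cV0 : 0 < c%:R^-1 :> R by rewrite invr_gt0.
have regvar := regvar_v _ _ cV0 d0.
near=> n; rewrite divfK ?lt0r_neq0// /dilate; case: ifPn => [cn|_]; last first.
  by rewrite mul0r mulr0 subrr normr0 ltW.
rewrite mulr1 -expRB; set m := (n %/ c)%N; have nE : n = (m * c)%N by rewrite divnK.
have nm : n.+1%:R <= m.+1%:R * c%:R :> R.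
  by rewrite -natrM ler_nat mulSn -nE -add1n leq_add2r.
have v_le : `|v m - v n - s * (lnS m - lnS n)| <= d.
  have : forall k, (k <= n)%N -> c%:R^-1 * n.+1%:R <= k.+1%:R :> R ->
    `|v k - v n - s * (lnS k - lnS n)| <= d by near: n.
  by apply; [exact: leq_div|rewrite mulrC ler_pdivrMr].
have ln_le : `|s * (lnS m - lnS n + ln c%:R)| <= d.
  rewrite normrM; apply: (@le_trans _ _ (`|s| * (c%:R / n.+1%:R))).
    by rewrite ler_wpM2l// dist_lnS_divn_le.
  rewrite mulrA ler_pdivrMr// [leRHS]mulrC -ler_pdivrMr//.
  apply: (@le_trans _ _ n%:R); last by rewrite ler_nat.
  by near: n; exact: nbhs_infty_ger.
have dist_le : `|v m - v n - - s * ln c%:R| <= 2 * d.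
  have -> : v m - v n - - s * ln c%:R =
    (v m - v n - s * (lnS m - lnS n)) + s * (lnS m - lnS n + ln c%:R) by ring.
  by rewrite mulr_natl mulr2n; apply: (le_trans (ler_normD _ _)); exact: lerD.
apply: (le_trans (dist_expR_le _)); first lra.
apply: le_trans d2; rewrite -/E mulrA ler_pM2r//; lra.
Unshelve. all: by end_near. Qed.

(* The logarithm of (n + 1)^(l - 1) * p(n)^l for p = expR \o v. *)
Definition log_scale (l : nat) v n : R := (l%:R - 1) * lnS n + l%:R * v n.

Lemma log_regvar_log_scale s l v : log_regvar s v ->
  log_regvar (l%:R * (s + 1) - 1) (log_scale l v).
Proof.
move=> regvar_v; have := log_regvarD (log_regvarZ_lnS (l%:R - 1)) (log_regvarZ l%:R regvar_v).
by rewrite (_ : l%:R - 1 + l%:R * s = l%:R * (s + 1) - 1)//; ring.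
Qed.

(* Gamma(s + 1)^l / Gamma(l * (s + 1)), divided by the product of the c^(s + 1). *)
Definition rep_weight_const s cs : R :=
  gbinom_const ((size cs)%:R * (s + 1) - 1) / gbinom_const s ^+ size cs *
  \prod_(c <- cs) expR (- (s + 1) * ln c%:R).

Lemma rep_weight_const_gt0 s cs : 0 < rep_weight_const s cs.
Proof.
rewrite mulr_gt0 ?divr_gt0 ?exprn_gt0 ?gbinom_const_gt0//.
by apply: prodr_gt0 => c _; exact: expR_gt0.
Qed.

Lemma rep_weight_const0 cs : all (ltn 0) cs -> (0 < size cs)%N ->
  rep_weight_const 0 cs = ((size cs).-1`!%:R * (\prod_(c <- cs) c)%:R)^-1.
Proof.
move=> cs0 sz; rewrite /rep_weight_const gbinom_const0 expr1n divr1 add0r mulr1.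
rewrite -{1}(prednK sz) -natr1 addrK gbinom_const_nat invfM; congr (_ * _).
rewrite natr_prod -prodfV big_seq [RHS]big_seq; apply: eq_bigr => c /(allP cs0) c0.
by rewrite mulN1r expRN lnK// posrE ltr0n.
Qed.

Theorem rep_weight_lattice_equiv s v cs : log_regvar s v -> -1 < s ->
  all (ltn 0) cs -> (0 < size cs)%N ->
  lattice_equiv (foldr gcdn 0 cs)%N (rep_weight_const s cs) (log_scale (size cs) v)
    (rep_weight (fun k => expR (v k)) cs).
Proof.
move=> regvar_v s1; case: cs => // c cs; elim: cs c => [|c' cs IH] c.
  move=> /andP[c0 _] _; have := dilate_lattice_equiv c0 regvar_v.
  have -> : log_scale (size [:: c]) v = v.
    by apply/funext => n; rewrite /log_scale subrr mul0r add0r mul1r.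
  rewrite [foldr _ _ _]gcdn0 /rep_weight_const big_seq1 mul1r addrK expr1 divff ?mul1r; last first.
    by rewrite lt0r_neq0// gbinom_const_gt0.
  suff -> : rep_weight (fun k => expR (v k)) [:: c] = dilate c (fun k => expR (v k)) by [].
  apply/funext => n; rewrite /= /conv big_ord_recr/= subnn mulr1 big1 ?add0r// => y _.
  by rewrite subn_eq0 leqNgt ltn_ord mulr0.
move=> /andP[c0 cs0] _; have {}IH := IH c' cs0 isT; set cs' := c' :: cs in cs0 IH *.
have g0 : (0 < foldr gcdn 0 cs')%N by rewrite /= gcdn_gt0; move: cs0 => /= /andP[->].
pose l := size cs'; have l1 : -1 < l%:R * (s + 1) - 1.
  by rewrite ltrBrDr addNr mulr_gt0 ?ltr0n//; lra.
have := conv_lattice_equiv regvar_v (log_regvar_log_scale l regvar_v) s1 l1 c0 g0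
  (dilate_lattice_equiv c0 regvar_v) IH.
have -> : (fun n => lnS n + (v n + log_scale l v n)) = log_scale (size (c :: cs')) v.
  by apply/funext => n; rewrite /log_scale [size _]/= -/cs' -/l -[l.+1%:R]natr1; ring.
suff -> : expR (- (s + 1) * ln c%:R) * rep_weight_const s cs' *
    (gbinom_const (s + (l%:R * (s + 1) - 1) + 1) /
     (gbinom_const s * gbinom_const (l%:R * (s + 1) - 1))) = rep_weight_const s (c :: cs') by [].
rewrite /rep_weight_const big_cons [size (c :: _)]/= -/l -[l.+1%:R]natr1.
have -> : s + (l%:R * (s + 1) - 1) + 1 = (l%:R + 1) * (s + 1) - 1 by ring.
by rewrite exprS; field; rewrite expf_neq0 !lt0r_neq0 ?gbinom_const_gt0.
Qed.

End weighted_representations.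

(** * Compactness and diagonalisation *)

Lemma pred_compactness (Good : nat -> (nat -> bool) -> Prop) :
  (forall n (A B : nat -> bool), (forall i, (i <= n)%N -> A i = B i) -> Good n A -> Good n B) ->
  (forall N, exists A, forall n, (n <= N)%N -> Good n A) ->
  exists A, forall n, Good n A.
Proof.
move=> local /choice[a a_good].
pose s : nat -> cantor_space := a.
have [A [_ clA]] := @cantor_space_compact (s @ \oo) _ filterT.
exists A => n.
have cylinder (i : 'I_n.+1) : nbhs A [set B : cantor_space | B (i : nat) = A (i : nat)].
  have : nbhs (A (i : nat)) [set A (i : nat)] by exact: discrete_set1.
  exact: (@proj_continuous nat (fun=> bool) i A).
have agree : nbhs A [set B : cantor_space | forall i : 'I_n.+1, B (i : nat) = A (i : nat)].
  exact: (filter_forall (nbhs_filter A) cylinder).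
have eventually_good : (s @ \oo) [set B | Good n B] by exists n => // N /= nN; exact: a_good.
have [B [/= GB BA]] := clA _ _ eventually_good agree.
by apply: (local n B) GB => i; rewrite -ltnS => ilt; exact: (BA (Ordinal ilt)).
Qed.

Lemma diagonal_near (R : realType) (e0 : R) (Q : R -> nat -> Prop) : 0 < e0 ->
  (forall e : R, 0 < e <= e0 -> \forall n \near \oo, Q e n) ->
  exists e : nat -> R, e n @[n --> \oo] --> (0 : R) /\ \forall n \near \oo, 0 < e n /\ Q (e n) n.
Proof.
move=> e0_gt0 near_Q; pose e (j : nat) : R := e0 / j.+1%:R.
have e_gt0 j : 0 < e j by rewrite divr_gt0.
have /choice[N after_N] (j : nat) : exists N, forall n, (N <= n)%N -> Q (e j) n.
  have [|N _ after_N] := near_Q (e j); last by exists N.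
  by rewrite e_gt0 ler_pdivrMr// ler_peMr ?(ltW e0_gt0)// ler1n.
pose j n := \max_(i < n.+1 | (N i <= n)%N) i.
exists (e \o j); split; last first.
  exists (N 0%N) => // n /= N0n; split=> //; apply: after_N; rewrite /j.
  have [|i /= i_le ->] := @eq_bigmax_cond _ (fun i : 'I_n.+1 => N i <= n)%N (fun i => i : nat).
    by apply/card_gt0P; exists ord0.
  exact: i_le.
apply/cvgr0Pnorm_le => d d0; have [J _ J_ge] := nbhs_infty_ger (e0 / d).
exists (maxn J (N J)) => // n /=; rewrite geq_max => /andP[Jn NJn].
have Jj : (J <= j n)%N.
  exact: (@leq_bigmax_cond _ (fun i : 'I_n.+1 => N i <= n)%N (fun i => i : nat)
    (Ordinal (Jn : J < n.+1)%N)).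
rewrite gtr0_norm ?e_gt0// ler_pdivrMr// mulrC -ler_pdivrMr//.
by apply: (le_trans (J_ge _ Jj)); rewrite ler_nat.
Qed.

Local Close Scope classical_set_scope.

(** * Random subsets of a finite set *)

Section expectation.
Import mathcomp.boot.fintype mathcomp.boot.finset.
Variables (R : realDomainType) (T : finType) (p : T -> R).
Hypothesis p01 : forall x, 0 <= p x <= 1.
Implicit Types (s : seq T) (f g : {set T} -> R) (A B U : {set T}).

(* The expectation of f A when each x in s belongs to A independently with probability p x. *)
Fixpoint expect s f : R :=
  if s is x :: s' then
    p x * expect s' (fun A => f (x |: A)) + (1 - p x) * expect s' f
  else f set0.

Definition incl_prob U : R := \prod_(x in U) p x.

Definition antitone f := forall A B, A \subset B -> f B <= f A.

Let p_ge0 x : 0 <= p x. Proof. by case/andP: (p01 x). Qed.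
Let onem_p_ge0 x : 0 <= 1 - p x. Proof. by rewrite subr_ge0; case/andP: (p01 x). Qed.

Lemma incl_prob_ge0 U : 0 <= incl_prob U. Proof. exact: prodr_ge0. Qed.

Lemma incl_prob0 : incl_prob set0 = 1. Proof. exact: big_set0. Qed.

Lemma eq_expect s f g : f =1 g -> expect s f = expect s g.
Proof. by move=> /funext ->. Qed.

Lemma expect_cst s c : expect s (fun=> c) = c.
Proof. by elim: s => //= x s ->; ring. Qed.

Lemma expectD s f g : expect s (fun A => f A + g A) = expect s f + expect s g.
Proof. by elim: s f g => //= x s IH f g; rewrite !IH; ring. Qed.

Lemma expectZ s c f : expect s (fun A => c * f A) = c * expect s f.
Proof. by elim: s f => //= x s IH f; rewrite !IH; ring. Qed.

Lemma expect_sum (I : Type) (r : seq I) (P : pred I) s (f : I -> {set T} -> R) :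
  expect s (fun A => \sum_(i <- r | P i) f i A) = \sum_(i <- r | P i) expect s (f i).
Proof.
elim: r => [|i r IH].
  by rewrite big_nil -[RHS](expect_cst s); apply: eq_expect => A; rewrite big_nil.
rewrite big_cons -IH; case: ifPn => Pi; last first.
  by apply: eq_expect => A; rewrite big_cons (negbTE Pi).
by rewrite -expectD; apply: eq_expect => A; rewrite big_cons Pi.
Qed.

Lemma expect_le_sub s f g :
  (forall A, A \subset s -> f A <= g A) -> expect s f <= expect s g.
Proof.
elim: s f g => [|x s IH] f g fg /=; first by apply: fg; apply/subsetP => x; rewrite inE.
apply: lerD; apply: ler_wpM2l => //; apply: IH => A As; apply: fg; apply/subsetP => y.
  by rewrite in_setU1 in_cons => /orP[->//|/(subsetP As) ->]; rewrite orbT.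
by move/(subsetP As); rewrite in_cons orbC => ->.
Qed.

Lemma expect_le s f g : (forall A, f A <= g A) -> expect s f <= expect s g.
Proof. by move=> fg; exact: expect_le_sub. Qed.

Lemma expect_ge0 s f : (forall A, 0 <= f A) -> 0 <= expect s f.
Proof. by move=> f0; rewrite -[leLHS](expect_cst s); exact: expect_le. Qed.

Lemma expect_mem s x f : uniq s -> x \in s ->
  expect s (fun A => (x \in A)%:R * f A) = p x * expect s (fun A => f (x |: A)).
Proof.
elim: s f => // y s IH f /= /andP[ys us]; rewrite in_cons.
case: (eqVneq x y) => [-> _|xy /= xs].
  have -> : expect s (fun A => (y \in A)%:R * f A) = 0.
    rewrite -(expect_cst s 0); apply: le_anti; rewrite !expect_le_sub// => A As;
      by rewrite (_ : (y \in A) = false) ?mul0r//; apply: contraNF ys => /(subsetP As).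
  rewrite mulr0 addr0; congr (_ * _).
  under eq_expect => A do rewrite setU11 mul1r.
  by under [in RHS]eq_expect => A do rewrite setUA setUid; ring.
under eq_expect => A do rewrite in_setU1 (negbTE xy).
rewrite !IH// (_ : (fun A => f (y |: _)) = fun A => f (x |: (y |: A))); first ring.
by apply/funext => A; rewrite setUCA.
Qed.

Lemma expect_subset s U f : uniq s -> U \subset s ->
  expect s (fun A => (U \subset A)%:R * f A) = incl_prob U * expect s (fun A => f (U :|: A)).
Proof.
move=> us; move Un: #|U| => n; elim: n U Un f => [|n IH] U Un f Us.
  move/eqP: Un; rewrite cards_eq0 => /eqP ->; rewrite incl_prob0 mul1r.
  by apply: eq_expect => A; rewrite sub0set mul1r set0U.
have /card_gt0P[x xU] : (0 < #|U|)%N by rewrite Un.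
have xs : x \in s by exact: (subsetP Us).
have sub1 A : (U \subset A)%:R * f A = (x \in A)%:R * ((U :\ x \subset A)%:R * f A).
  by rewrite -{1}(setD1K xU) subUset sub1set mulrA -natrM mulnb.
rewrite (eq_expect _ sub1) expect_mem//.
have sub2 A : (U :\ x \subset x |: A)%:R * f (x |: A) = (U :\ x \subset A)%:R * f (x |: A).
  by rewrite -subDset setDDl setUid.
rewrite (eq_expect _ sub2) (IH (U :\ x) _ (fun A => f (x |: A))); last first.
- exact: subset_trans (subD1set _ _) Us.
- by move: Un; rewrite (cardsD1 x) xU => -[].
rewrite mulrA /incl_prob (big_setD1 x xU)/=; congr (_ * _).
by apply: eq_expect => A; rewrite setUA setD1K.
Qed.

Lemma expect_subset1 s U : uniq s -> U \subset s ->
  expect s (fun A => (U \subset A)%:R) = incl_prob U.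
Proof.
move=> us Us; rewrite -[RHS]mulr1 -{2}(expect_cst s 1) -(expect_subset (fun=> 1))//.
by apply: eq_expect => A; rewrite mulr1.
Qed.

Lemma harris_antitone s f g : antitone f -> antitone g ->
  expect s f * expect s g <= expect s (fun A => f A * g A).
Proof.
elim: s f g => [//|x s IH] f g af ag /=.
have antitoneU h : antitone h -> antitone (fun A => h (x |: A)).
  by move=> ah A B AB; apply/ah/setUS.
have IH1 := IH _ _ (antitoneU _ af) (antitoneU _ ag).
have f10 : expect s (fun A => f (x |: A)) <= expect s f.
  by apply: expect_le => A; apply/af/subsetUr.
have g10 : expect s (fun A => g (x |: A)) <= expect s g.
  by apply: expect_le => A; apply/ag/subsetUr.
set f1 := expect s (fun A => f (x |: A)) in IH1 f10 *.
set g1 := expect s (fun A => g (x |: A)) in IH1 g10 *.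
apply: (@le_trans _ _ (p x * (f1 * g1) + (1 - p x) * (expect s f * expect s g))); last first.
  by apply: lerD; apply: ler_wpM2l => //; exact: IH.
rewrite -subr_ge0 (_ : _ - _ = p x * (1 - p x) * ((expect s f - f1) * (expect s g - g1))).
  by rewrite !mulr_ge0// subr_ge0.
ring.
Qed.

Definition prob s (Q : {set T} -> Prop) : R := expect s (fun A => `[< Q A >]%:R).

Lemma prob_le s (Q Q' : {set T} -> Prop) : (forall A, Q A -> Q' A) -> prob s Q <= prob s Q'.
Proof.
move=> QQ'; apply: expect_le => A; rewrite ler_nat.
by case: asboolP => // /QQ' /asboolT ->.
Qed.

Lemma prob_le_expect s (Q : {set T} -> Prop) f :
  (forall A, 0 <= f A) -> (forall A, Q A -> 1 <= f A) -> prob s Q <= expect s f.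
Proof.
by move=> f0 Qf; apply: expect_le => A; case: asboolP => [/Qf //|_]; exact: f0.
Qed.

Lemma prob_exists_le (I : eqType) (r : seq I) s (Q : I -> {set T} -> Prop) :
  prob s (fun A => exists2 i, i \in r & Q i A) <= \sum_(i <- r) prob s (Q i).
Proof.
rewrite /prob -expect_sum; apply: prob_le_expect => [A|A [i ir QiA]]; first exact: sumr_ge0.
by rewrite (big_rem i ir)/= asboolT// lerDl sumr_ge0.
Qed.

Lemma prob_or_le s (Q Q' : {set T} -> Prop) :
  prob s (fun A => Q A \/ Q' A) <= prob s Q + prob s Q'.
Proof.
rewrite /prob -expectD; apply: prob_le_expect => [A|A [] QA]; first exact: addr_ge0.
  by rewrite asboolT// lerDl.
by rewrite (asboolT QA) lerDr.
Qed.

Lemma prob_lt1_ex s (Q : {set T} -> Prop) : prob s Q < 1 -> exists A, ~ Q A.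
Proof.
move=> Qlt1; apply: contrapT => /forallNP allQ; move: Qlt1; apply/negP; rewrite -leNgt.
rewrite -(expect_cst s 1); apply: expect_le => A.
by rewrite asboolT//; apply: contrapT; exact: allQ.
Qed.

End expectation.

Lemma onem_sum_le_prod (R : realDomainType) (I : Type) (r : seq I) (P : pred I) (x : I -> R) :
  (forall i, 0 <= x i <= 1) ->
  1 - \sum_(i <- r | P i) x i <= \prod_(i <- r | P i) (1 - x i).
Proof.
move=> x01; elim: r => [|i r IH]; first by rewrite !big_nil subr0.
rewrite !big_cons; case: ifPn => // Pi; have /andP[x0 x1] := x01 i.
have sum_ge0 : 0 <= \sum_(j <- r | P j) x j by apply: sumr_ge0 => j _; case/andP: (x01 j).
apply: (@le_trans _ _ ((1 - x i) * (1 - \sum_(j <- r | P j) x j))).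
  by rewrite -subr_ge0 (_ : _ - _ = x i * \sum_(j <- r | P j) x j); [rewrite mulr_ge0|ring].
by apply: ler_wpM2l; rewrite ?subr_ge0.
Qed.

Section janson.
Import mathcomp.boot.fintype mathcomp.boot.finset.
Variables (R : realType) (T : finType) (p : T -> R).
Hypothesis p01 : forall x, 0 <= p x <= 1.
Variables (s : seq T).
Hypotheses (us : uniq s) (sT : forall U : {set T}, U \subset s).
Variables (t d : R).
Hypothesis t01 : 0 <= t <= 1.
Implicit Types (A U V : {set T}) (Us : seq {set T}).

(* With t = 1 this is the indicator that A contains none of the sets. *)
Definition discount Us A : R := \prod_(U <- Us) (1 - t * (U \subset A)%:R).

Let t_indic_itv (b : bool) : 0 <= t * b%:R <= 1.
Proof. by case: b; rewrite ?mulr1 ?mulr0 ?lexx ?ler01. Qed.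

Lemma discount_ge0 Us A : 0 <= discount Us A.
Proof. by apply: prodr_ge0 => U _; rewrite subr_ge0; case/andP: (t_indic_itv (U \subset A)). Qed.

Lemma discount_le1 Us A : discount Us A <= 1.
Proof.
by apply: prodr_ile1 => U _; rewrite subr_ge0 lerBlDr lerDl andbC; exact: t_indic_itv.
Qed.

Lemma discount_antitone Us U : antitone (fun A => discount Us (U :|: A)).
Proof.
move=> A B AB; apply: ler_prod => V _.
rewrite subr_ge0; have /andP[_ ->] := t_indic_itv (V \subset U :|: B); rewrite lerD2l lerN2.
case/andP: t01 => t0 _; apply: ler_wpM2l => //; rewrite ler_nat.
by case: (boolP (V \subset U :|: A)) => // /subset_trans -> //; exact: setUS.
Qed.

Lemma expect_discount_conditioned Us U :
  \sum_(V <- Us | ~~ [disjoint V & U]) incl_prob p (V :\: U) <= d ->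
  (1 - t * d) * expect p s (discount Us) <= expect p s (fun A => discount Us (U :|: A)).
Proof.
move=> hd; case/andP: (t01) => t0 _.
pose hit := [seq V : {set T} <- Us | ~~ [disjoint V & U]].
pose off := [seq V : {set T} <- Us | [disjoint V & U]].
have split A : discount Us A = discount hit A * discount off A.
  rewrite /discount !big_filter (bigID (fun V : {set T} => [disjoint V & U]))/= mulrC.
  by congr (_ * _); apply: eq_bigl => V; rewrite ?negbK.
have hit_ge : 1 - t * d <= expect p s (fun A => discount hit (U :|: A)).
  apply: (@le_trans _ _ (expect p s (fun A => 1 - \sum_(V <- hit) t * (V \subset U :|: A)%:R))).
    have -> : expect p s (fun A => 1 - \sum_(V <- hit) t * (V \subset U :|: A)%:R) =
        1 - t * \sum_(V <- hit) incl_prob p (V :\: U).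
      transitivity (expect p s (fun A => 1 + - t * \sum_(V <- hit) (V \subset U :|: A)%:R)).
        by apply: eq_expect => A; rewrite mulNr mulr_sumr.
      rewrite expectD expectZ expect_cst expect_sum mulNr; congr (1 - t * _).
      apply: eq_bigr => V _; rewrite -(expect_subset1 p01 us (sT _)).
      by apply: eq_expect => A; rewrite subDset.
    by rewrite lerD2l lerN2 big_filter; exact: ler_wpM2l.
  by apply: expect_le => // A; exact: onem_sum_le_prod.
have off_ge : expect p s (discount Us) <= expect p s (fun A => discount off (U :|: A)).
  apply: expect_le => // A; rewrite split [leRHS](_ : _ = discount off A).
    by rewrite ler_piMl ?discount_ge0 ?discount_le1.
  rewrite /discount !big_filter; apply: eq_bigr => V dVU; congr (1 - t * (nat_of_bool _)%:R).
  by rewrite -subDset; move/setDidPl: dVU => ->.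
rewrite [leRHS](eq_expect _ _ (fun A => split (U :|: A))).
apply: le_trans (harris_antitone p01 _ (discount_antitone _ _) (discount_antitone _ _)).
apply: (@le_trans _ _ (expect p s (fun A => discount hit (U :|: A)) * expect p s (discount Us))).
  by apply: ler_wpM2r hit_ge; apply: expect_ge0 => // A; exact: discount_ge0.
by apply: ler_wpM2l off_ge; apply: expect_ge0 => // A; exact: discount_ge0.
Qed.

(* The Boppana-Spencer proof of Janson's inequality. *)
Lemma expect_discount_le Us :
  {in Us, forall U, \sum_(V <- Us | ~~ [disjoint V & U]) incl_prob p (V :\: U) <= d} ->
  expect p s (discount Us) <= expR (- (t * (1 - t * d) * \sum_(U <- Us) incl_prob p U)).
Proof.
case/andP: (t01) => t0 _; elim: Us => [|U Us IH] hd.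
  rewrite big_nil mulr0 oppr0 expR0 -[leRHS](expect_cst p s 1).
  by apply: expect_le => // A; exact: discount_le1.
have tail_le V : \sum_(V' <- Us | ~~ [disjoint V' & V]) incl_prob p (V' :\: V) <=
    \sum_(V' <- U :: Us | ~~ [disjoint V' & V]) incl_prob p (V' :\: V).
  by rewrite big_cons; case: ifP => // _; rewrite lerDr incl_prob_ge0.
have {}IH : expect p s (discount Us) <= expR (- (t * (1 - t * d) * \sum_(U <- Us) incl_prob p U)).
  by apply: IH => V VUs; apply: le_trans (tail_le V) (hd V _); rewrite inE VUs orbT.
have cond := expect_discount_conditioned (le_trans (tail_le U) (hd U (mem_head _ _))).
set E := expect p s (discount Us) in IH cond.
have E0 : 0 <= E by apply: expect_ge0 => // A; exact: discount_ge0.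
set q := incl_prob p U; have q0 : 0 <= q by exact: incl_prob_ge0.
have -> : expect p s (discount (U :: Us)) =
    E - t * q * expect p s (fun A => discount Us (U :|: A)).
  rewrite -mulrA -(expect_subset p01 (discount Us) us (sT U)) -mulNr -expectZ -expectD.
  by apply: eq_expect => A; rewrite {1}/discount big_cons -/(discount Us A); ring.
apply: (@le_trans _ _ ((1 - t * (1 - t * d) * q) * E)).
  rewrite mulrBl mul1r lerD2l lerN2 (_ : _ * q * E = t * q * ((1 - t * d) * E)); last ring.
  by apply: ler_wpM2l => //; exact: mulr_ge0.
rewrite big_cons -/q [_ * (q + _)]mulrDr opprD expRD.
apply: (@le_trans _ _ (expR (- (t * (1 - t * d) * q)) * E)); last by rewrite ler_wpM2l// expR_ge0.
by apply: ler_wpM2r => //; exact: expR_ge1Dx.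
Qed.

End janson.

(** * Representations and disjoint families of representations *)

Lemma ler_sum_inj (R : numDomainType) (T1 T2 : finType) (A : {set T1}) (B : {set T2})
    (phi : T1 -> T2) (f : T1 -> R) (g : T2 -> R) :
  {in A &, injective phi} -> {in A, forall k, phi k \in B} ->
  {in A, forall k, f k = g (phi k)} -> {in B, forall k, 0 <= g k} ->
  \sum_(k in A) f k <= \sum_(k in B) g k.
Proof.
move=> inj AB fg g0; rewrite (eq_bigr _ fg) -(big_imset g inj) [leRHS](big_setID (phi @: A))/=.
have /finset.setIidPr -> : phi @: A \subset B.
  by apply/fintype.subsetP => _ /imsetP[k kA ->]; exact: AB.
by rewrite lerDl; apply: sumr_ge0 => k; rewrite finset.in_setD => /andP[_]; exact: g0.
Qed.

Section representations.
Import mathcomp.boot.fintype mathcomp.boot.finset.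
Variables (J : finType) (N : nat).
Local Notation T := 'I_N.+1.
Implicit Types (c : J -> nat) (k : {ffun J -> T}) (S U : {set T}).

Definition supp c : {set J} := [set i | (0 < c i)%N].

(* Coordinates of zero weight are set to 0, so that every solution is counted once. *)
Definition reps c (m : nat) : {set {ffun J -> T}} :=
  [set k : {ffun J -> T} | [forall i, (c i == 0)%N ==> (k i == ord0)] &&
    ((\sum_i c i * k i)%N == m)].

Definition entries c k : {set T} := k @: supp c.

Lemma repsP c m k :
  reflect ((forall i, c i = 0%N -> k i = ord0) /\ (\sum_i c i * k i)%N = m) (k \in reps c m).
Proof.
rewrite inE; apply: (iffP andP) => -[zero_coord /eqP sum_k]; split => //; try exact/eqP.
  by move=> i /eqP ci; have /forallP/(_ i)/implyP/(_ ci)/eqP := zero_coord.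
by apply/forallP => i; apply/implyP => /eqP ci; apply/eqP/zero_coord.
Qed.

Lemma card_reps_supp0 c m : supp c = set0 -> (#|reps c m| <= 1)%N.
Proof.
move=> c0; rewrite -(cards1 ([ffun=> ord0] : {ffun J -> T})); apply: subset_leq_card.
apply/subsetP => k /repsP[zero_coord _]; rewrite inE; apply/eqP/ffunP => i.
rewrite ffunE zero_coord//; have : i \notin supp c by rewrite c0 inE.
by rewrite inE -eqn0Ngt => /eqP.
Qed.

Definition zero_at k i : {ffun J -> T} := [ffun j => if j == i then ord0 else k j].

Lemma zero_at_inj k k' i : zero_at k i = zero_at k' i -> k i = k' i -> k = k'.
Proof.
move=> /ffunP agree ki; apply/ffunP => j; have := agree j; rewrite !ffunE.
by case: (eqVneq j i) => [->|].
Qed.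

Lemma imset_zero_at k i (I : {set J}) : i \in I -> k @: I = k i |: zero_at k i @: (I :\ i).
Proof.
move=> iI; rewrite -{1}(setD1K iI) imsetU1; congr (_ |: _).
apply: eq_in_imset => j; rewrite in_setD1 => /andP[ji _].
by rewrite ffunE (negbTE ji).
Qed.

Definition drop_weight c i : J -> nat := fun j => if j == i then 0%N else c j.

(* The weights of the equation in which the coordinates i and j are identified. *)
Definition merge_weight c i j : J -> nat :=
  fun t => if t == j then 0%N else if t == i then (c i + c j)%N else c t.

Lemma supp_drop c i : supp (drop_weight c i) = supp c :\ i.
Proof. by apply/setP => j; rewrite !inE /drop_weight; case: eqP. Qed.

Lemma supp_merge c i j : i \in supp c -> supp (merge_weight c i j) = supp c :\ j.
Proof.
rewrite inE => ci; apply/setP => t; rewrite !inE /merge_weight; case: eqP => //= _.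
by case: eqP => // ->; rewrite addn_gt0 ci.
Qed.

Lemma sum_drop_le c i : (\sum_t drop_weight c i t <= \sum_t c t)%N.
Proof. by apply: leq_sum => t _; rewrite /drop_weight; case: eqP. Qed.

Lemma sum_merge_weight c i j (f : J -> nat) : i != j -> f i = f j ->
  (\sum_t merge_weight c i j t * f t = \sum_t c t * f t)%N.
Proof.
move=> ij fij; rewrite (bigD1 j)//= [RHS](bigD1 j)//= (bigD1 i)//= [in RHS](bigD1 i)//=.
rewrite /merge_weight !eqxx (negbTE ij) mul0n add0n mulnDl fij addnCA addnA; congr (_ + _)%N.
by apply: eq_bigr => t /andP[/negbTE -> /negbTE ->].
Qed.

Lemma sum_merge c i j : i != j -> (\sum_t merge_weight c i j t = \sum_t c t)%N.
Proof.
move=> ij; have := sum_merge_weight c (f := fun=> 1%N) ij erefl.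
by under eq_bigr do rewrite muln1; under [RHS]eq_bigr do rewrite muln1.
Qed.

Lemma zero_at_reps_drop c m i k : k \in reps c m -> (c i * k i <= m)%N /\
  zero_at k i \in reps (drop_weight c i) (m - c i * k i).
Proof.
move=> /repsP[k0 <-]; rewrite (bigD1 i)//=; split; first exact: leq_addr.
apply/repsP; split => [j|]; first by rewrite /drop_weight ffunE; case: eqP => // _; exact: k0.
rewrite addKn (bigD1 i)//= /drop_weight eqxx mul0n add0n.
by apply: eq_bigr => j ji; rewrite ffunE (negbTE ji).
Qed.

Lemma zero_at_reps_merge c m i j k : i != j -> k i = k j -> k \in reps c m ->
  zero_at k j \in reps (merge_weight c i j) m.
Proof.
move=> ij kij /repsP[k0 <-]; apply/repsP; split=> [t|].
  rewrite /merge_weight ffunE; case: eqP => // _; case: eqP => [->|_]; last exact: k0.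
  by move/eqP; rewrite addn_eq0 => /andP[/eqP /k0].
rewrite -(sum_merge_weight c ij (f := fun t => k t : nat)) ?kij//.
by apply: eq_bigr => t _; rewrite /merge_weight ffunE; case: (t == j).
Qed.

Lemma entries_drop c i k : i \in supp c ->
  entries c k = k i |: entries (drop_weight c i) (zero_at k i).
Proof. by move=> ci; rewrite /entries supp_drop -imset_zero_at. Qed.

Lemma entries_merge c i j k : i \in supp c -> j \in supp c -> i != j -> k i = k j ->
  entries (merge_weight c i j) (zero_at k j) = entries c k.
Proof.
move=> ci cj ij kij; rewrite /entries supp_merge// (imset_zero_at k cj) -kij.
apply/esym/setUidPr; rewrite sub1set; apply/imsetP; exists i; first by rewrite in_setD1 ij.
by rewrite ffunE (negbTE ij).
Qed.

Definition distinct_entries c k := #|entries c k| == #|supp c|.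

Definition good S c k := distinct_entries c k && [disjoint entries c k & S].

Section weighted_sums.
Variables (R : realDomainType) (w : {set T} -> R).
Hypothesis w_ge0 : forall U, 0 <= w U.

Definition rep_sum c m : R := \sum_(k in reps c m) w (entries c k).

Lemma rep_sum_le0 c m : supp c = set0 -> rep_sum c m <= w set0.
Proof.
move=> c0; rewrite /rep_sum (eq_bigr (fun=> w set0)) => [|k _].
  by rewrite sumr_const -mulr_natl ler_piMl// lern1 card_reps_supp0.
by rewrite /entries c0 imset0.
Qed.

Lemma sum_hit_le S c m :
  \sum_(k in reps c m | ~~ [disjoint entries c k & S]) w (entries c k) <=
  \sum_(i in supp c) \sum_(x in S | (c i * x <= m)%N)
    \sum_(k in reps (drop_weight c i) (m - c i * x)) w (x |: entries (drop_weight c i) k).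
Proof.
apply: (@le_trans _ _
  (\sum_(k in reps c m) \sum_(i in supp c) \sum_(x in S | k i == x) w (entries c k))).
  rewrite big_mkcondr/=; apply: ler_sum => k _; case: ifPn => [|_]; last first.
    by apply: sumr_ge0 => i _; exact: sumr_ge0.
  move=> /pred0Pn[x /= /andP[/imsetP[i ci ->] kS]].
  rewrite (bigD1 i)//= (bigD1 (k i))/=; last by rewrite kS eqxx.
  by rewrite -addrA lerDl addr_ge0//; do ?[apply: sumr_ge0 => ? _].
rewrite exchange_big/=; apply: ler_sum => i ci.
rewrite (exchange_big_dep (mem S))/=; last by move=> k x _ /andP[].
rewrite [leRHS]big_mkcondr/=; apply: ler_sum => x xS.
rewrite (eq_bigl (fun k => k \in [set k in reps c m | k i == x])) => [|k]; last first.
  by rewrite xS [RHS]inE.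
case: ifPn => cxm; last first.
  rewrite big1// => k; rewrite inE => /andP[/(zero_at_reps_drop i)[kim _] /eqP kx].
  by move: kim cxm; rewrite kx => ->.
apply: (@ler_sum_inj _ _ _ _ _ (fun k => zero_at k i)) => //.
- move=> k k'; rewrite !inE => /andP[_ /eqP kx] /andP[_ /eqP k'x] /zero_at_inj.
  by apply; rewrite kx.
- by move=> k; rewrite inE => /andP[/(zero_at_reps_drop i)[_ +] /eqP <-].
- by move=> k; rewrite inE => /andP[_ /eqP <-]; rewrite -entries_drop.
Qed.

Lemma sum_not_distinct_le c m :
  \sum_(k in reps c m | ~~ distinct_entries c k) w (entries c k) <=
  \sum_(i in supp c) \sum_(j in supp c | i != j) rep_sum (merge_weight c i j) m.
Proof.
apply: (@le_trans _ _ (\sum_(k in reps c m) \sum_(i in supp c)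
    \sum_(j in supp c | (i != j) && (k i == k j)) w (entries c k))).
  rewrite big_mkcondr/=; apply: ler_sum => k _; case: ifPn => [not_inj|_]; last first.
    by apply: sumr_ge0 => i _; exact: sumr_ge0.
  have [i [j [ci cj ij kij]]] : exists i j, [/\ i \in supp c, j \in supp c, i != j & k i = k j].
    apply: contrapT => inj; move/imset_injP: not_inj; apply => i j ci cj kij.
    by apply/eqP; apply: contraPT isT => ij _; apply: inj; exists i, j.
  rewrite (bigD1 i)//= (bigD1 j)/=; last by rewrite cj ij kij eqxx.
  by rewrite -addrA lerDl addr_ge0//; do ?[apply: sumr_ge0 => ? _].
rewrite exchange_big/=; apply: ler_sum => i ci.
rewrite (exchange_big_dep (fun j => (j \in supp c) && (i != j)))/=; last first.
  by move=> k j _ /and3P[-> ->].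
apply: ler_sum => j /andP[cj ij].
rewrite (eq_bigl (fun k => k \in [set k in reps c m | k i == k j])) => [|k]; last first.
  by rewrite cj ij [RHS]inE.
apply: (@ler_sum_inj _ _ _ _ _ (fun k => zero_at k j)) => //.
- move=> k k'; rewrite !inE => /andP[_ /eqP kx] /andP[_ /eqP kx'] E.
  by apply: (zero_at_inj E); rewrite -kx -kx'; move/ffunP: E => /(_ i); rewrite !ffunE (negbTE ij).
- by move=> k; rewrite inE => /andP[kr /eqP kij]; apply: zero_at_reps_merge.
- by move=> k; rewrite inE => /andP[_ /eqP kij]; rewrite entries_merge.
Qed.

Lemma sum_not_good_le S c m (D : R) : 0 <= D ->
  (forall x U, x \in S -> w (x |: U) <= w U) ->
  (forall c' m', #|supp c'|.+1 = #|supp c| -> (\sum_t c' t <= \sum_t c t)%N -> (m' <= m)%N ->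
     rep_sum c' m' <= D) ->
  \sum_(k in reps c m | ~~ good S c k) w (entries c k) <= (#|supp c| * (#|S| + #|supp c|))%:R * D.
Proof.
move=> D0 wS lower; have card_supp i : i \in supp c -> #|supp c :\ i|.+1 = #|supp c|.
  by move=> ci; rewrite [RHS](cardsD1 i) ci.
have const_sum (I1 I2 : finType) (A : {set I1}) (B : {set I2}) :
    \sum_(i in A) \sum_(j in B) D = (#|A| * #|B|)%:R * D.
  by rewrite !sumr_const -mulrnA mulnC mulr_natl.
have hit_le : \sum_(k in reps c m | ~~ [disjoint entries c k & S]) w (entries c k) <=
    (#|supp c| * #|S|)%:R * D.
  apply: (le_trans (sum_hit_le S c m)); rewrite -const_sum.
  apply: ler_sum => i ci; rewrite big_mkcondr; apply: ler_sum => x xS; case: ifPn => // _.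
  apply: le_trans (lower (drop_weight c i) (m - c i * x)%N _ _ _).
  - by apply: ler_sum => k _; exact: wS.
  - by rewrite supp_drop card_supp.
  - exact: sum_drop_le.
  - exact: leq_subr.
have not_distinct_le : \sum_(k in reps c m | ~~ distinct_entries c k) w (entries c k) <=
    (#|supp c| * #|supp c|)%:R * D.
  apply: (le_trans (sum_not_distinct_le c m)); rewrite -const_sum.
  apply: ler_sum => i ci; rewrite big_mkcondr; apply: ler_sum => j cj; case: ifPn => // ij.
  by apply: lower; rewrite ?supp_merge ?card_supp ?sum_merge.
rewrite mulnDr natrD mulrDl; apply: le_trans (lerD hit_le not_distinct_le).
rewrite big_mkcondr [X in _ <= X + _]big_mkcondr [X in _ <= _ + X]big_mkcondr -big_split/=.
apply: ler_sum => k _; rewrite /good negb_and; have := w_ge0 (entries c k).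
by case: distinct_entries; case: [disjoint _ & _] => /= wk; rewrite ?addr0 ?add0r// lerDl.
Qed.

End weighted_sums.

Fixpoint level_const (R : realDomainType) (C : R) (s l : nat) : R :=
  if l is l'.+1 then C + (l * (s + l))%:R * level_const C s l' else 1.

Lemma level_const_ge0 (R : realDomainType) (C : R) s l : 0 <= C -> 0 <= level_const C s l.
Proof. by move=> C0; elim: l => //= l IH; rewrite addr_ge0// mulr_ge0. Qed.

Lemma ler_level_const (R : realDomainType) (C : R) s l l' : 0 <= C -> (l <= l')%N ->
  level_const C s l <= level_const C s l'.
Proof.
move=> C0 /subnKC <-; elim: (l' - l)%N => [|r IH]; first by rewrite addn0.
rewrite addnS /=; apply: (le_trans IH); rewrite -[leLHS]add0r -[X in 0 + X]mul1r.
by rewrite lerD// ler_wpM2r ?level_const_ge0// ler1n muln_gt0 addnS.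
Qed.

(* If some S makes the sum over good representations small at every level, then so are the
   full sums: the other representations come from a lower level. *)
Lemma rep_sum_level_le (R : realDomainType) (w : {set T} -> R) (W : nat -> R) (C : R)
    (L B s : nat) :
  (forall U, 0 <= w U) -> w set0 <= 1 -> (forall m, 1 <= W m) ->
  {homo W : m n / (m <= n)%N >-> m <= n} -> 0 <= C ->
  (forall c m, (0 < #|supp c| <= L)%N -> (\sum_t c t <= B)%N -> (m <= N)%N ->
    exists S, [/\ (#|S| <= s)%N, forall x U, x \in S -> w (x |: U) <= w U &
      \sum_(k in reps c m | good S c k) w (entries c k) <= C * W m]) ->
  forall c m, (#|supp c| <= L)%N -> (\sum_t c t <= B)%N -> (m <= N)%N ->
    rep_sum w c m <= level_const C s L * W m.
Proof.
move=> w0 w1 W1 Wmono C0 exists_S c m cL cB mN.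
have W0 n : 0 <= W n by exact: le_trans (W1 n).
apply: (@le_trans _ _ (level_const C s #|supp c| * W m)); last first.
  by rewrite ler_wpM2r// ler_level_const.
move El: #|supp c| => l; elim: l c m El cL cB mN => [|l IH] c m El cL cB mN.
  rewrite mul1r; apply: le_trans (le_trans (rep_sum_le0 w0 m _) (le_trans w1 (W1 m))) => //.
  by apply/eqP; rewrite -cards_eq0 El.
have [|S [Ss wS good_le]] := exists_S c m _ cB mN; first by rewrite cL El.
have D0 : 0 <= level_const C s l * W m by rewrite mulr_ge0// level_const_ge0.
have not_good_le := sum_not_good_le w0 (S := S) (c := c) (m := m) D0 wS.
rewrite /rep_sum (bigID (good S c))/= mulrDl -mulrA; apply: lerD => //.
apply: (le_trans (not_good_le _)) => [c' m' c'c c'B m'm|].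
  have lE : #|supp c'| = l by apply: succn_inj; rewrite c'c.
  apply: (@le_trans _ _ (level_const C s l * W m')).
    apply: IH => //; last exact: leq_trans mN.
      by rewrite -ltnS c'c ltnW.
    exact: leq_trans cB.
  by rewrite ler_wpM2l ?level_const_ge0// Wmono.
by rewrite El ler_wpM2r// ler_nat leq_mul2l leq_add2r Ss orbT.
Qed.

End representations.

Section random_representations.
Import mathcomp.boot.fintype mathcomp.boot.finset.
Variables (R : realType) (p : nat -> R).
Hypothesis p01 : forall x, 0 <= p x <= 1.
Variables (J : finType) (N : nat).
Local Notation T := 'I_N.+1.
Implicit Types (c : J -> nat) (k : {ffun J -> T}) (A S U : {set T}).

Local Notation pT := (fun x : T => p x).
Local Notation E := (expect pT (enum T)).
Local Notation Pr := (prob pT (enum T)).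

Let p_ge0 x : 0 <= p x. Proof. by case/andP: (p01 x). Qed.
Let pT01 (x : T) : 0 <= pT x <= 1. Proof. exact: p01. Qed.
Let sub_enum (U : {set T}) : U \subset enum T.
Proof. by apply/subsetP => x _; rewrite mem_enum. Qed.

Definition mean_reps c m : R := \sum_(k in reps N c m) \prod_(i in supp c) p (k i).

Lemma mean_reps_ge0 c m : 0 <= mean_reps c m.
Proof. by apply: sumr_ge0 => k _; exact: prodr_ge0. Qed.

Lemma mean_reps_rep_weight c m : (m <= N)%N ->
  mean_reps c m = rep_weight p [seq c i | i <- enum (supp c)] m.
Proof.
move=> mN; rewrite -(@coef_prod_rep_weight _ _ N)//; last first.
  by apply/allP => _ /mapP[i ci ->]; move: ci; rewrite mem_enum inE.
rewrite big_map big_enum/= (big_distr_big_dep ord0)/= coef_sum.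
rewrite /mean_reps [LHS]big_mkcond [RHS]big_mkcond/=; apply: eq_bigr => k _.
have -> : (k \in pfamily ord0 (mem (supp c)) (fun=> xpredT)) =
    [forall i, (c i == 0)%N ==> (k i == ord0)].
  apply/pfamilyP/forallP => [[/subsetP zero_coord _] i|zero_coord].
    apply/implyP => ci; apply/negPn; apply: contraTN ci => ki.
    by have := zero_coord i ki; rewrite inE lt0n.
  split => //; apply/subsetP => i; rewrite inE [in X in _ -> X]inE lt0n.
  by apply: contraNN => ci; have := zero_coord i; rewrite ci.
rewrite inE; have -> : (\sum_i c i * k i = \sum_(i in supp c) c i * k i)%N.
  rewrite [LHS](bigID (mem (supp c)))/= [X in (_ + X)%N]big1 ?addn0// => i.
  by rewrite inE -eqn0Ngt => /eqP ->; rewrite mul0n.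
case: [forall _, _] => //=.
rewrite scaler_prod prodrXr coefZ coefXn [m == _]eq_sym.
by case: eqP; rewrite ?mulr1 ?mulr0.
Qed.

Lemma incl_prob_entries c k : distinct_entries c k ->
  incl_prob pT (entries c k) = \prod_(i in supp c) p (k i).
Proof. by move=> /imset_injP inj; rewrite /incl_prob big_imset. Qed.

Lemma prod_le_incl_prob_entries c k :
  \prod_(i in supp c) p (k i) <= incl_prob pT (entries c k).
Proof.
rewrite (partition_big_imset k)/=; apply: ler_prod => y /imsetP[i ci ->].
rewrite prodr_ge0//= (bigD1 i)/= ?ci ?eqxx// ler_piMr//.
by apply: prodr_ile1 => j _; exact: p01.
Qed.

Lemma sum_good_incl_prob_le S c m :
  \sum_(k in reps N c m | good S c k) incl_prob pT (entries c k) <= mean_reps c m.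
Proof.
rewrite /mean_reps [leRHS](bigID (good S c))/= -[leLHS]addr0; apply: lerD.
  by apply: ler_sum => k /andP[_ /andP[/incl_prob_entries -> _]].
by apply: sumr_ge0 => k _; exact: prodr_ge0.
Qed.

Definition good_count S c m A : R :=
  \sum_(k in reps N c m | good S c k) (entries c k \subset A)%:R.

(* The number of ordered M-tuples of pairwise disjoint good representations. *)
Fixpoint disjoint_tuples (M : nat) c m S A : R :=
  if M is M'.+1 then
    \sum_(k in reps N c m | good S c k)
      (entries c k \subset A)%:R * disjoint_tuples M' c m (S :|: entries c k) A
  else 1.

Lemma disjoint_tuples_ge0 M c m S A : 0 <= disjoint_tuples M c m S A.
Proof.
elim: M S => [|M IH] S //=; apply: sumr_ge0 => k _; exact: mulr_ge0.
Qed.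

Lemma disjoint_tuples_setU M c m S U A : U \subset S ->
  disjoint_tuples M c m S (U :|: A) = disjoint_tuples M c m S A.
Proof.
elim: M S => [|M IH] S US //=; apply: eq_bigr => k /andP[_ /andP[_ dS]].
rewrite IH; last exact: subset_trans US (subsetUl _ _).
congr (_%:R * _); congr nat_of_bool; rewrite -subDset.
by move/setDidPl: (disjointWr US dS) => ->.
Qed.

Lemma expect_disjoint_tuples_le M c m S : E (disjoint_tuples M c m S) <= mean_reps c m ^+ M.
Proof.
elim: M S => [|M IH] S; first by rewrite -[leRHS](expect_cst pT (enum T)).
rewrite [disjoint_tuples M.+1 c m S](_ : _ = fun A => \sum_(k in reps N c m | good S c k)
  (entries c k \subset A)%:R * disjoint_tuples M c m (S :|: entries c k) A)// expect_sum exprS.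
apply: (@le_trans _ _ (\sum_(k in reps N c m | good S c k)
    incl_prob pT (entries c k) * mean_reps c m ^+ M)).
  apply: ler_sum => k _; rewrite expect_subset ?enum_uniq// ler_wpM2l ?incl_prob_ge0//.
  apply: le_trans (IH (S :|: entries c k)); apply: expect_le => // A.
  by rewrite disjoint_tuples_setU// subsetUr.
by rewrite -mulr_suml ler_wpM2r ?sum_good_incl_prob_le// exprn_ge0// mean_reps_ge0.
Qed.

Lemma disjoint_tuples_ge M c m S A (y : R) : 0 <= y ->
  (forall S', (#|S'| <= #|S| + #|supp c| * M)%N -> y <= good_count S' c m A) ->
  y ^+ M <= disjoint_tuples M c m S A.
Proof.
move=> y0; elim: M S => [//|M IH] S y_le /=.
rewrite exprSr; apply: (le_trans (ler_wpM2l (exprn_ge0 M y0) (y_le S (leq_addr _ _)))).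
rewrite /good_count mulr_sumr; apply: ler_sum => k _; rewrite mulrC ler_wpM2l//.
apply: IH => S' S'le; apply: y_le; apply: (leq_trans S'le); rewrite mulnS addnA leq_add2r.
apply: (leq_trans (leq_card_setU _ _)); rewrite leq_add2l; exact: leq_imset_card.
Qed.

(* A surplus of representations, even off every small set, produces many disjoint tuples. *)
Lemma prob_good_count_ge_le (M : nat) c m (y : R) : 0 < y ->
  Pr (fun A => forall S, (#|S| <= #|supp c| * M)%N -> y <= good_count S c m A) <=
    (y^-1 * mean_reps c m) ^+ M.
Proof.
move=> y0; have yM0 : 0 < y ^+ M by rewrite exprn_gt0.
apply: (@le_trans _ _ (E (fun A => (y ^+ M)^-1 * disjoint_tuples M c m set0 A))).
  apply: prob_le_expect => // A; first by rewrite mulr_ge0 ?disjoint_tuples_ge0// invr_ge0 ltW.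
  move=> surplus; rewrite -[leLHS](mulVf (lt0r_neq0 yM0)) ler_pM2l ?invr_gt0//.
  by apply: disjoint_tuples_ge (ltW y0) _ => S; rewrite cards0; exact: surplus.
by rewrite expectZ exprMn exprVn ler_wpM2l ?expect_disjoint_tuples_le// invr_ge0 ltW.
Qed.

Definition count_reps c m A : R := rep_sum (fun U => (U \subset A)%:R) c m.

Lemma good_count_ge S c m A (D : R) : 0 <= D ->
  (forall c' m', #|supp c'|.+1 = #|supp c| -> (\sum_t c' t <= \sum_t c t)%N -> (m' <= m)%N ->
     count_reps c' m' A <= D) ->
  count_reps c m A - (#|supp c| * (#|S| + #|supp c|))%:R * D <= good_count S c m A.
Proof.
move=> D0 lower; rewrite lerBlDr /count_reps /rep_sum (bigID (good S c))/= lerD2l.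
apply: (@sum_not_good_le _ _ _ (fun U => (U \subset A)%:R)) => // x U _; rewrite ler_nat.
by case: (boolP (x |: U \subset A)) => //; rewrite subUset => /andP[_ ->].
Qed.

Definition distinct_reps c m : seq {set T} :=
  [seq entries c k | k in [set k in reps N c m | distinct_entries c k]].

Lemma sum_distinct_incl_prob_ge c m (d : R) :
  \sum_(k in reps N c m | ~~ distinct_entries c k) incl_prob pT (entries c k) <= d ->
  mean_reps c m - d <= \sum_(U <- distinct_reps c m) incl_prob pT U.
Proof.
move=> not_distinct_le; rewrite lerBlDr big_map big_enum/=.
apply: (@le_trans _ _ (\sum_(k in reps N c m) incl_prob pT (entries c k))).
  by apply: ler_sum => k _; exact: prod_le_incl_prob_entries.
rewrite (bigID (distinct_entries c))/=; apply: lerD not_distinct_le.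
by apply: eq_ler; apply: eq_bigl => k; rewrite [in RHS]inE.
Qed.

Lemma discount_distinct_ge c m (t : R) A : 0 < t < 1 ->
  expR (- (t / (1 - t) * count_reps c m A)) <= discount t (distinct_reps c m) A.
Proof.
move=> /andP[t0 t1]; have onem_t : 0 < 1 - t by rewrite subr_gt0.
have factor_ge (x : bool) : expR (- (t / (1 - t) * x%:R)) <= 1 - t * x%:R.
  case: x; last by rewrite !mulr0 oppr0 expR0 addr0.
  rewrite !mulr1 expRN -[leRHS]invrK.
  rewrite lef_pV2 ?posrE ?invr_gt0 ?expR_gt0//; apply: le_trans (expR_ge1Dx _).
  by apply: eq_ler; field; exact: lt0r_neq0.
apply: (@le_trans _ _ (\prod_(U <- distinct_reps c m) expR (- (t / (1 - t) * (U \subset A)%:R)))).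
  rewrite -expR_sum ler_expR big_map big_enum/= sumrN -mulr_sumr lerN2 ler_pM2l ?divr_gt0//.
  rewrite [leLHS]big_mkcond [leRHS]big_mkcond; apply: ler_sum => k _.
  by rewrite inE; case: (k \in reps N c m) => //=; case: ifP.
by apply: ler_prod => U _; rewrite expR_ge0 factor_ge.
Qed.

(* Janson's inequality, for the representations with distinct entries only. *)
Lemma prob_count_lt_le c m (t d y : R) : 0 < t < 1 -> t * d <= 1 ->
  (forall S, (#|S| <= #|supp c|)%N ->
    \sum_(k in reps N c m | ~~ good S c k) incl_prob pT (entries c k :\: S) <= d) ->
  Pr (fun A => count_reps c m A < y) <=
    expR (t / (1 - t) * y - t * (1 - t * d) * (mean_reps c m - d)).
Proof.
move=> t_itv td1 overlap; have /andP[t0 t1] := t_itv; have t01 : 0 <= t <= 1 by rewrite !ltW.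
have odds0 : 0 < t / (1 - t) by rewrite divr_gt0// subr_gt0.
have mean_le : mean_reps c m - d <= \sum_(U <- distinct_reps c m) incl_prob pT U.
  apply: sum_distinct_incl_prob_ge; apply: le_trans (overlap set0 _); last by rewrite cards0.
  rewrite [leRHS](eq_bigl (fun k => (k \in reps N c m) && ~~ distinct_entries c k)) => [|k].
    by under [leRHS]eq_bigr => k _ do rewrite setD0.
  by rewrite /good disjoint_sym disjoints_subset sub0set andbT.
have janson : E (discount t (distinct_reps c m)) <=
    expR (- (t * (1 - t * d) * \sum_(U <- distinct_reps c m) incl_prob pT U)).
  apply: expect_discount_le => // [|_ /mapP[k _ ->]]; first exact: enum_uniq.
  rewrite big_map big_enum_cond/=; apply: le_trans (overlap (entries c k) (leq_imset_card _ _)).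
  rewrite [leLHS]big_mkcond [leRHS]big_mkcond; apply: ler_sum => k' _.
  rewrite inE /good negb_and; case: (k' \in reps N c m) => //=.
  by case: distinct_entries; case: [disjoint entries c k' & entries c k] => //=;
    exact: incl_prob_ge0.
apply: (@le_trans _ _ (E (fun A => expR (t / (1 - t) * y) * discount t (distinct_reps c m) A))).
  apply: prob_le_expect => // A; first by rewrite mulr_ge0 ?expR_ge0 ?discount_ge0.
  move=> /ltW count_le; apply: le_trans (ler_wpM2l (expR_ge0 _) (discount_distinct_ge c m A t_itv)).
  by rewrite -expRD -[leLHS]expR0 ler_expR -mulrBr mulr_ge0 ?subr_ge0// ltW.
rewrite expectZ; apply: (le_trans (ler_wpM2l (expR_ge0 _) janson)).
by rewrite -expRD ler_expR lerD2l lerN2 ler_wpM2l// mulr_ge0 ?subr_ge0// ltW.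
Qed.

End random_representations.

(** * Concentration *)

Definition weight_of (J : finType) (B : nat) (c : {ffun J -> 'I_B.+1}) : J -> nat := fun i => c i.

Lemma bounded_weights (J : finType) (B : nat) (c : J -> nat) : (\sum_i c i <= B)%N ->
  exists c' : {ffun J -> 'I_B.+1}, c = weight_of c'.
Proof.
move=> cB; have c_lt i : (c i < B.+1)%N.
  by rewrite ltnS; apply: leq_trans cB; rewrite (bigD1 i)//= leq_addr.
by exists [ffun i => Ordinal (c_lt i)]; apply/funext => i; rewrite /weight_of ffunE.
Qed.

Lemma expR_lnS_sq (R : realType) n : expR (- (2 * lnS n)) = (n.+1%:R ^+ 2)^-1 :> R.
Proof. by rewrite -(expR_lnS R n) -expRM_natl -expRN. Qed.

Lemma upper_moment_le (R : realType) (e x mu l : R) (M : nat) :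
  0 < e <= 3^-1 -> 0 < x -> 0 <= mu <= (1 + e / 4) * x -> 4 * l / e <= M%:R ->
  (((1 + e) * x)^-1 * mu) ^+ M <= expR (- (2 * l)).
Proof.
move=> /andP[e0 e3] x0 /andP[mu0 mu_le] M_ge.
have y0 : 0 < (1 + e) * x by rewrite mulr_gt0// addr_gt0.
have ratio_le : ((1 + e) * x)^-1 * mu <= expR (- (e / 2)).
  rewrite mulrC ler_pdivrMr//; apply: (le_trans mu_le); rewrite mulrA ler_wpM2r ?(ltW x0)//.
  have e1 : 0 <= 1 + e by lra.
  apply: le_trans (ler_wpM2r e1 (expR_ge1Dx (- (e / 2)))).
  have : 0 <= e * (3^-1 - e) by rewrite mulr_ge0 ?subr_ge0// ltW.
  lra.
have ratio_ge0 : 0 <= ((1 + e) * x)^-1 * mu by rewrite mulr_ge0// invr_ge0 ltW.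
apply: (@le_trans _ _ (expR (- (e / 2)) ^+ M)); first by rewrite lerXn2r ?nnegrE ?expR_ge0.
rewrite -expRM_natl ler_expR.
by have := ler_wpM2r (ltW e0) M_ge; rewrite divfK ?lt0r_neq0//; lra.
Qed.

Lemma janson_exponent_le (R : realType) (e d t l x y : R) :
  0 < e <= 3^-1 -> 0 <= d -> 0 <= l -> 0 < x -> 0 < t -> t * (1 + d) = e / 2 ->
  4 * (1 + d) * (l + 1) <= e ^+ 2 * x -> (1 - e / 4) * x - d <= y ->
  t / (1 - t) * ((1 - 3 * e) * x) - t * (1 - t * d) * y <= - (2 * l).
Proof.
move=> /andP[e0 e3] d0 l0 x0 t0 tE x_ge y_ge.
have td0 : 0 <= t * d by rewrite mulr_ge0// ltW.
have td_le : t * d <= e / 2 by lra.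
have t_le : t <= e / 2 by lra.
have e2_ge0 : 0 <= e * e by rewrite mulr_ge0 ?(ltW e0).
have y_ge_half : (1 - e / 2) * x <= y.
  have : e ^+ 2 * x <= e * x by rewrite ler_wpM2r ?(ltW x0)// expr2 ler_piMl ?(ltW e0)//; lra.
  have : 0 <= (1 + d) * l by rewrite mulr_ge0//; lra.
  lra.
have variance_term : t * ((1 - e) * x) <= t * (1 - t * d) * y.
  rewrite -mulrA ler_wpM2l ?(ltW t0)//.
  have td1 : 0 <= 1 - t * d by lra.
  apply: le_trans (ler_wpM2l td1 y_ge_half); rewrite mulrA ler_wpM2r ?(ltW x0)//.
  have : (1 - e / 2) * (1 - e / 2) <= (1 - t * d) * (1 - e / 2) by rewrite ler_wpM2r//; lra.
  lra.
have threshold_term : t / (1 - t) * ((1 - 3 * e) * x) <= t * ((1 - 2 * e) * x).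
  have onem_t : 0 < 1 - t by lra.
  rewrite -mulrA ler_wpM2l ?(ltW t0)// mulrC ler_pdivrMr// mulrAC ler_wpM2r ?(ltW x0)//.
  have : (1 - 2 * e) * (1 - e / 2) <= (1 - 2 * e) * (1 - t) by rewrite ler_wpM2l//; lra.
  lra.
have gain : 2 * l <= t * (e * x).
  have d1 : 0 < 2 * (1 + d) by lra.
  rewrite -(ler_pM2r d1); apply: (@le_trans _ _ (e ^+ 2 * x)); first by lra.
  apply: eq_ler.
  have -> : t * (e * x) * (2 * (1 + d)) = t * (1 + d) * (2 * (e * x)) by ring.
  by rewrite tE; field.
lra.
Qed.

Section concentration.
Import mathcomp.boot.fintype mathcomp.boot.finset.
Variables (R : realType) (h : nat) (b : 'I_h -> nat) (p : nat -> R).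
Hypothesis p01 : forall x, 0 <= p x <= 1.
Hypothesis b_gt0 : forall i, (0 < b i)%N.
Variables (W : nat -> R) (C z : R).
Hypothesis W_ge1 : forall m, 1 <= W m.
Hypothesis W_homo : {homo W : m n / (m <= n)%N >-> m <= n}.
Hypothesis C_ge0 : 0 <= C.
Hypothesis z_gt0 : 0 < z.
Implicit Type c : 'I_h -> nat.

Local Notation B := (\sum_(i < h) b i)%N.
Local Notation Pr N := (prob (fun x : 'I_N.+1 => p x) (enum 'I_N.+1)).

Hypothesis mean_lower_level : forall N c m, (0 < #|supp c| <= h.-1)%N -> (\sum_i c i <= B)%N ->
  (m <= N)%N -> mean_reps p N c m <= C * W m * expR (- z * lnS m).

Let W_gt0 m : 0 < W m. Proof. exact: lt_le_trans (W_ge1 m). Qed.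
Let mean_ge0 N c m : 0 <= mean_reps p N c m. Proof. exact: mean_reps_ge0. Qed.

Let card_supp_b : #|supp b| = h.
Proof.
rewrite -[RHS]card_ord -cardsT; congr #|pred_of_set _|.
by apply/setP => i; rewrite !inE b_gt0.
Qed.

Let card_supp_lower c : #|supp c|.+1 = #|supp b| -> (#|supp c| <= h.-1)%N.
Proof. by rewrite card_supp_b => /(congr1 predn) /= ->. Qed.

Definition sparse (D : R) N (A : {set 'I_N.+1}) :=
  forall c m, (#|supp c| <= h.-1)%N -> (\sum_i c i <= B)%N -> (m <= N)%N ->
    count_reps R c m A <= D * W m.

Lemma sparse_of_good_count_le (M N : nat) (K : R) (A : {set 'I_N.+1}) : 0 <= K ->
  (forall c m, (0 < #|supp c| <= h.-1)%N -> (\sum_i c i <= B)%N -> (m <= N)%N ->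
    exists2 S : {set 'I_N.+1}, (#|S| <= #|supp c| * M)%N & good_count R S c m A <= K * W m) ->
  sparse (level_const K (h.-1 * M) h.-1) A.
Proof.
move=> K0 exists_S; apply: rep_sum_level_le => //; first by rewrite lern1 leq_b1.
move=> c m cI cB mN; have [S Sle good_le] := exists_S c m cI cB mN; exists S; split => //.
  by apply: (leq_trans Sle); rewrite leq_mul2r; case/andP: cI => _ ->; rewrite orbT.
move=> x U _; rewrite ler_nat; case: (boolP (x |: U \subset A)) => //.
by rewrite subUset => /andP[_ ->].
Qed.

Lemma lower_level_moment_le N c m (K : R) (M : nat) : C <= K -> 0 < K -> (0 < M)%N ->
  2 <= z * M%:R -> (0 < #|supp c| <= h.-1)%N -> (\sum_i c i <= B)%N -> (m <= N)%N ->
  ((K * W m)^-1 * mean_reps p N c m) ^+ M <= C / K * (m.+1%:R ^+ 2)^-1.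
Proof.
move=> CK K0 M0 zM cI cB mN.
have ratio_le : (K * W m)^-1 * mean_reps p N c m <= C / K * expR (- z * lnS m).
  apply: (le_trans (ler_wpM2l _ (mean_lower_level cI cB mN))).
    by rewrite invr_ge0 mulr_ge0// ltW.
  by have := W_gt0 m; move: (W m) => x x0; apply: eq_ler; field; rewrite !lt0r_neq0.
have CK0 : 0 <= C / K by rewrite divr_ge0// ltW.
apply: (@le_trans _ _ ((C / K * expR (- z * lnS m)) ^+ M)).
  have ratio_ge0 : 0 <= (K * W m)^-1 * mean_reps p N c m.
    by rewrite mulr_ge0 ?mean_ge0// invr_ge0 mulr_ge0// ltW.
  by rewrite lerXn2r ?nnegrE// mulr_ge0 ?expR_ge0.
rewrite exprMn; apply: ler_pM; rewrite ?exprn_ge0 ?expR_ge0//.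
  by rewrite -(prednK M0) exprS ler_piMr// exprn_ile1// ler_pdivrMr// mul1r.
rewrite -expRM_natl -(expR_lnS R m) -expRM_natl -expRN ler_expR.
by have := ler_wpM2r (lnS_ge0 R m) zM; lra.
Qed.

Lemma sum_inv_sq_ord_le (N : nat) : \sum_(m < N.+1) (m.+1%:R ^+ 2)^-1 <= 2 :> R.
Proof.
rewrite -(big_mkord xpredT (fun m => (m.+1%:R ^+ 2)^-1 : R)) big_ltn// expr1n invr1.
by have := @sum_inv_sq_le R 1 N.+1 isT; rewrite invr1; lra.
Qed.

Lemma sparse_or_surplus (M N : nat) (K : R) (A : {set 'I_N.+1}) : 0 <= K ->
  ~ sparse (level_const K (h.-1 * M) h.-1) A ->
  exists (c : {ffun 'I_h -> 'I_B.+1}) (m : 'I_N.+1),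
  [/\ (0 < #|supp (weight_of c)| <= h.-1)%N, (\sum_i c i <= B)%N &
    forall S : {set 'I_N.+1}, (#|S| <= #|supp (weight_of c)| * M)%N ->
      K * W m <= good_count R S (weight_of c) m A].
Proof.
move=> K0; apply: contra_notP => no_surplus; apply: sparse_of_good_count_le K0 _ => c m cI cB mN.
apply: contrapT => no_S; apply: no_surplus.
have [c' cE] := bounded_weights cB; rewrite {c}cE in cI cB no_S *.
exists c', (Ordinal (mN : m < N.+1)%N); split=> // S Sle.
by rewrite leNgt; apply/negP => /ltW good_le; apply: no_S; exists S.
Qed.

Lemma prob_not_sparse_le : exists2 D : R, 0 <= D & forall N,
  Pr N (fun A => ~ sparse D A) <= 4^-1.
Proof.
pose M := (Num.truncn (2 / z)).+1.
have zM : 2 <= z * M%:R by rewrite mulrC -ler_pdivrMr// ltW// truncnS_gt.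
pose q : R := #|{ffun 'I_h -> 'I_B.+1}|%:R; pose K := 8 * (q + 1) * (C + 1).
have q0 : 0 <= q by exact: ler0n.
have qC : 0 <= q * C by rewrite mulr_ge0.
have CK : C <= K by rewrite /K; have := C_ge0; lra.
have K0 : 0 < K by rewrite /K; have := C_ge0; lra.
exists (level_const K (h.-1 * M) h.-1) => [|N]; first by rewrite level_const_ge0// ltW.
pose r := [seq x <- enum {: {ffun 'I_h -> 'I_B.+1} * 'I_N.+1} |
  (0 < #|supp (weight_of x.1)| <= h.-1)%N && (\sum_i x.1 i <= B)%N].
pose surplus (x : {ffun 'I_h -> 'I_B.+1} * 'I_N.+1) (A : {set 'I_N.+1}) := forall S : {set 'I_N.+1},
  (#|S| <= #|supp (weight_of x.1)| * M)%N -> K * W x.2 <= good_count R S (weight_of x.1) x.2 A.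
have union_bound : Pr N (fun A => ~ sparse (level_const K (h.-1 * M) h.-1) A) <=
    \sum_(x <- r) Pr N (surplus x).
  apply: (@le_trans _ _ (Pr N (fun A => exists2 x, x \in r & surplus x A))).
    apply: prob_le => // A /(sparse_or_surplus (ltW K0))[c [m [cI cB surplusA]]].
    by exists (c, m) => //; rewrite mem_filter mem_enum cI cB.
  exact: prob_exists_le.
apply: (le_trans union_bound); rewrite big_filter big_enum_cond/=.
have CK0 : 0 <= C / K by rewrite divr_ge0// ltW.
apply: (@le_trans _ _ (\sum_(x : {ffun 'I_h -> 'I_B.+1} * 'I_N.+1) C / K * (x.2.+1%:R ^+ 2)^-1)).
  rewrite big_mkcond; apply: ler_sum => x _; case: ifPn => [/andP[cI cB]|_]; last first.
    by rewrite mulr_ge0 ?invr_ge0 ?exprn_ge0.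
  apply: le_trans (@prob_good_count_ge_le _ _ p01 _ _ M _ _ _ (mulr_gt0 K0 (W_gt0 x.2))) _.
  by apply: lower_level_moment_le => //; rewrite -ltnS.
rewrite -(pair_big xpredT xpredT (fun (_ : {ffun 'I_h -> 'I_B.+1}) (m : 'I_N.+1) =>
  C / K * (m.+1%:R ^+ 2)^-1))/=.
rewrite sumr_const -mulr_sumr -[leLHS]mulr_natr -/q.
apply: (@le_trans _ _ (C / K * 2 * q)).
  by rewrite ler_wpM2r// ler_wpM2l ?sum_inv_sq_ord_le.
by rewrite mulrAC -mulrA mulrAC ler_pdivrMr// /K; have := C_ge0; lra.
Qed.

Definition overlap_const : R := (h * (h + h))%:R * level_const C h h.-1.

Lemma overlap_const_ge0 : 0 <= overlap_const.
Proof. by rewrite mulr_ge0// level_const_ge0. Qed.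

Lemma sum_not_good_overlap_le N n (S : {set 'I_N.+1}) : (n <= N)%N -> (#|S| <= h)%N ->
  \sum_(k in reps N b n | ~~ good S b k) incl_prob (fun x : 'I_N.+1 => p x) (entries b k :\: S) <=
    overlap_const * W n.
Proof.
move=> nN Sh; pose w (U : {set 'I_N.+1}) := incl_prob (fun x : 'I_N.+1 => p x) (U :\: S).
have w_ge0 U : 0 <= w U by apply: incl_prob_ge0 => x; exact: p01.
have wS x U : x \in S -> w (x |: U) <= w U.
  by move=> xS; rewrite /w setDUl (_ : [set x] :\: S = set0) ?set0U//; apply/eqP;
    rewrite setD_eq0 sub1set.
have lower : forall c m, (#|supp c| <= h.-1)%N -> (\sum_i c i <= B)%N -> (m <= N)%N ->
    rep_sum w c m <= level_const C h h.-1 * W m.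
  apply: rep_sum_level_le => //; first by rewrite /w set0D /incl_prob big_set0.
  move=> c m cI cB mN; exists S; split => //.
  rewrite (eq_bigr (fun k => incl_prob (fun x : 'I_N.+1 => p x) (entries c k))) => [|k].
    apply: (le_trans (sum_good_incl_prob_le p01 _ _ _)).
    apply: (le_trans (mean_lower_level cI cB mN)).
    by rewrite ler_piMr ?mulr_ge0 ?(ltW (W_gt0 _))// expR_le1 mulNr oppr_le0 mulr_ge0 ?lnS_ge0 ?ltW.
  by move=> /andP[_ /andP[_ /setDidPl kS]]; rewrite /w kS.
have not_good_le := sum_not_good_le w_ge0 (S := S) (c := b) (m := n).
apply: (le_trans (not_good_le (level_const C h h.-1 * W n) _ wS _)).
- by rewrite mulr_ge0 ?level_const_ge0// ltW.
- move=> c m cI cB mn; apply: (@le_trans _ _ (level_const C h h.-1 * W m)).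
    by apply: lower => //; [exact: card_supp_lower|exact: leq_trans nN].
  by rewrite ler_wpM2l ?level_const_ge0 ?W_homo.
rewrite card_supp_b /overlap_const -[leRHS]mulrA ler_wpM2r//.
  by rewrite mulr_ge0 ?level_const_ge0// ltW.
by rewrite ler_nat leq_mul2l leq_add2r Sh orbT.
Qed.

Lemma prob_count_above_le N n (e D x : R) : 0 < e <= 3^-1 -> 0 <= D -> 0 < x -> (n <= N)%N ->
  mean_reps p N b n <= (1 + e / 4) * x ->
  h%:R ^+ 2 * D * (4 / e + 2) / e * W n * (lnS n + 1) <= x ->
  Pr N (fun A => sparse D A /\ (1 + 2 * e) * x < count_reps R b n A) <= (n.+1%:R ^+ 2)^-1.
Proof.
move=> e01 D0 x0 nN mean_le growth; have /andP[e0 e3] := e01; have l0 := lnS_ge0 R n.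
have M_ge0 : 0 <= 4 * lnS n / e by rewrite divr_ge0 ?mulr_ge0// ltW.
pose M := (Num.truncn (4 * lnS n / e)).+1.
have M_ge : 4 * lnS n / e <= M%:R by apply: ltW; exact: truncnS_gt.
have M_le : M%:R <= 4 * lnS n / e + 1.
  by rewrite /M -natr1 lerD2r; have /andP[] := truncn_itv M_ge0.
have y0 : 0 < (1 + e) * x by rewrite mulr_gt0// addr_gt0.
have loss_le : h%:R ^+ 2 * (M%:R + 1) * (D * W n) <= e * x.
  apply: le_trans (ler_wpM2l (ltW e0) growth).
  rewrite [leLHS](_ : _ = h%:R ^+ 2 * D * W n * (M%:R + 1)); last by ring.
  rewrite [leRHS](_ : _ = h%:R ^+ 2 * D * W n * ((4 / e + 2) * (lnS n + 1))); last first.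
    by field; exact: lt0r_neq0.
  rewrite ler_wpM2l ?mulr_ge0 ?exprn_ge0 ?(ltW (W_gt0 _))//.
  have : 0 <= 4 / e by rewrite divr_ge0// ltW.
  by move: M_le; rewrite [4 * lnS n / e]mulrAC; move: (4 / e) (lnS n) l0 => c l l0; lra.
have mean_itv : 0 <= mean_reps p N b n <= (1 + e / 4) * x by rewrite mean_ge0.
rewrite -expR_lnS_sq; apply: le_trans (upper_moment_le e01 x0 mean_itv M_ge).
apply: le_trans (@prob_good_count_ge_le _ _ p01 _ N M b n _ y0).
apply: prob_le => // A [sparseA count_gt] S.
rewrite card_supp_b => Sle; have DW0 : 0 <= D * W n by rewrite mulr_ge0// ltW.
have good_ge : count_reps R b n A - (h * (#|S| + h))%:R * (D * W n) <= good_count R S b n A.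
  have := good_count_ge S (c := b) (m := n) (A := A) DW0; rewrite card_supp_b; apply=> c m cI cB mn.
  apply: (@le_trans _ _ (D * W m)); last by rewrite ler_wpM2l ?W_homo.
  by apply: sparseA => //; [apply: card_supp_lower; rewrite card_supp_b|exact: leq_trans nN].
have : (h * (#|S| + h))%:R * (D * W n) <= h%:R ^+ 2 * (M%:R + 1) * (D * W n).
  rewrite ler_wpM2r// natr1 -natrX -natrM ler_nat -mulnn -mulnA leq_mul2l mulnS.
  by rewrite addnC leq_add2l Sle orbT.
lra.
Qed.

Lemma prob_count_below_le N n (e x : R) : 0 < e <= 3^-1 -> 0 < x -> (n <= N)%N ->
  (1 - e / 4) * x <= mean_reps p N b n ->
  4 * (1 + overlap_const) / e ^+ 2 * W n * (lnS n + 1) <= x ->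
  Pr N (fun A => count_reps R b n A < (1 - 3 * e) * x) <= (n.+1%:R ^+ 2)^-1.
Proof.
move=> e01 x0 nN mean_ge growth; have /andP[e0 e3] := e01; have l0 := lnS_ge0 R n.
pose d := overlap_const * W n.
have d0 : 0 <= d by rewrite mulr_ge0 ?overlap_const_ge0// ltW.
pose t := e / (2 * (1 + d)).
have t0 : 0 < t by rewrite divr_gt0//; lra.
have tE : t * (1 + d) = e / 2 by rewrite /t; field; lra.
have td0 : 0 <= t * d by rewrite mulr_ge0// ltW.
have t01 : 0 < t < 1 by rewrite t0/=; lra.
have x_ge : 4 * (1 + d) * (lnS n + 1) <= e ^+ 2 * x.
  apply: le_trans (ler_wpM2l (exprn_ge0 2 (ltW e0)) growth).
  rewrite [leRHS](_ : _ = 4 * (W n + d) * (lnS n + 1)); last by rewrite /d; field; exact: lt0r_neq0.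
  by rewrite ler_wpM2r ?addr_ge0// ler_wpM2l// lerD2r.
have mean_sub_ge : (1 - e / 4) * x - d <= mean_reps p N b n - d by rewrite lerD2r.
rewrite -expR_lnS_sq; apply: (@le_trans _ _ (expR (t / (1 - t) * ((1 - 3 * e) * x) -
    t * (1 - t * d) * (mean_reps p N b n - d)))).
  apply: prob_count_lt_le => //; first by lra.
  by move=> S; rewrite card_supp_b; exact: sum_not_good_overlap_le.
by rewrite ler_expR; exact: janson_exponent_le tE x_ge mean_sub_ge.
Qed.

Lemma rep_countE N n (A : {set 'I_N.+1}) (P : pred nat) :
  (forall x : 'I_N.+1, P x = (x \in A)) -> (n <= N)%N ->
  (rep_count b P n)%:R = count_reps R b n A.
Proof.
move=> PA nN; rewrite /count_reps /rep_sum -natr_sum -big_mkcondr/= sum1_card; congr _%:R.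
have nN1 : (n.+1 <= N.+1)%N by [].
pose widen (k : {ffun 'I_h -> 'I_n.+1}) : {ffun 'I_h -> 'I_N.+1} := [ffun i => widen_ord nN1 (k i)].
have widen_inj : injective widen.
  by move=> k k' /ffunP E; apply/ffunP => i; apply/val_inj; have := E i; rewrite !ffunE => -[].
rewrite /rep_count -(card_imset _ widen_inj); apply: eq_card => k'.
have sum_widen (k : {ffun 'I_h -> 'I_n.+1}) : (\sum_i b i * widen k i = \sum_i b i * k i)%N.
  by apply: eq_bigr => i _; rewrite ffunE.
apply/imsetP/andP => [[k]|[/repsP[_ kn] /subsetP kA]].
  rewrite classical_sets.in_setE => /andP[/forallP kA /eqP kn] ->; split.
    by apply/repsP; split=> [i bi|]; [have := b_gt0 i; rewrite bi|rewrite sum_widen].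
  by apply/subsetP => _ /imsetP[i _ ->]; rewrite -PA ffunE/=; exact: kA.
have k_lt i : (k' i < n.+1)%N.
  by rewrite ltnS -kn (bigD1 i)//=; apply: leq_trans (leq_addr _ _); rewrite leq_pmull.
have k'E : k' = widen [ffun i => Ordinal (k_lt i)].
  by apply/ffunP => i; rewrite !ffunE; exact: val_inj.
exists [ffun i => Ordinal (k_lt i)] => //.
rewrite classical_sets.in_setE/= -sum_widen -k'E kn eqxx andbT.
apply/forallP => i; rewrite ffunE/= PA; apply: kA.
by apply/imsetP; exists i => //; rewrite inE b_gt0.
Qed.

Definition deviates (f : nat -> R) (e : R) n N (A : {set 'I_N.+1}) :=
  3 * e * f n < `|count_reps R b n A - f n|.

Lemma prob_deviates_le N n (e D : R) (f : nat -> R) : 0 < e <= 3^-1 -> 0 <= D -> 0 < f n ->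
  (n <= N)%N -> (1 - e / 4) * f n <= mean_reps p N b n <= (1 + e / 4) * f n ->
  h%:R ^+ 2 * D * (4 / e + 2) / e * W n * (lnS n + 1) <= f n ->
  4 * (1 + overlap_const) / e ^+ 2 * W n * (lnS n + 1) <= f n ->
  Pr N (fun A => sparse D A /\ deviates f e n A) <= 2 * (n.+1%:R ^+ 2)^-1.
Proof.
move=> e01 D0 f0 nN /andP[mean_ge mean_le] growth_gt growth_lt.
have ef0 : 0 <= e * f n by rewrite mulr_ge0 ?(ltW f0)//; case/andP: e01 => /ltW.
have above := prob_count_above_le e01 D0 f0 nN mean_le growth_gt.
have below := prob_count_below_le e01 f0 nN mean_ge growth_lt.
rewrite mulr_natl mulr2n; apply: le_trans (lerD above below).
apply: le_trans (prob_or_le _ _ _ _) => //; apply: prob_le => // A [sparseA].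
by rewrite /deviates ltr_normr => /orP[gt_f|lt_f]; [left; split => //; lra|right; lra].
Qed.

Lemma exists_pred_near (f e : nat -> R) (D : R) (n0 : nat) : (8 <= n0)%N ->
  (forall N, Pr N (fun A => ~ sparse D A) <= 4^-1) ->
  (forall n N, (n0 <= n <= N)%N ->
    Pr N (fun A => sparse D A /\ deviates f (e n) n A) <= 2 * (n.+1%:R ^+ 2)^-1) ->
  exists P : pred nat, forall n, (n0 <= n)%N -> `|(rep_count b P n)%:R - f n| <= 3 * e n * f n.
Proof.
move=> n08 not_sparse_le deviates_le.
pose concentrated n (P : pred nat) :=
  (n0 <= n)%N -> `|(rep_count b P n)%:R - f n| <= 3 * e n * f n.
apply: (@pred_compactness concentrated) => [n P P' PP' P_close n0n|N].
  have -> : rep_count b P' n = rep_count b P n.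
    pose A := [set x : 'I_n.+1 | P x]; apply/eqP; rewrite -(eqr_nat R).
    by rewrite !(@rep_countE n n A)// => x; rewrite inE// PP'// -ltnS.
  exact: P_close.
pose bad n (A : {set 'I_N.+1}) := sparse D A /\ deviates f (e n) n A.
have : Pr N (fun A => ~ sparse D A \/ exists2 n, n \in index_iota n0 N.+1 & bad n A) < 1.
  apply: (le_lt_trans (prob_or_le _ _ _ _)) => //.
  have many_bad : Pr N (fun A => exists2 n, n \in index_iota n0 N.+1 & bad n A) <= 4^-1.
    apply: (le_trans (prob_exists_le _ _ _ _)) => //.
    apply: (@le_trans _ _ (\sum_(n0 <= n < N.+1) 2 * (n.+1%:R ^+ 2)^-1)).
      rewrite big_seq [leRHS]big_seq; apply: ler_sum => n.
      by rewrite mem_index_iota; exact: deviates_le.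
    rewrite -mulr_sumr.
    have := @sum_inv_sq_le R n0 N.+1 (leq_trans (isT : 0 < 8)%N n08).
    have : n0%:R^-1 <= 8^-1 :> R by rewrite lef_pV2 ?posrE ?ltr0n ?ler_nat// (leq_trans _ n08).
    lra.
  by have := not_sparse_le N; lra.
move=> /prob_lt1_ex[//|A /not_orP[/contrapT sparseA no_bad]].
exists (fun x => [exists y in A, y == x :> nat]) => n nN n0n.
have PA (x : 'I_N.+1) : [exists y in A, y == x :> nat] = (x \in A).
  apply/exists_inP/idP => [[y yA /eqP/val_inj <-//]|xA]; by exists x.
rewrite (rep_countE PA nN) leNgt; apply/negP => dev.
by apply: no_bad; exists n => //; rewrite mem_index_iota n0n ltnS.
Qed.

Local Open Scope classical_set_scope.
Local Open Scope ring_scope.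

Lemma prob_deviates_near (f : nat -> R) (D : R) : 0 <= D ->
  rep_weight p [seq b i | i <- enum 'I_h] n / f n @[n --> \oo] --> (1 : R) ->
  (forall K : R, \forall n \near \oo, K * W n * (lnS n + 1) <= f n) ->
  forall e : R, 0 < e <= 3^-1 -> \forall n \near \oo, 0 < f n /\
    forall N, (n <= N)%N -> Pr N (fun A => sparse D A /\ deviates f e n A) <= 2 * (n.+1%:R ^+ 2)^-1.
Proof.
move=> D0 mean_cvg growth e e01; have /andP[e0 _] := e01.
have e4 : 0 < e / 4 by rewrite divr_gt0.
have /cvgrPdist_le/(_ _ e4) mean_near := mean_cvg.
have growth1 := growth 1; have growth_gt := growth (h%:R ^+ 2 * D * (4 / e + 2) / e).
have growth_lt := growth (4 * (1 + overlap_const) / e ^+ 2).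
near=> n.
have f0 : 0 < f n.
  apply: (@lt_le_trans _ _ (1 * W n * (lnS n + 1))); last by near: n.
  by rewrite mul1r mulr_gt0// ltr_wpDl// lnS_ge0.
split=> // N nN; apply: prob_deviates_le => //; try by near: n.
have -> : mean_reps p N b n = rep_weight p [seq b i | i <- enum 'I_h] n.
  rewrite mean_reps_rep_weight//; congr (rep_weight p (map b _) n).
  by apply: eq_enum => i; rewrite !inE b_gt0.
have : `|1 - rep_weight p [seq b i | i <- enum 'I_h] n / f n| <= e / 4 by near: n.
rewrite ler_norml => /andP[? ?].
by apply/andP; split; [rewrite -ler_pdivlMr//|rewrite -ler_pdivrMr//]; lra.
Unshelve. all: by end_near. Qed.

Lemma exists_pred_rep_count_equiv (f : nat -> R) :
  rep_weight p [seq b i | i <- enum 'I_h] n / f n @[n --> \oo] --> (1 : R) ->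
  (forall K : R, \forall n \near \oo, K * W n * (lnS n + 1) <= f n) ->
  exists P : pred nat, (rep_count b P n)%:R / f n @[n --> \oo] --> (1 : R).
Proof.
move=> mean_cvg growth.
have [D D0 not_sparse_le] := prob_not_sparse_le.
have third_gt0 : 0 < 3^-1 :> R by rewrite invr_gt0.
have [e [e_cvg0 [n1 _ near_e]]] :=
  diagonal_near third_gt0 (prob_deviates_near D0 mean_cvg growth).
have [|//|n N|P P_close] := @exists_pred_near f e D (maxn n1 8); first exact: leq_maxr.
  rewrite geq_max => /andP[/andP[n1n _] nN].
  by have [_ [_]] := near_e n n1n; apply.
exists P; apply/cvgrPdist_le => d d0.
have d3 : 0 < d / 3 by rewrite divr_gt0.
have /cvgr0Pnorm_le/(_ _ d3) e_near := e_cvg0.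
near=> n.
have nn1 : (maxn n1 8 <= n)%N by near: n; exact: nbhs_infty_ge.
have [_ [f0 _]] := near_e n (leq_trans (leq_maxl _ _) nn1).
rewrite distrC -[X in _ - X](divff (lt0r_neq0 f0)) -mulrBl normrM normfV (gtr0_norm f0).
rewrite ler_pdivrMr//; apply: (le_trans (P_close n nn1)); rewrite ler_wpM2r ?(ltW f0)//.
have : `|e n| <= d / 3 by near: n.
by have := ler_norm (e n); lra.
Unshelve. all: by end_near. Qed.

End concentration.

(** * Choice of the probabilities *)

Local Open Scope classical_set_scope.
Local Open Scope ring_scope.

Lemma log_le_power_near (R : realType) (K E g : R) : 0 < E -> 0 < g ->
  \forall n \near \oo, K * (lnS n + 1) <= E * expR (g * lnS n).
Proof.
move=> E0 g0; have q0 : 0 < E * g ^+ 2 by rewrite mulr_gt0 ?exprn_gt0.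
have lnS_large := near_lnS_ge (4 * `|K| / (E * g ^+ 2)); have lnS_ge1 := near_lnS_ge (1 : R).
near=> n; have l1 : 1 <= lnS n :> R by near: n.
have : 4 * `|K| / (E * g ^+ 2) <= lnS n by near: n.
rewrite ler_pdivrMr// => large.
have gl0 : 0 <= g * lnS n by rewrite mulr_ge0 ?(ltW g0)// lnS_ge0.
have l0 : 0 <= lnS n :> R by exact: lnS_ge0.
apply: le_trans (ler_wpM2l (ltW E0) (expR_ge1Dxn 1 gl0)).
apply: (@le_trans _ _ (`|K| * (2 * lnS n))).
  apply: (le_trans (ler_wpM2r _ (ler_norm K))); first by lra.
  by rewrite ler_wpM2l//; lra.
have := ler_wpM2r l0 large; rewrite (_ : 2`! = 2%N)// expr2; lra.
Unshelve. all: by end_near. Qed.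

Section growth_exponent.
Variables (R : realType) (rho : R) (f : nat -> R).
Hypothesis regvar_f : log_regvar rho f.
Hypothesis growth : forall K : R, \forall n \near \oo, K * (lnS n + 1) <= expR (f n).

Lemma log_growth_index_ge0 : 0 <= rho.
Proof.
apply: (log_regvar_index_ge (K := 0) regvar_f); apply: filterS (growth 1) => n.
rewrite mul1r mul0r addr0 => f_ge.
by rewrite -ler_expR expR0; apply: le_trans f_ge; rewrite lerDr lnS_ge0.
Qed.

(* W = n ^ theta separates the mean F from the lower levels, which are of order F / n ^ d. *)
Lemma exists_growth_exponent (d : R) : 0 < d -> exists theta, [/\ 0 <= theta, rho - d < theta &
  forall K : R, \forall n \near \oo, K * expR (theta * lnS n) * (lnS n + 1) <= expR (f n)].
Proof.
move=> d0; have rho_ge0 := log_growth_index_ge0.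
have [rho0|rho_neq0] := eqVneq rho 0.
  exists 0; split => //; first by lra.
  by move=> K; apply: filterS (growth K) => n; rewrite mul0r expR0 mulr1.
have rho_gt0 : 0 < rho by rewrite lt_def rho_neq0.
pose g := Num.min (rho / 3) (d / 3).
have g_rho : g <= rho / 3 by rewrite ge_min lexx.
have g_d : g <= d / 3 by rewrite ge_min lexx orbT.
have g0 : 0 < g by rewrite lt_min !divr_gt0.
exists (rho - 2 * g); split; [lra|lra|move=> K].
have [K' f_ge] := log_regvar_ge regvar_f (ltac:(lra) : rho - g < rho).
apply: filterS (log_le_power_near K (expR_gt0 K') g0) => n log_le.
apply: (@le_trans _ _ (expR (K' + (rho - g) * lnS n))); last by rewrite ler_expR.
rewrite mulrAC; apply: (le_trans (ler_wpM2r (expR_ge0 _) log_le)).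
by rewrite -!expRD ler_expR; lra.
Qed.

End growth_exponent.

Lemma cvg_min0_sub (R : realType) (v : nat -> R) :
  (forall e, 0 < e -> \forall n \near \oo, v n <= e) ->
  Num.min 0 (v n) - v n @[n --> \oo] --> (0 : R).
Proof.
move=> v_le; apply/cvgr0Pnorm_le => e e0; apply: filterS (v_le e e0) => n v_le_e.
by rewrite minEle; case: ifPn => v_ge; [rewrite sub0r normrN ger0_norm|rewrite subrr normr0 ltW].
Qed.

Section probabilities.
Variables (R : realType) (cs : seq nat).
Hypothesis cs_gt0 : all (ltn 0) cs.
Hypothesis size_gt0 : (0 < size cs)%N.
Local Notation h := (size cs).

Let hR : 0 < h%:R :> R. Proof. by rewrite ltr0n. Qed.

Lemma rep_weight_le (s t : R) v : log_regvar s v -> -1 < s -> h%:R * (s + 1) - 1 < t ->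
  exists2 K : R, 0 <= K & forall n, rep_weight (fun k => expR (v k)) cs n <= K * expR (t * lnS n).
Proof.
move=> regvar_v s1 ht.
have [K K0 rep_le] := lattice_equiv_bounded (rep_weight_lattice_equiv regvar_v s1 cs_gt0 size_gt0).
have [K' scale_le] := log_regvar_le (log_regvar_log_scale h regvar_v) ht.
exists (K * expR K'); first by rewrite mulr_ge0 ?expR_ge0// ltW.
move=> n; have := le_trans (ler_norm _) (rep_le n).
rewrite ler_pdivrMr ?expR_gt0// => /le_trans; apply.
by rewrite -mulrA -expRD ler_wpM2l ?(ltW K0)// ler_expR.
Qed.

Variables (rho : R) (f : nat -> R).
Hypothesis rho_gt : -1 < rho.
Hypothesis regvar_f : log_regvar rho f.
Hypothesis gcd_cs : foldr gcdn 0%N cs = 1%N.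
Hypothesis f_le : forall e : R, 0 < e ->
  \forall n \near \oo, f n <= (h%:R - 1) * lnS n + ln (rep_weight_const 0 cs) + e.

Let s : R := (rho + 1) / h%:R - 1.
Let C : R := rep_weight_const s cs.
Let root n : R := h%:R^-1 * (f n + (- (h%:R - 1) * lnS n + - ln C)).

Let s_gt : -1 < s. Proof. by rewrite /s ltrBrDl subrr divr_gt0// -ltrBlDr sub0r. Qed.

Let rho_le : rho <= h%:R - 1.
Proof.
apply: (log_regvar_index_le (K := ln (rep_weight_const 0 cs) + 1) regvar_f).
by apply: filterS (f_le ltr01) => n; lra.
Qed.

Let log_scale_root n : log_scale h root n = f n - ln C.
Proof. by rewrite /log_scale /root; field; exact: lt0r_neq0. Qed.

Let log_regvar_root : log_regvar s root.
Proof.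
have -> : s = h%:R^-1 * (rho + (- (h%:R - 1) + 0)) by rewrite /s; field; exact: lt0r_neq0.
apply: log_regvarZ; apply: log_regvarD regvar_f _; apply: log_regvarD (log_regvarZ_lnS _) _.
by move=> eta e _ /ltW e0; apply: nearW => n k _ _; rewrite subrr mul0r subrr normr0.
Qed.

Let near_root_le (e : R) : 0 < e -> \forall n \near \oo, root n <= e.
Proof.
move=> e0; have s_le0 : s <= 0 by rewrite subr_le0 ler_pdivrMr// mul1r -lerBrDr.
have [s0|s_neq0] := eqVneq s 0.
  by apply: filterS (f_le (mulr_gt0 hR e0)) => n; rewrite /root /C s0 ler_pdivrMl//; lra.
have s_lt0 : s < 0 by rewrite lt_neqAle s_neq0.
have [K root_le] := log_regvar_le log_regvar_root (ltac:(lra) : s < s / 2).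
have s2 : 0 < - (s / 2) by lra.
apply: filterS (near_lnS_ge (K / - (s / 2))) => n; rewrite ler_pdivrMr//.
by have := root_le n; lra.
Qed.

Lemma exists_probability : exists v : nat -> R, [/\ log_regvar ((rho + 1) / h%:R - 1) v,
  forall n, v n <= 0 &
  rep_weight (fun k => expR (v k)) cs n / expR (f n) @[n --> \oo] --> (1 : R)].
Proof.
pose v n := Num.min 0 (root n).
have v_root : v n - root n @[n --> \oo] --> (0 : R) by exact: cvg_min0_sub near_root_le.
have regvar_v : log_regvar s v := log_regvar_cvg log_regvar_root v_root.
exists v; split => // [n|]; first by rewrite ge_min lexx.
have C0 : 0 < C by exact: rep_weight_const_gt0.
have := rep_weight_lattice_equiv regvar_v s_gt cs_gt0 size_gt0.
rewrite gcd_cs /lattice_equiv -/C => equiv.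
have ratio_cvg : rep_weight (fun k => expR (v k)) cs n / expR (log_scale h v n) @[n --> \oo] --> C.
  apply: (eq_fun_cvg (cvgD equiv (cvg_cst C))) => [n|]; last by rewrite add0r.
  by rewrite /= dvd1n !mulr1 subrK.
have correction_cvg : expR (h%:R * (v n - root n) - ln C) @[n --> \oo] --> expR (h%:R * 0 - ln C).
  apply: continuous_cvg; first exact: continuous_expR.
  by apply: cvgB; [apply: cvgM => //; exact: cvg_cst|exact: cvg_cst].
apply: (eq_fun_cvg (cvgM ratio_cvg correction_cvg)) => [n|].
  rewrite /= -!expRN -mulrA -expRD; congr (_ * expR _).
  by rewrite -[f n](subrK (ln C)) -log_scale_root /log_scale; ring.
by rewrite mulr0 sub0r expRN lnK ?posrE// divff// lt0r_neq0.
Qed.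

End probabilities.

Lemma finite_uniform_bound (R : realDomainType) (T : finType) (Q : T -> R -> Prop) :
  (forall x C C', C <= C' -> Q x C -> Q x C') -> (forall x, exists2 C, 0 <= C & Q x C) ->
  exists2 C, 0 <= C & forall x, Q x C.
Proof.
move=> Q_mono Q_ex; have /choice[C C_spec] x : exists C, 0 <= C /\ Q x C.
  by have [C C0 QC] := Q_ex x; exists C.
exists (\sum_x C x) => [|x]; first by apply: sumr_ge0 => x _; have [] := C_spec x.
apply: Q_mono (C_spec x).2; rewrite (bigD1 x)//= lerDl.
by apply: sumr_ge0 => y _; have [] := C_spec y.
Qed.

Lemma mean_reps_lower_level_le (R : realType) (J : finType) (L B : nat) (s t : R) v :
  log_regvar s v -> -1 < s -> L%:R * (s + 1) - 1 < t ->
  exists2 C : R, 0 <= C & forall N (c : J -> nat) m, (0 < #|supp c| <= L)%N ->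
    (\sum_i c i <= B)%N -> (m <= N)%N ->
    mean_reps (fun k => expR (v k)) N c m <= C * expR (t * lnS m).
Proof.
move=> regvar_v s1 Lt.
pose bounded (w : {ffun J -> 'I_B.+1}) (C : R) := (0 < #|supp (weight_of w)| <= L)%N ->
  forall N m, (m <= N)%N ->
  mean_reps (fun k => expR (v k)) N (weight_of w) m <= C * expR (t * lnS m).
have [w C C' CC' C_bound wL N m mN|w|C C0 C_bound] := @finite_uniform_bound R _ bounded.
- by apply: (le_trans (C_bound wL N m mN)); rewrite ler_wpM2r ?expR_ge0.
- have [/andP[w0 wL]|/negP not_wL] := boolP (0 < #|supp (weight_of w)| <= L)%N; last first.
    by exists 0 => // /not_wL.
  pose cs := [seq weight_of w i | i <- enum (supp (weight_of w))].
  have size_cs : size cs = #|supp (weight_of w)| by rewrite size_map -cardE.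
  have cs_gt0 : all (ltn 0) cs.
    by apply/allP => _ /mapP[i wi ->]; move: wi; rewrite mem_enum finset.inE.
  have cs_t : (size cs)%:R * (s + 1) - 1 < t.
    by apply: le_lt_trans Lt; rewrite lerD2r size_cs ler_wpM2r ?ler_nat//; lra.
  have [|K K0 rep_le] := rep_weight_le cs_gt0 _ regvar_v s1 cs_t; first by rewrite size_cs.
  by exists K => // _ N m mN; rewrite mean_reps_rep_weight.
exists C => // N c m cL cB mN.
by have [w cE] := bounded_weights cB; rewrite {c}cE in cL cB *; exact: C_bound.
Qed.

Lemma exists_rep_count_equiv (R : realType) (h : nat) (b : 'I_h -> nat) (rho : R) (f : nat -> R) :
  (0 < h)%N -> (forall i, 0 < b i)%N -> \big[gcdn/0%N]_(i < h) b i = 1%N -> log_regvar rho f ->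
  (forall K : R, \forall n \near \oo, K * (lnS n + 1) <= expR (f n)) ->
  (forall e : R, 0 < e -> \forall n \near \oo,
    f n <= h.-1%:R * lnS n + ln ((h.-1)`!%:R * (\prod_(i < h) b i)%:R)^-1 + e) ->
  exists A : pred nat, (rep_count b A n)%:R / expR (f n) @[n --> \oo] --> (1 : R).
Proof.
move=> h0 b_gt0 b_gcd regvar_f growth f_le; have rho_ge0 := log_growth_index_ge0 regvar_f growth.
pose cs := [seq b i | i <- enum 'I_h].
have size_cs : size cs = h by rewrite size_map -cardE card_ord.
have cs_gt0 : all (ltn 0) cs by apply/allP => _ /mapP[i _ ->]; exact: b_gt0.
have gcd_cs : foldr gcdn 0%N cs = 1%N by rewrite -b_gcd foldrE big_map big_enum.
have hE : h.-1%:R = h%:R - 1 :> R by rewrite -[in RHS](prednK h0) -natr1 addrK.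
have hR : 0 < h%:R :> R by rewrite ltr0n.
have size_gt0 : (0 < size cs)%N by rewrite size_cs.
have rho_gt : -1 < rho by lra.
have const_cs : rep_weight_const (0 : R) cs = ((h.-1)`!%:R * (\prod_(i < h) b i)%:R)^-1.
  by rewrite rep_weight_const0// size_cs big_map big_enum.
have [|v [regvar_v v_le0 mean_cvg]] := exists_probability cs_gt0 size_gt0 rho_gt regvar_f gcd_cs.
  by rewrite const_cs size_cs -hE.
rewrite size_cs in regvar_v.
pose d := (rho + 1) / h%:R; have d0 : 0 < d by rewrite divr_gt0//; lra.
have [theta [theta0 theta_gt W_growth]] := exists_growth_exponent regvar_f growth d0.
have p01 x : 0 <= expR (v x) <= 1 by rewrite expR_ge0 expR_le1 v_le0.
pose z := (theta - (rho - d)) / 2.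
have z0 : 0 < z by rewrite divr_gt0// subr_gt0.
have lower_exponent_lt : h.-1%:R * (d - 1 + 1) - 1 < theta - z.
  have : h%:R * d = rho + 1 by rewrite /d mulrC divfK// lt0r_neq0.
  by rewrite hE subrK mulrBl mul1r /z => ->; lra.
have s1 : -1 < d - 1 by lra.
have [C C0 lower_le] :=
  mean_reps_lower_level_le 'I_h (\sum_i b i)%N regvar_v s1 lower_exponent_lt.
apply: (exists_pred_rep_count_equiv p01 b_gt0 _ _ C0 z0 _ mean_cvg W_growth).
- by move=> m; rewrite -expR0 ler_expR mulr_ge0// lnS_ge0.
- by move=> m n mn; rewrite ler_expR ler_wpM2l// ler_lnS.
- move=> N c m cI cB mN; apply: (le_trans (lower_le N c m cI cB mN)).
  by rewrite -mulrA -expRD -mulrDl.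
Qed.

Section regularly_varying_bounds.
Variables (R : realType) (F : R -> R).
Hypothesis F_gt0 : forall x, 1 <= x -> 0 < F x.

Lemma near_mul_lnS_le : F x / ln x @[x --> +oo] --> +oo ->
  forall K : R, \forall n \near \oo, K * (lnS n + 1) <= F n%:R.
Proof.
move=> /cvgryPge F_growth K.
have F_ge : \forall n \near \oo, 3 * `|K| <= F n%:R / ln n%:R.
  exact: (@cvgr_idn R _ (F_growth (3 * `|K|))).
near=> n.
have n0 : 0 < n%:R :> R by rewrite ltr0n; near: n; exact: nbhs_infty_gt.
have ln_ge1 : 1 <= ln n%:R :> R.
  by rewrite -ler_expR lnK ?posrE//; near: n; exact: nbhs_infty_ger.
have lnS_le : lnS n <= ln n%:R + 1 :> R.
  rewrite -lerBlDl; apply: (le_trans (ler_norm _)).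
  apply: (le_trans (dist_ln_le n0 _ (lexx _))); first by rewrite ler_nat.
  by rewrite -natr1 addrAC subrr add0r normr1 mul1r invf_le1// ler1n -(ltr0n R).
apply: (@le_trans _ _ (3 * `|K| * ln n%:R)); last first.
  by rewrite -ler_pdivlMr; [near: n|lra].
apply: (@le_trans _ _ (`|K| * (lnS n + 1))).
  by rewrite ler_wpM2r ?ler_norm// addr_ge0// lnS_ge0.
by rewrite [3 * _]mulrC -mulrA ler_wpM2l//; lra.
Unshelve. all: by end_near. Qed.

Lemma near_ln_le (d : nat) (C : R) : 0 < C ->
  (exists eps : R -> R, eps x @[x --> +oo] --> (0 : R) /\
    \forall x \near +oo, F x <= (1 + eps x) * (x ^+ d * C)) ->
  forall e : R, 0 < e -> \forall n \near \oo, ln (F n%:R) <= d%:R * lnS n + ln C + e.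
Proof.
move=> C0 [eps [/cvgr0Pnorm_le eps_cvg F_near]] e e0.
have F_le : \forall n \near \oo, F n%:R <= (1 + eps n%:R) * (n%:R ^+ d * C).
  exact: (@cvgr_idn R _ F_near).
have eps_le : \forall n \near \oo, `|eps n%:R| <= e by exact: (@cvgr_idn R _ (eps_cvg e e0)).
near=> n.
have n0 : (0 < n)%N by near: n; exact: nbhs_infty_gt.
have eps_n : eps n%:R <= e by apply: (le_trans (ler_norm _)); near: n.
have e1 : 0 < 1 + e by rewrite addr_gt0.
have pow_gt0 : 0 < n.+1%:R ^+ d * C by rewrite mulr_gt0// exprn_gt0.
have F_le_pow : F n%:R <= (1 + e) * (n.+1%:R ^+ d * C).
  apply: (@le_trans _ _ ((1 + eps n%:R) * (n%:R ^+ d * C))); first by near: n.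
  apply: (@le_trans _ _ ((1 + e) * (n%:R ^+ d * C))).
    by rewrite ler_wpM2r ?lerD2l// mulr_ge0 ?exprn_ge0// ltW.
  by rewrite ler_wpM2l ?(ltW e1)// ler_wpM2r ?(ltW C0)// lerXn2r ?nnegrE// ler_nat.
apply: (@le_trans _ _ (ln ((1 + e) * (n.+1%:R ^+ d * C)))).
  by rewrite ler_ln ?posrE ?mulr_gt0// F_gt0// ler1n.
rewrite lnM ?posrE// lnM ?posrE ?exprn_gt0// lnXn// -[ln n.+1%:R *+ d]mulr_natl -/(lnS n).
by have := le_ln1Dx (ltac:(lra) : -1 < e); lra.
Unshelve. all: by end_near. Qed.

End regularly_varying_bounds.

Theorem theorem1 (R : realType) (h : nat) (b : 'I_h -> nat)
  (h2 : (2 <= h)%N)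
  (bpos : forall i, (0 < b i)%N)
  (bgcd : \big[gcdn/0%N]_(i < h) b i = 1%N)
  (F : R -> R)
  (Freg : regularly_varying F)
  (Flog : (F x / ln x) @[x --> +oo%R] --> +oo)
  (Fup : exists eps : R -> R, eps x @[x --> +oo%R] --> 0 /\
     \forall x \near +oo,
        F x <= (1 + eps x) *
               (x ^+ h.-1 / ((h.-1)`!%:R * (\prod_(i < h) b i)%:R))) :
  exists A : pred nat,
    ((rep_count b A n)%:R / F n%:R) @[n --> \oo] --> (1 : R).
Proof.
have [F_gt0 _] := Freg.
have expR_ln_F : \forall n \near \oo, expR (ln (F n%:R)) = F n%:R.
  by exists 1%N => // n n1; rewrite lnK// posrE F_gt0// ler1n.
have [rho regvar_F] := regularly_varying_log_regvar Freg.
have growth (K : R) : \forall n \near \oo, K * (lnS n + 1) <= expR (ln (F n%:R)).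
  by apply: filterS2 expR_ln_F (near_mul_lnS_le Flog K) => n ->.
have const_gt0 : 0 < ((h.-1)`!%:R * (\prod_(i < h) b i)%:R)^-1 :> R.
  by rewrite invr_gt0 mulr_gt0// ltr0n ?fact_gt0// prodn_gt0.
have F_le := near_ln_le F_gt0 const_gt0 Fup.
have [A A_cvg] := exists_rep_count_equiv (ltnW h2) bpos bgcd regvar_F growth F_le.
exists A; apply: cvg_trans A_cvg; apply: near_eq_cvg.
by apply: filterS expR_ln_F => n ->.
Qed.
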